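(* Let $s\in\mathbb R$, $p>0$ and $N\in\mathbb N$, $N\ge2$, and set $T_N(x)=\sum_{n=1}^N n^{-2s}e^{2\pi i n^2x}$. With implicit constants depending only on $s$ and $p$: \begin{itemize} \item if $s<1/4$: $\|T_N\|_p\simeq N^{1/2-2s}$ for $p<4$; $\|T_N\|_4\simeq N^{1/2-2s}(\log N)^{1/4}$; $\|T_N\|_p\simeq N^{1-2/p-2s}$ for $p>4$; \item if $s=1/4$: $\|T_N\|_p\simeq(\log N)^{1/2}$ for $p<4$; $\|T_N\|_p\simeq N^{1/2-2/p}$ for $p>4$; and $(\log N)^{1/2}\lesssim\|T_N\|_4\lesssim(\log N)^{3/4}$; \item if $1/4<s<1/2$: $\|T_N\|_p\simeq1$ for $p<\frac{2}{1-2s}$; $\|T_N\|_p\simeq N^{1-2/p-2s}$ for $p>\frac{2}{1-2s}$; and for $p=\frac2{1-2s}$, $(\log N)^{1/p}\lesssim\|T_N\|_p\lesssim(\log N)^{1/2}$; \item if $s\ge1/2$: $\|T_N\|_p\simeq1$ for all $p>0$. \end{itemize}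
   Context: $\|\cdot\|_p$ denotes the $L^p(\mathbb T)$ (quasi-)norm on $\mathbb T=\mathbb R/\mathbb Z$. $X\simeq Y$ means $cY\le X\le CY$ with $c,C>0$ independent of $N$. *)

(* Defs.v *)
From Stdlib Require Import Reals.
From Coquelicot Require Import Coquelicot.
Open Scope R_scope.

Definition expi (theta : R) : C := (cos theta, sin theta).

Definition T (s : R) (N : nat) (x : R) : C :=
  sum_n_m (fun n : nat => RtoC (Rpower (INR n) (-2 * s)) * expi (2 * PI * INR (n * n) * x))%C 1 N.

(* t^p for t >= 0, with the convention 0^p = 0 (p > 0) *)
Definition rpow_nn (t p : R) : R := if Rle_dec t 0 then 0 else Rpower t p.

(* L^p(T) quasi-norm on T = R/Z, computed over one period [0,1] *)
Definition Lp_norm (p : R) (f : R -> C) : R :=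
  rpow_nn (RInt (fun x => rpow_nn (Cmod (f x)) p) 0 1) (/ p).

Definition simeq (F G : nat -> R) : Prop :=
  exists c C0 : R, 0 < c /\ 0 < C0 /\
    forall N : nat, (2 <= N)%nat -> c * G N <= F N /\ F N <= C0 * G N.

Definition lesssim (F G : nat -> R) : Prop :=
  exists C0 : R, 0 < C0 /\ forall N : nat, (2 <= N)%nat -> F N <= C0 * G N.

Definition normT (s p : R) (N : nat) : R := Lp_norm p (T s N).

(* Main.v *)
(* Expanding |S|^2 for a Weyl sum S with tent weights of length L gives a bilinear form with kernel e(-2uvx), a Fejer-type sum;
   Dirichlet approximation of x by a/q then yields |S(x)|^2 <= C (L + L^2 / (q (1 + L^2 |x - a/q|))) without any logarithmic loss,
   and integrating over the arcs around the a/q bounds the L^p norm of S. A sharp cutoff is a sum of tents of geometrically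
   decreasing length, and the weights n^(-2s) are inserted by Abel summation on dyadic blocks. When all the blocks contribute
   equally, square-function cancellation between them is obtained by telescoping (1 + |P_j|^2)^(p/2) along the partial sums P_j
   and integrating by parts.

   The lower bounds come from Parseval together with an L^3 upper bound (p < 4), from the neighbourhood |x| <= 1/(6 N^2) of the
   origin, from pairing with sum_m m^(-1/p) e(mx) at the critical exponent, and, for p = 4, from counting the solutions of
   a^2 + b^2 = c^2 + d^2. *)
From HB Require Import structures.
Require Import Defs.
From Stdlib Require Import Reals Lra Lia Psatz.
From mathcomp Require Import all_boot zify.
From Coquelicot Require Import Coquelicot.
Set Implicit Arguments. Unset Strict Implicit. Unset Printing Implicit Defensive.
Delimit Scope R_scope with R.
Delimit Scope C_scope with C.
Open Scope R_scope.

(** The exponent 4 comes out of one sum. When the pointwise bound is raised to the power p/2 > 1 and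
    integrated, an arc around a/q contributes about L^(p-2) q^(-p/2), and q has about q numerators.
    The arcs thus add up to L^(p-2) sum_{q <= 4L} q^(1-p/2): a convergent sum for p > 4, a logarithm
    at p = 4, and in total L^(p/2), the size of the generic term, for 2 < p < 4. Exponents p <= 2
    are reached by comparison of norms. A tent is a convolution of two intervals: after
    Cauchy-Schwarz its kernel decays like the inverse square of the distance to the integers, which
    is summable over residues mod q. A sharp cutoff would leave the first power and a logarithm. The
    1 in 1 + |P_j|^2 keeps the power smooth where P_j vanishes. Block j lives at frequencies about
    4^j, so the integration by parts trades a derivative of size 4^j, of the lower blocks, for an
    antiderivative of size 4^(-j). The triangle inequality over log N blocks of equal size would
    cost log N; the telescoping costs its square root. *)

HB.instance Definition _ := Monoid.isComLaw.Build R 0 Rplus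
  (fun x y z => esym (Rplus_assoc x y z)) Rplus_comm Rplus_0_l.
HB.instance Definition _ := Monoid.isMulLaw.Build R 0 Rmult Rmult_0_l Rmult_0_r.
HB.instance Definition _ := Monoid.isAddLaw.Build R Rmult Rplus
   Rmult_plus_distr_r Rmult_plus_distr_l.
HB.instance Definition _ := Monoid.isComLaw.Build C (RtoC 0) Cplus
   Cplus_assoc Cplus_comm Cplus_0_l.
HB.instance Definition _ := Monoid.isMulLaw.Build C (RtoC 0) Cmult Cmult_0_l Cmult_0_r.
HB.instance Definition _ := Monoid.isAddLaw.Build C Cmult Cplus
   Cmult_plus_distr_r Cmult_plus_distr_l.

Notation "\rsum_ ( i <- r ) F" := (\big[Rplus/0]_(i <- r) F%R)
  (at level 36, F at level 36, i, r at level 50) : R_scope.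
Notation "\rsum_ ( m <= i < n ) F" := (\big[Rplus/0]_(m%N <= i < n%N) F%R)
  (at level 36, F at level 36, i, m, n at level 50) : R_scope.
Notation "\rsum_ ( i < n ) F" := (\big[Rplus/0]_(i < n%N) F%R)
  (at level 36, F at level 36, i, n at level 50) : R_scope.
Notation "\rsum_ ( i < n | P ) F" := (\big[Rplus/0]_(i < n%N | P%B) F%R)
  (at level 36, F at level 36, i, n at level 50) : R_scope.
Notation "\csum_ ( m <= i < n ) F" := (\big[Cplus/RtoC 0]_(m%N <= i < n%N) F%C)
  (at level 36, F at level 36, i, m, n at level 50) : C_scope.
Notation "\csum_ ( i < n ) F" := (\big[Cplus/RtoC 0]_(i < n%N) F%C)
  (at level 36, F at level 36, i, n at level 50) : C_scope.
Notation "\csum_ ( i <- r ) F" := (\big[Cplus/RtoC 0]_(i <- r) F%C)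
  (at level 36, F at level 36, i, r at level 50) : C_scope.

Notation pw := rpow_nn.

(** * Finite sums of real and complex numbers *)

Lemma rsum_le (I : Type) (r : seq I) (P : pred I) (F G : I -> R) :
  (forall i, P i -> F i <= G i) ->
  \big[Rplus/0]_(i <- r | P i) F i <= \big[Rplus/0]_(i <- r | P i) G i.
Proof.
move=> h; apply: (big_ind2 (fun x y => x <= y)) => //; first exact: Rle_refl.
by move=> *; apply: Rplus_le_compat.
Qed.

Lemma rsum_le_seq (I : eqType) (r : seq I) (F G : I -> R) :
  {in r, forall i, F i <= G i} -> \rsum_(i <- r) F i <= \rsum_(i <- r) G i.
Proof. by move=> h; rewrite big_seq [X in _ <= X]big_seq; apply: rsum_le. Qed.

Lemma rsum_nat_le m n (F G : nat -> R) :
  (forall i, (m <= i < n)%N -> F i <= G i) ->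
  \rsum_(m <= i < n) F i <= \rsum_(m <= i < n) G i.
Proof. by move=> h; apply: rsum_le_seq => i; rewrite mem_index_iota; apply: h. Qed.

Lemma rsum_ge0 (I : Type) (r : seq I) (P : pred I) (F : I -> R) :
  (forall i, P i -> 0 <= F i) -> 0 <= \big[Rplus/0]_(i <- r | P i) F i.
Proof.
move=> h; apply: (big_ind (fun x => 0 <= x)) => //; first exact: Rle_refl.
by move=> *; lra.
Qed.

Lemma rsum_const (I : Type) (r : seq I) (c : R) : \rsum_(i <- r) c = INR (size r) * c.
Proof.
elim: r => [|i r ih]; first by rewrite big_nil /=; ring.
by rewrite big_cons ih /size -/size S_INR; ring.
Qed.

Lemma rsum_nat_const m n (c : R) : (m <= n)%N -> \rsum_(m <= i < n) c = (INR n - INR m) * c.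
Proof. by move=> h; rewrite rsum_const size_iota minus_INR //; apply/leP. Qed.

Lemma rsum_ord_const n (c : R) : \rsum_(i < n) c = INR n * c.
Proof. by rewrite -(big_mkord xpredT (fun=> c)) rsum_nat_const //=; ring. Qed.

Lemma rsumMl (I : Type) (r : seq I) (P : pred I) c (F : I -> R) :
  \big[Rplus/0]_(i <- r | P i) (c * F i) = c * \big[Rplus/0]_(i <- r | P i) F i.
Proof. by rewrite big_distrr. Qed.

Lemma rsumMr (I : Type) (r : seq I) (P : pred I) c (F : I -> R) :
  \big[Rplus/0]_(i <- r | P i) (F i * c) = \big[Rplus/0]_(i <- r | P i) F i * c.
Proof. by rewrite big_distrl. Qed.

Lemma csumMl (I : Type) (r : seq I) (P : pred I) c (F : I -> C) :
  \big[Cplus/RtoC 0]_(i <- r | P i) (c * F i)%C = (c * \big[Cplus/RtoC 0]_(i <- r | P i) F i)%C.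
Proof. by rewrite big_distrr. Qed.

Lemma rsumD (I : Type) (r : seq I) (P : pred I) (F G : I -> R) :
  \big[Rplus/0]_(i <- r | P i) (F i + G i) =
  \big[Rplus/0]_(i <- r | P i) F i + \big[Rplus/0]_(i <- r | P i) G i.
Proof. exact: big_split. Qed.

Lemma csumD (I : Type) (r : seq I) (P : pred I) (F G : I -> C) :
  \big[Cplus/RtoC 0]_(i <- r | P i) (F i + G i)%C =
  (\big[Cplus/RtoC 0]_(i <- r | P i) F i + \big[Cplus/RtoC 0]_(i <- r | P i) G i)%C.
Proof. exact: big_split. Qed.

Lemma rsumN (I : Type) (r : seq I) (P : pred I) (F : I -> R) :
  \big[Rplus/0]_(i <- r | P i) - F i = - \big[Rplus/0]_(i <- r | P i) F i.
Proof.
by apply: (big_ind2 (fun x y => x = - y)) => // [|x1 x2 y1 y2 -> ->]; ring.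
Qed.

Lemma rsumB (I : Type) (r : seq I) (P : pred I) (F G : I -> R) :
  \big[Rplus/0]_(i <- r | P i) (F i - G i) =
  \big[Rplus/0]_(i <- r | P i) F i - \big[Rplus/0]_(i <- r | P i) G i.
Proof. by rewrite /Rminus -rsumN -rsumD. Qed.

Lemma rsum_subrange m n a b (F : nat -> R) : (m <= a)%N -> (b <= n)%N ->
  (forall i, 0 <= F i) -> \rsum_(a <= i < b) F i <= \rsum_(m <= i < n) F i.
Proof.
move=> hm hn F0; case: (leqP a b) => hab; last by rewrite big_geq ?(ltnW hab) //; exact: rsum_ge0.
have g0 u v : 0 <= \rsum_(u <= i < v) F i by exact: rsum_ge0.
have e1 : \rsum_(m <= i < n) F i = \rsum_(m <= i < a) F i + \rsum_(a <= i < n) F i.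
  by rewrite (big_cat_nat (n := a)) //; exact: leq_trans hn.
have e2 : \rsum_(a <= i < n) F i = \rsum_(a <= i < b) F i + \rsum_(b <= i < n) F i.
  by rewrite (big_cat_nat (n := b)).
by rewrite e1 e2; have := g0 m a; have := g0 b n; lra.
Qed.

Lemma rsum_range_sub n a b (P : pred nat) (F : nat -> R) : (b <= n)%N ->
  (forall i, (a <= i < b)%N -> P i) -> (forall i, 0 <= F i) ->
  \rsum_(a <= i < b) F i <= \rsum_(i < n | P i) F i.
Proof.
move=> hn hP F0; rewrite -(big_mkord P) [X in _ <= X]big_mkcond.
have -> : \rsum_(a <= i < b) F i = \rsum_(a <= i < b) (if P i then F i else 0).
  by apply: eq_big_nat => i /hP ->.
apply: (@rsum_subrange 0 n a b (fun i => if P i then F i else 0)) => // i.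
by case: ifP => _; [exact: F0|exact: Rle_refl].
Qed.

Lemma Cmod_csum (I : Type) (r : seq I) (P : pred I) (F : I -> C) :
  Cmod (\big[Cplus/RtoC 0]_(i <- r | P i) F i) <= \big[Rplus/0]_(i <- r | P i) Cmod (F i).
Proof.
apply: (big_ind2 (fun x y => Cmod x <= y)).
- by rewrite Cmod_0; apply: Rle_refl.
- move=> x1 x2 y1 y2 h1 h2; apply: Rle_trans (Cmod_triangle _ _) _.
  exact: Rplus_le_compat.
- by move=> i _; apply: Rle_refl.
Qed.

Lemma fst_csum (I : Type) (r : seq I) (P : pred I) (F : I -> C) :
  fst (\big[Cplus/RtoC 0]_(i <- r | P i) F i) = \big[Rplus/0]_(i <- r | P i) fst (F i).
Proof. by apply: (big_morph fst (id1 := 0) (op1 := Rplus)) => [[? ?] [? ?]|]. Qed.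

Lemma snd_csum (I : Type) (r : seq I) (P : pred I) (F : I -> C) :
  snd (\big[Cplus/RtoC 0]_(i <- r | P i) F i) = \big[Rplus/0]_(i <- r | P i) snd (F i).
Proof. by apply: (big_morph snd (id1 := 0) (op1 := Rplus)) => [[? ?] [? ?]|]. Qed.

(** * Nonnegative powers *)

Lemma pwE t p : 0 < t -> pw t p = Rpower t p.
Proof. by rewrite /rpow_nn => h; case: Rle_dec => // h'; lra. Qed.

Lemma pw0 t p : t <= 0 -> pw t p = 0.
Proof. by rewrite /rpow_nn => h; case: Rle_dec. Qed.

Lemma Rpower_gt0 t p : 0 < Rpower t p. Proof. exact: exp_pos. Qed.

Lemma pw_ge0 t p : 0 <= pw t p.
Proof.
by rewrite /rpow_nn; case: Rle_dec => h; [lra|left; exact: Rpower_gt0].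
Qed.

Lemma pw_gt0 t p : 0 < t -> 0 < pw t p.
Proof. by move=> h; rewrite pwE //; exact: Rpower_gt0. Qed.

Lemma pw_le s t p : 0 <= p -> s <= t -> pw s p <= pw t p.
Proof.
move=> hp hst; case: (Rle_dec s 0) => hs; first by rewrite pw0 //; apply: pw_ge0.
by rewrite !pwE; try lra; apply: Rle_Rpower_l; lra.
Qed.

Lemma pwM s t p : 0 <= s -> 0 <= t -> pw (s * t) p = pw s p * pw t p.
Proof.
have p00 : pw 0 p = 0 by apply: pw0; lra.
move=> [hs|<-]; last by rewrite Rmult_0_l p00 Rmult_0_l.
move=> [ht|<-]; last by rewrite Rmult_0_r p00 Rmult_0_r.
by rewrite !pwE ?Rpower_mult_distr //; apply: Rmult_lt_0_compat.
Qed.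

Lemma pwD t a b : pw t (a + b) = pw t a * pw t b.
Proof.
case: (Rle_dec t 0) => h; first by rewrite !pw0 ?Rmult_0_l.
by rewrite !pwE ?Rpower_plus; lra.
Qed.

Lemma pwA t a b : pw (pw t a) b = pw t (a * b).
Proof.
case: (Rle_dec t 0) => h; first by rewrite (pw0 _ h) !pw0 //; lra.
rewrite (pwE (t := pw t a)); last by apply: pw_gt0; lra.
by rewrite !pwE ?Rpower_mult; lra.
Qed.

Lemma pw_1 t : 0 <= t -> pw t 1 = t.
Proof. by move=> [h|<-]; [rewrite pwE // Rpower_1|rewrite pw0 //; lra]. Qed.

Lemma pw_2 t : 0 <= t -> pw t 2 = t * t.
Proof. by move=> h; rewrite -{2 3}(pw_1 h) -pwD; congr pw; ring. Qed.

Lemma pw_sub1 t a : 0 <= t -> pw t a = pw t (a - 1) * t.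
Proof. by move=> ht; rewrite -{3}(pw_1 ht) -pwD; congr pw; ring. Qed.

Lemma pw_sub2 t a : 0 <= t -> pw t a = pw t (a - 2) * (t * t).
Proof. by move=> ht; rewrite -pw_2 // -pwD; congr pw; ring. Qed.

Lemma pw_half t : 0 <= t -> pw t (1/2) * pw t (1/2) = t.
Proof. by move=> ht; rewrite -pwD (_ : 1/2 + 1/2 = 1) ?pw_1 //; field. Qed.

Lemma pw_z t : 0 < t -> pw t 0 = 1.
Proof. by move=> h; rewrite pwE // Rpower_O. Qed.

Lemma pw1 p : pw 1 p = 1.
Proof. by rewrite pwE ?/Rpower ?ln_1 ?Rmult_0_r ?exp_0 //; lra. Qed.

Lemma pw_inv t p : 0 < t -> pw (/ t) p = / pw t p.
Proof.
move=> h; apply: (Rmult_eq_reg_r (pw t p)); last by have := pw_gt0 p h; lra.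
have hi := Rinv_0_lt_compat _ h.
rewrite -pwM; try lra; rewrite !Rinv_l ?pw1 //; first by have := pw_gt0 p h; lra.
by lra.
Qed.

Lemma pwN t p : 0 < t -> pw t (- p) = / pw t p.
Proof. by move=> h; rewrite !pwE // Rpower_Ropp. Qed.

Lemma pwV t p : 0 < p -> 0 <= t -> pw (pw t p) (/ p) = t.
Proof. by move=> hp ht; rewrite pwA Rinv_r ?pw_1 //; lra. Qed.

Lemma pw_le1 t p : 0 <= p -> t <= 1 -> pw t p <= 1.
Proof. by move=> hp ht; rewrite -(pw1 p); apply: pw_le. Qed.

Lemma pw_ge1 t p : 0 <= p -> 1 <= t -> 1 <= pw t p.
Proof. by move=> hp ht; rewrite -(pw1 p); apply: pw_le. Qed.

Lemma pw_le_e t a b : 1 <= t -> a <= b -> pw t a <= pw t b.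
Proof. by move=> ht hab; rewrite !pwE; try lra; apply: Rle_Rpower; lra. Qed.

(** At 0 the convention [pw 0 p = 0] is the continuous value because [p] is positive, with modulus
    of continuity e^(1/p). *)
Lemma continuous_pw t p : 0 < p -> continuous (fun t => pw t p) t.
Proof.
move=> hp; case: (Rtotal_order t 0) => [ht|[->|ht]].
- apply: (continuous_ext_loc _ (fun=> 0)); last exact: continuous_const.
  have h : 0 < - t by lra.
  exists (mkposreal _ h) => y; rewrite /ball /= /AbsRing_ball /abs /minus /plus /opp /=.
  by move/Rabs_def2 => [? ?]; rewrite pw0 //; lra.
- apply/continuity_pt_filterlim => e he.
  exists (pw e (/ p)); split; first by apply: pw_gt0.
  move=> x [_]; rewrite /dist /= /R_dist (pw0 (t := 0)); try lra.
  rewrite !Rminus_0_r => hx.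
  rewrite Rabs_pos_eq; last exact: pw_ge0.
  case: (Rle_dec x 0) => h0; first by rewrite pw0.
  rewrite Rabs_pos_eq in hx; try lra.
  have ep := pw_gt0 (/ p) he.
  have -> : e = pw (pw e (/ p)) p by rewrite pwA Rinv_l ?pw_1; lra.
  rewrite pwE; try lra; rewrite [X in _ < X]pwE //.
  by apply: Rlt_Rpower_l => //; lra.
- apply: (continuous_ext_loc _ (fun t => exp (p * ln t))).
    exists (mkposreal _ ht) => y; rewrite /ball /= /AbsRing_ball /abs /minus /plus /opp /=.
    by move/Rabs_def2 => [? ?]; rewrite pwE //; lra.
  apply: (continuous_comp (fun t => p * ln t) exp).
    apply: (@continuous_mult R_UniformSpace); first exact: continuous_const.
    exact: continuous_ln.
  exact: continuous_exp.
Qed.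

(** The tangent of [exp] at [th * a] lies below the graph; averaging this bound at [a] and at 0 with
    weights [th] and [1 - th] cancels the linear terms. *)
Lemma exp_convex_0 a th : 0 <= th <= 1 -> exp (th * a) <= th * exp a + (1 - th).
Proof.
move=> [h0 h1]; set l := th * a.
have e1 : exp l * (1 + (a - l)) <= exp a.
  have -> : exp a = exp l * exp (a - l) by rewrite -exp_plus; congr exp; ring.
  apply: Rmult_le_compat_l; first by left; apply: exp_pos.
  exact: exp_ineq1_le.
have e2 : exp l * (1 + (0 - l)) <= 1.
  have e0 : exp l * exp (0 - l) = 1 by rewrite -exp_plus -exp_0; congr exp; ring.
  rewrite -[X in _ <= X]e0.
  apply: Rmult_le_compat_l; first by left; apply: exp_pos.
  exact: exp_ineq1_le.
have -> : exp l = th * (exp l * (1 + (a - l))) + (1 - th) * (exp l * (1 + (0 - l))).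
  by rewrite /l; ring.
apply: Rplus_le_compat; first by apply: Rmult_le_compat_l.
by rewrite -[X in _ <= X]Rmult_1_r; apply: Rmult_le_compat_l; lra.
Qed.

(** The preceding convexity bound with [th = / p] at the point [p * ln t]. *)
Lemma bernoulli_pw t p : 1 <= p -> 0 <= t -> 1 + p * (t - 1) <= pw t p.
Proof.
move=> hp [ht|<-]; last by rewrite pw0; lra.
rewrite pwE // /Rpower.
have hth : 0 <= / p <= 1.
  split; first by left; apply: Rinv_0_lt_compat; lra.
  by rewrite -Rinv_1; apply: Rinv_le_contravar; lra.
have := exp_convex_0 (p * ln t) hth.
have -> : / p * (p * ln t) = ln t by field; lra.
rewrite exp_ln // => h.
have := Rmult_le_compat_l p _ _ _ h.
have -> : p * (/ p * exp (p * ln t) + (1 - / p)) = exp (p * ln t) + p - 1 by field; lra.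
by lra.
Qed.

(** Bernoulli's inequality at [t / m], rescaled by m^p. *)
Lemma pw_tangent t m p : 1 <= p -> 0 <= t -> 0 < m ->
  pw m p + p * pw m (p - 1) * (t - m) <= pw t p.
Proof.
move=> hp ht hm.
have htm : 0 <= t / m by apply: Rdiv_le_0_compat.
have := bernoulli_pw hp htm.
move/(Rmult_le_compat_l _ _ _ (pw_ge0 m p)).
rewrite -pwM; try lra.
have -> : m * (t / m) = t by field; lra.
have -> : pw m p = pw m (p - 1) * m.
  by rewrite -{3}(pw_1 (t := m)) -?pwD; try lra; congr pw; ring.
have -> : pw m (p - 1) * m * (1 + p * (t / m - 1)) =
  pw m (p - 1) * m + p * pw m (p - 1) * (t - m) by field; lra.
by [].
Qed.

(** Jensen's inequality for the values [F i / A i] with weights [A i]: the tangent bounds at the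
    mean [m / S] are summed, and their linear terms cancel. With norm bounds as weights it becomes
    Minkowski's inequality after integration. *)
Lemma jensen_pw (I : eqType) (r : seq I) (F A : I -> R) p :
  1 <= p -> {in r, forall i, 0 <= F i} -> {in r, forall i, 0 < A i} ->
  0 < \rsum_(i <- r) A i ->
  pw (\rsum_(i <- r) F i) p <=
  pw (\rsum_(i <- r) A i) (p - 1) * \rsum_(i <- r) (pw (A i) (1 - p) * pw (F i) p).
Proof.
move=> hp hF hA; set S := \rsum_(i <- r) A i; set m := \rsum_(i <- r) F i => hS.
have hRHS : 0 <= \rsum_(i <- r) (pw (A i) (1 - p) * pw (F i) p).
  by apply: rsum_ge0 => i _; apply: Rmult_le_pos; apply: pw_ge0.
case: (Rle_dec m 0) => hm.
  by rewrite pw0 //; apply: Rmult_le_pos => //; apply: pw_ge0.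
have hmS : 0 < m / S by apply: Rdiv_lt_0_compat; lra.
set k := pw (m / S) p; set k' := p * pw (m / S) (p - 1).
have key : \rsum_(i <- r) (A i * k + k' * (F i - A i * (m / S))) <=
   \rsum_(i <- r) (pw (A i) (1 - p) * pw (F i) p).
  apply: rsum_le_seq => i hi; have hAi := hA _ hi; have hFi := hF _ hi.
  have hd : 0 <= F i / A i by apply: Rdiv_le_0_compat.
  have := pw_tangent hp hd hmS; rewrite -/k -/k'.
  move/(Rmult_le_compat_l _ _ _ (Rlt_le _ _ hAi)).
  have -> : A i * (k + k' * (F i / A i - m / S)) = A i * k + k' * (F i - A i * (m / S)).
    by field; lra.
  move=> h; apply: Rle_trans h _; right.
  have -> : pw (F i) p = pw (A i) p * pw (F i / A i) p.
    by rewrite -pwM; try lra; congr pw; field; lra.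
  rewrite -Rmult_assoc -pwD; congr (_ * _).
  by rewrite -{1}(pw_1 (t := A i)); [congr pw; ring|lra].
rewrite rsumD rsumMr rsumMl rsumB rsumMr -/S -/m in key.
have e : m - S * (m / S) = 0 by field; lra.
rewrite e Rmult_0_r Rplus_0_r in key.
apply: Rle_trans (Rmult_le_compat_l _ _ _ (pw_ge0 _ _) key); right.
have -> : pw S (p - 1) * (S * k) = pw S (p - 1) * pw S 1 * k.
  by rewrite pw_1; [ring|lra].
rewrite -pwD /k; have -> : p - 1 + 1 = p by ring.
by rewrite -pwM; [congr pw; field; lra|lra|lra].
Qed.

(** * Integrals of continuous functions over one period *)

Definition cont (g : R -> R) := forall x, continuous g x.

Lemma cont_const c : cont (fun=> c). Proof. by move=> x; exact: continuous_const. Qed.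

Lemma cont_id : cont (fun x => x). Proof. by move=> x; exact: continuous_id. Qed.

Lemma contD f g : cont f -> cont g -> cont (fun x => f x + g x).
Proof. by move=> hf hg x; exact: (@continuous_plus R_UniformSpace). Qed.

Lemma contM f g : cont f -> cont g -> cont (fun x => f x * g x).
Proof. by move=> hf hg x; exact: (@continuous_mult R_UniformSpace). Qed.

Lemma cont_scal c f : cont f -> cont (fun x => c * f x).
Proof. by move=> hf; apply: contM => //; exact: cont_const. Qed.

Lemma cont_lin c : cont (fun x => c * x).
Proof. by apply: cont_scal; exact: cont_id. Qed.

Lemma contN f : cont f -> cont (fun x => - f x).
Proof. by move=> hf x; exact: (@continuous_opp R_UniformSpace). Qed.

Lemma contB f g : cont f -> cont g -> cont (fun x => f x - g x).
Proof. by move=> hf hg; apply: contD => //; apply: contN. Qed.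

Lemma cont_comp f g : cont f -> cont g -> cont (fun x => g (f x)).
Proof. by move=> hf hg x; apply: continuous_comp. Qed.

Lemma cont_ext f g : (forall x, f x = g x) -> cont f -> cont g.
Proof. by move=> h hf x; apply: (continuous_ext f g) => //; exact: hf. Qed.

Lemma cont_pw g p : 0 < p -> cont g -> cont (fun x => pw (g x) p).
Proof. by move=> hp hg; apply: (cont_comp (g := fun t => pw t p)) => // t; exact: continuous_pw. Qed.

Lemma cont_sqrt g : cont g -> cont (fun x => sqrt (g x)).
Proof. by move=> hg; apply: (cont_comp (g := sqrt)) => // t; exact: continuous_sqrt. Qed.

Lemma cont_cos g : cont g -> cont (fun x => cos (g x)).
Proof. by move=> hg; apply: (cont_comp (g := cos)) => // t; exact: continuous_cos. Qed.

Lemma cont_sin g : cont g -> cont (fun x => sin (g x)).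
Proof. by move=> hg; apply: (cont_comp (g := sin)) => // t; exact: continuous_sin. Qed.

Lemma cont_abs g : cont g -> cont (fun x => Rabs (g x)).
Proof. by move=> hg; apply: (cont_comp (g := Rabs)) => // t; exact: continuous_Rabs. Qed.

Lemma cont_rsum (I : Type) (r : seq I) (P : pred I) (F : I -> R -> R) :
  (forall i, P i -> cont (F i)) -> cont (fun x => \big[Rplus/0]_(i <- r | P i) F i x).
Proof.
move=> h; elim: r => [|i r ih].
  by apply: (@cont_ext (fun=> 0)) => [x|]; [rewrite big_nil|exact: cont_const].
case hP: (P i).
  apply: (@cont_ext (fun x => F i x + \big[Rplus/0]_(i <- r | P i) F i x)).
    by move=> x; rewrite big_cons hP.
  by apply: contD => //; apply: h.
by apply: cont_ext ih => x; rewrite big_cons hP.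
Qed.

Lemma cont_ex_RInt g a b : cont g -> ex_RInt g a b.
Proof. by move=> h; apply: ex_RInt_continuous => x _; exact: h. Qed.

Lemma RInt_le01 f g : cont f -> cont g ->
  (forall x, 0 <= x <= 1 -> f x <= g x) -> RInt f 0 1 <= RInt g 0 1.
Proof.
move=> hf hg h; apply: RInt_le; [lra|exact: cont_ex_RInt|exact: cont_ex_RInt|].
by move=> x hx; apply: h; lra.
Qed.

Lemma RInt_eq01 (f g : R -> R) : (forall x, f x = g x) -> RInt f 0 1 = RInt g 0 1.
Proof. by move=> h; apply: RInt_ext => x _. Qed.

Lemma RInt_ge01 f : cont f -> (forall x, 0 <= f x) -> 0 <= RInt f 0 1.
Proof.
by move=> hf h; apply: RInt_ge_0; [lra|exact: cont_ex_RInt|move=> x _; exact: h].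
Qed.

Lemma RInt_const01 c : RInt (fun=> c : R) 0 1 = c :> R.
Proof. by rewrite (@RInt_const R_CompleteNormedModule) /scal /= /mult /=; ring. Qed.

Lemma RInt_D f g a b : cont f -> cont g ->
  RInt (fun x => f x + g x) a b = RInt f a b + RInt g a b.
Proof. by move=> hf hg; rewrite RInt_plus //; exact: cont_ex_RInt. Qed.

Lemma RInt_Ml c f a b : cont f -> RInt (fun x => c * f x) a b = c * RInt f a b.
Proof. by move=> hf; rewrite (RInt_scal f) //; exact: cont_ex_RInt. Qed.

Lemma RInt_rsum (I : Type) (r : seq I) (P : pred I) (F : I -> R -> R) a b :
  (forall i, P i -> cont (F i)) ->
  RInt (fun x => \big[Rplus/0]_(i <- r | P i) F i x) a b =
  \big[Rplus/0]_(i <- r | P i) RInt (F i) a b.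
Proof.
move=> h; elim: r => [|i r ih].
  rewrite big_nil (RInt_ext _ (fun=> 0)) => [|x _]; last by rewrite big_nil.
  by rewrite (@RInt_const R_CompleteNormedModule) /scal /= /mult /=; ring.
rewrite big_cons; case hP: (P i).
  rewrite -ih -RInt_D; [|exact: h|exact: cont_rsum].
  by apply: RInt_ext => x _; rewrite big_cons hP.
by rewrite -ih; apply: RInt_ext => x _; rewrite big_cons hP.
Qed.

(** Says that the L^p norm of [g] is at most [a], in p-th powers so that no root is extracted.
    Strict positivity of [a] lets norm bounds serve as weights in [jensen_pw]. *)
Definition Lr p (g : R -> R) a :=
  cont g /\ 0 < a /\ RInt (fun x => pw (g x) p) 0 1 <= pw a p.

Lemma Lr_dom p g h a : 0 < p -> cont g ->
  (forall x, 0 <= x <= 1 -> g x <= h x) -> Lr p h a -> Lr p g a.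
Proof.
move=> hp hg hgh [hh [ha hi]]; split => //; split => //; apply: Rle_trans hi.
apply: RInt_le01; [exact: cont_pw|exact: cont_pw|move=> x hx].
by apply: pw_le; [lra|apply: hgh].
Qed.

Lemma Lr_le p g a b : 0 < p -> a <= b -> Lr p g a -> Lr p g b.
Proof.
move=> hp hab [hg [ha hi]]; split => //; split; first by lra.
by apply: Rle_trans hi _; apply: pw_le; lra.
Qed.

Lemma Lr_scal p c g a : 0 < p -> 0 < c -> (forall x, 0 <= g x) ->
  Lr p g a -> Lr p (fun x => c * g x) (c * a).
Proof.
move=> hp hc h0 [hg [ha hi]]; split; first by exact: cont_scal.
split; first exact: Rmult_lt_0_compat.
rewrite (RInt_eq01 (g := fun x => pw c p * pw (g x) p)); last first.
  by move=> x; rewrite pwM //; lra.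
rewrite RInt_Ml; last exact: cont_pw.
by rewrite pwM; try lra; apply: Rmult_le_compat_l => //; exact: pw_ge0.
Qed.

(** Minkowski's inequality: with the bounds [a i] as Jensen weights, each integral contributes at
    most a_i^(1-p) a_i^p = a_i, so the total is S^(p-1) S. *)
Lemma Lr_sum (I : eqType) (r : seq I) p (g : I -> R -> R) (a : I -> R) :
  1 <= p -> (forall i x, 0 <= g i x) -> {in r, forall i, Lr p (g i) (a i)} ->
  0 < \rsum_(i <- r) a i ->
  Lr p (fun x => \rsum_(i <- r) g i x) (\rsum_(i <- r) a i).
Proof.
move=> hp g0 hg; set S := \rsum_(i <- r) a i => hS.
have hc : cont (fun x => \rsum_(i <- r) g i x).
  apply: (@cont_ext (fun x => \big[Rplus/0]_(i <- r | i \in r) g i x)).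
    by move=> x; rewrite -big_seq.
  by apply: cont_rsum => i /hg [].
split => //; split => //.
pose h x := pw S (p - 1) * \big[Rplus/0]_(i <- r | i \in r) (pw (a i) (1 - p) * pw (g i x) p).
have hch : forall i, i \in r -> cont (fun x => pw (a i) (1 - p) * pw (g i x) p).
  move=> i hi; apply: cont_scal.
  by apply: cont_pw; [lra|case: (hg _ hi)].
apply: (@Rle_trans _ (RInt h 0 1)).
  apply: RInt_le01; [by apply: cont_pw => //; lra| |move=> x _].
    by apply: cont_scal; apply: cont_rsum.
  rewrite /h -big_seq; apply: jensen_pw => // i hi.
  by case: (hg _ hi) => _ [].
rewrite RInt_Ml ?RInt_rsum //; last by apply: cont_rsum.
rewrite (@pw_sub1 S p); last lra.
apply: Rmult_le_compat_l; first exact: pw_ge0.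
rewrite /S [X in _ <= X]big_seq; apply: rsum_le => i hi.
have [hgi [hai hii]] := hg _ hi.
rewrite RInt_Ml; last by apply: cont_pw => //; lra.
apply: Rle_trans (Rmult_le_compat_l _ _ _ (pw_ge0 _ _) hii) _; right.
by rewrite -pwD -[RHS]pw_1; [congr pw; ring|lra].
Qed.

Definition contC (f : R -> C) := cont (fun x => fst (f x)) /\ cont (fun x => snd (f x)).

Lemma contC_Cmod f : contC f -> cont (fun x => Cmod (f x)).
Proof.
move=> [h1 h2]; rewrite /Cmod; apply: cont_sqrt.
by apply: contD; apply: (cont_comp (g := fun t => t ^ 2)) => // t;
  apply: (@ex_derive_continuous R_AbsRing R_NormedModule); auto_derive.
Qed.

Lemma contC_sum (I : Type) (r : seq I) (P : pred I) (F : I -> R -> C) :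
  (forall i, P i -> contC (F i)) -> contC (fun x => \big[Cplus/RtoC 0]_(i <- r | P i) F i x).
Proof.
move=> h; split.
  apply: (@cont_ext (fun x => \big[Rplus/0]_(i <- r | P i) fst (F i x))).
    by move=> x; rewrite fst_csum.
  by apply: cont_rsum => i /h [].
apply: (@cont_ext (fun x => \big[Rplus/0]_(i <- r | P i) snd (F i x))).
  by move=> x; rewrite snd_csum.
by apply: cont_rsum => i /h [].
Qed.

Lemma contC_M f g : contC f -> contC g -> contC (fun x => (f x * g x)%C).
Proof. by move=> [a b] [c d]; split; [apply: contB|apply: contD]; apply: contM. Qed.

Lemma contC_const c : contC (fun=> c).
Proof. by split; apply: cont_const. Qed.

Lemma contC_ext f g : (forall x, f x = g x) -> contC f -> contC g.
Proof. by move=> h [h1 h2]; split; [apply: cont_ext h1|apply: cont_ext h2] => x /=; rewrite h. Qed.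

Lemma contC_expi g : cont g -> contC (fun x => expi (g x)).
Proof. by move=> h; split; [apply: cont_cos|apply: cont_sin]. Qed.

Definition Lc p (f : R -> C) a := contC f /\ Lr p (fun x => Cmod (f x)) a.

Lemma Lc_ext p f g a : (forall x, f x = g x) -> Lc p f a -> Lc p g a.
Proof.
move=> h [hf [hc [ha hi]]]; have hg := contC_ext h hf.
split => //; split; first exact: contC_Cmod.
split => //; apply: Rle_trans hi; right; apply: RInt_eq01 => x; by rewrite h.
Qed.

Lemma Lc_le p f a b : 0 < p -> a <= b -> Lc p f a -> Lc p f b.
Proof. by move=> hp hab [hf hl]; split => //; apply: Lr_le hl. Qed.

Lemma Lc_sum (I : eqType) (r : seq I) p (f : I -> R -> C) (a : I -> R) :
  1 <= p -> {in r, forall i, Lc p (f i) (a i)} -> 0 < \rsum_(i <- r) a i ->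
  Lc p (fun x => \big[Cplus/RtoC 0]_(i <- r) f i x) (\rsum_(i <- r) a i).
Proof.
move=> hp hf hS.
have hc : contC (fun x => \big[Cplus/RtoC 0]_(i <- r) f i x).
  apply: (@contC_ext (fun x => \big[Cplus/RtoC 0]_(i <- r | i \in r) f i x)).
    by move=> x; rewrite -big_seq.
  by apply: contC_sum => i /hf [].
split => //.
apply: (@Lr_dom _ _ (fun x => \rsum_(i <- r) Cmod (f i x))); first by lra.
- exact: contC_Cmod.
- by move=> x _; apply: Cmod_csum.
by apply: Lr_sum => // [i x|i /hf []//]; exact: Cmod_ge_0.
Qed.

Lemma Lc_D p f g a b : 1 <= p -> Lc p f a -> Lc p g b ->
  Lc p (fun x => (f x + g x)%C) (a + b).
Proof.
move=> hp hf hg; have [_ [_ [ha _]]] := hf; have [_ [_ [hb _]]] := hg.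
have /= := @Lc_sum bool [:: true; false] p (fun c => if c then f else g) (fun c => if c then a else b) hp.
rewrite !big_cons !big_nil Rplus_0_r => h.
have {}h := h _ _; apply: (Lc_ext _ (h _ _)).
- by move=> x; rewrite !big_cons !big_nil Cplus_0_r.
- by case.
- by lra.
Qed.

Lemma Lc_scal p c k f a : 0 < p -> 0 < k -> Cmod c <= k -> Lc p f a ->
  Lc p (fun x => (c * f x)%C) (k * a).
Proof.
move=> hp hk hck [hf hl].
have hc : contC (fun x => (c * f x)%C) by apply: contC_M => //; exact: contC_const.
split => //; apply: (@Lr_dom _ _ (fun x => k * Cmod (f x))) => //; first exact: contC_Cmod.
  by move=> x _; rewrite Cmod_mult; apply: Rmult_le_compat_r => //; exact: Cmod_ge_0.
by apply: Lr_scal => // x; exact: Cmod_ge_0.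
Qed.

(** * Exponential sums *)

Lemma expiD a b : expi (a + b) = (expi a * expi b)%C.
Proof. by rewrite /expi /Cmult /= cos_plus sin_plus Rplus_comm (Rplus_comm (cos a * sin b)). Qed.

Lemma expi0 : expi 0 = 1%C.
Proof. by rewrite /expi cos_0 sin_0. Qed.

Lemma Cmod_expi a : Cmod (expi a) = 1.
Proof.
rewrite /Cmod /expi /= !Rmult_1_r -[RHS]sqrt_1; congr sqrt.
by have := sin2_cos2 a; rewrite /Rsqr; lra.
Qed.

Lemma expiN a : expi (- a) = Cconj (expi a).
Proof. by rewrite /expi /Cconj /= cos_neg sin_neg. Qed.

Lemma Cmod_1_expi a : Cmod (1 - expi a)%C = 2 * Rabs (sin (a / 2)).
Proof.
have -> : 2 * Rabs (sin (a / 2)) = sqrt ((2 * sin (a / 2)) ^ 2).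
  by rewrite -Rsqr_pow2 sqrt_Rsqr_abs Rabs_mult (Rabs_pos_eq 2) //; lra.
rewrite /Cmod /expi /=; congr sqrt.
have e : a = 2 * (a / 2) by field.
have hc : cos a = 1 - 2 * sin (a / 2) * sin (a / 2) by rewrite {1}e cos_2a_sin.
have hs : sin a = 2 * sin (a / 2) * cos (a / 2) by rewrite {1}e sin_2a.
have := sin2_cos2 (a / 2); rewrite hc hs /Rsqr => h.
set u := sin (a / 2); set v := cos (a / 2).
have hv : v * v = 1 - u * u by rewrite /u /v; lra.
transitivity (4 * (u * u) * (u * u) + 4 * (u * u) * (v * v)); first by ring.
by rewrite hv; ring.
Qed.

Lemma Cmod_sqr z : Cmod z * Cmod z = fst z * fst z + snd z * snd z.
Proof.
rewrite /Cmod sqrt_sqrt; first by ring.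
by apply: Rplus_le_le_0_compat; apply: pow2_ge_0.
Qed.

Lemma Cmod_sqr_expi_sum (I : Type) (r : seq I) (a th : I -> R) :
  let z := \big[Cplus/RtoC 0]_(i <- r) (RtoC (a i) * expi (th i))%C in
  Cmod z * Cmod z = \rsum_(i <- r) \rsum_(j <- r) (a i * a j * cos (th i - th j)).
Proof.
move=> z; rewrite Cmod_sqr {}/z fst_csum snd_csum /= !big_distrl /= -rsumD.
apply: eq_bigr => i _; rewrite !big_distrr /= -rsumD; apply: eq_bigr => j _.
by rewrite cos_minus; ring.
Qed.

(** * Dirichlet kernels and the Fejer-type kernel *)

Definition dirk (K : nat) (t : R) : C := (\csum_(i < K) expi (2 * PI * (INR i * t)))%C.

Lemma Cmod_dirk_le K t : Cmod (dirk K t) <= INR K.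
Proof.
apply: Rle_trans (Cmod_csum _ _ _) _; right.
rewrite (eq_bigr (fun=> 1)) => [|i _]; last by rewrite Cmod_expi.
by rewrite rsum_ord_const; ring.
Qed.

Lemma dirk_geom K t : ((1 - expi (2 * PI * t)) * dirk K t = 1 - expi (2 * PI * (INR K * t)))%C.
Proof.
elim: K => [|K ih].
  by rewrite /dirk big_ord0 /= Rmult_0_l Rmult_0_r expi0; ring.
rewrite /dirk big_ord_recr /= -/(dirk K t) Cmult_plus_distr_l ih.
have -> : 2 * PI * (INR K.+1 * t) = 2 * PI * t + 2 * PI * (INR K * t) by rewrite S_INR; ring.
by rewrite expiD; ring.
Qed.

(** Taking moduli in the geometric sum gives 2 |sin(pi t)| |D_K(t)| = 2 |sin(pi K t)|. *)
Lemma dirk_sin K t : Cmod (dirk K t) * Rabs (sin (PI * t)) <= 1.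
Proof.
have := f_equal Cmod (dirk_geom K t); rewrite Cmod_mult !Cmod_1_expi.
have -> : 2 * PI * t / 2 = PI * t by field.
have := Rabs_le_between (sin (2 * PI * (INR K * t) / 2)) 1 => [[_ h]].
by have := h (SIN_bound _); lra.
Qed.

Lemma Cmod_dirkN K t : Cmod (dirk K (- t)) = Cmod (dirk K t).
Proof.
have -> : dirk K (- t) = Cconj (dirk K t); last first.
  by rewrite /Cconj /Cmod /=; congr sqrt; ring.
rewrite /dirk (big_morph Cconj (id1 := RtoC 0) (op1 := Cplus)).
- by apply: eq_bigr => i _; rewrite -expiN; congr expi; ring.
- by case=> [? ?] [? ?]; rewrite /Cconj /Cplus /=; congr pair; ring.
- by rewrite /Cconj /RtoC /=; congr pair; ring.
Qed.

(** A substitute for the Fejer kernel, with the same quadratic decay. The lengths 2L and L are the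
    index ranges of [rsum_window], from which it arises. *)
Definition kap (L : nat) (t : R) := Cmod (dirk (2 * L) t) * Cmod (dirk L t).

Lemma kap_ge0 L t : 0 <= kap L t.
Proof. by apply: Rmult_le_pos; apply: Cmod_ge_0. Qed.

Lemma kap_le L t : kap L t <= 2 * (INR L * INR L).
Proof.
have -> : 2 * (INR L * INR L) = INR (2 * L) * INR L by rewrite mult_INR /=; ring.
by apply: Rmult_le_compat; try exact: Cmod_ge_0; apply: Cmod_dirk_le.
Qed.

Lemma kap_sin L t : kap L t * (sin (PI * t) * sin (PI * t)) <= 1.
Proof.
have -> : sin (PI * t) * sin (PI * t) = Rabs (sin (PI * t)) * Rabs (sin (PI * t)).
  by rewrite -Rabs_mult Rabs_pos_eq //; apply: Rle_0_sqr.
have h1 := dirk_sin (2 * L) t; have h2 := dirk_sin L t.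
have -> : 1 = 1 * 1 by ring.
have -> : kap L t * (Rabs (sin (PI * t)) * Rabs (sin (PI * t))) =
  (Cmod (dirk (2 * L) t) * Rabs (sin (PI * t))) * (Cmod (dirk L t) * Rabs (sin (PI * t))).
  by rewrite /kap; ring.
by apply: Rmult_le_compat => //; apply: Rmult_le_pos; try exact: Cmod_ge_0; exact: Rabs_pos.
Qed.

Lemma kapN L t : kap L (- t) = kap L t.
Proof. by rewrite /kap !Cmod_dirkN. Qed.

Lemma kap_of_sin L t d : 0 < d -> d <= Rabs (sin (PI * t)) -> kap L t <= / (d * d).
Proof.
move=> hd h; apply: (Rmult_le_reg_r (d * d)); first by nra.
rewrite Rinv_l; last by nra.
apply: Rle_trans (kap_sin L t); apply: Rmult_le_compat_l; first exact: kap_ge0.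
have := Rsqr_abs (sin (PI * t)); rewrite /Rsqr => ->.
by apply: Rmult_le_compat; lra.
Qed.

(** Below 1/3 the mean value theorem applies with a cosine of at least 1/2 and pi >= 2; above it the
    sine is at least sin(pi/6) = 1/2. *)
Lemma sin_pi_ge t : 0 <= t <= 1/2 -> t <= sin (PI * t).
Proof.
move=> [h0 h1]; have hpi := PI_RGT_0; have p3 := PI2_3_2; have p4 := PI_4.
case: h0 => [h0|<-]; last by rewrite Rmult_0_r sin_0; lra.
case: (Rle_dec t (1/3)) => ht.
  have [c [hc1 hc2]] : exists c, sin (PI * t) - sin 0 = cos c * (PI * t - 0) /\ 0 < c < PI * t.
    apply: MVT_cor2; first by nra.
    by move=> c _; apply: derivable_pt_lim_sin.
  rewrite sin_0 !Rminus_0_r in hc1; rewrite hc1.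
  have : 1/2 <= cos c.
    have h13 : cos (PI / 3) = 1/2 by rewrite cos_PI3; field.
    rewrite -h13; apply: cos_decr_1; nra.
  by nra.
have : sin (PI / 6) <= sin (PI * t) by apply: sin_incr_1; nra.
by rewrite sin_PI6; lra.
Qed.

Lemma sin_shift_sqr j t : Rabs (sin (PI * (INR j + t))) = Rabs (sin (PI * t)).
Proof.
elim: j => [|j <-]; first by rewrite /= Rplus_0_l.
have -> : PI * (INR j.+1 + t) = PI * (INR j + t) + PI by rewrite S_INR; ring.
by rewrite neg_sin Rabs_Ropp.
Qed.

(** * Rational approximation *)

(** [a/b] and [c/d] are neighbours around [x] in the Farey sequence of order [Q.+1]; when the order
    increases, the mediant replaces one of them as soon as its denominator [b + d] is admissible. *)
Lemma farey Q x : 0 <= x <= 1 -> exists a b c d : nat,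
  [/\ (0 < b <= Q.+1)%N, (0 < d <= Q.+1)%N, (Q.+1 < b + d)%N, (c * b = a * d + 1)%N & (a <= b)%N && (c <= d)%N] /\
  (INR a <= x * INR b /\ x * INR d <= INR c).
Proof.
move=> hx; elim: Q => [|Q [a [b [c [d [[hb hd hbd hcb hac] [h1 h2]]]]]]].
  by exists 0%N, 1%N, 1%N, 1%N; split => //=; lra.
case: (ltnP Q.+2 (b + d)) => hQ.
  by exists a, b, c, d; split => //; split => //; lia.
case: (Rle_dec (x * INR (b + d)) (INR (a + c))) => hm.
  exists a, b, (a + c)%N, (b + d)%N; split => //; split; lia.
exists (a + c)%N, (b + d)%N, c, d; split; [split; lia|split => //; lra].
Qed.

(** The mediant separates the two Farey neighbours. On its left [x] is within 1/(b(b+d)) of [a/b],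
    on its right within 1/(d(b+d)) of [c/d], and b + d >= Q + 1. The relation cb - ad = 1 gives
    coprimality. *)
Lemma dirichlet_approx Q x : (0 < Q)%N -> 0 <= x <= 1 -> exists a q : nat,
  [/\ (0 < q <= Q)%N, (a <= q)%N & coprime a q] /\
  Rabs (x - INR a / INR q) * (INR q * (INR Q + 1)) <= 1.
Proof.
case: Q => // Q _ hx; have [a [b [c [d [[hb hd hbd hcb hac] [h1 h2]]]]]] := farey Q hx.
have hcbR : INR c * INR b = INR a * INR d + 1.
  by have := f_equal INR hcb; rewrite plus_INR !mult_INR.
have hQ : INR Q.+1 + 1 <= INR b + INR d.
  by rewrite -S_INR -plus_INR; apply: le_INR; lia.
have b0 : 0 < INR b by apply: lt_0_INR; lia.
have d0 : 0 < INR d by apply: lt_0_INR; lia.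
have Q0 : 0 < INR Q.+1 by apply: lt_0_INR; lia.
have cop1 : coprime a b.
  rewrite /coprime -dvdn1 -(dvdn_addr (m := a * d)); last by rewrite dvdn_mulr ?dvdn_gcdl.
  by rewrite -hcb dvdn_mull ?dvdn_gcdr.
have cop2 : coprime c d.
  rewrite /coprime -dvdn1 -(dvdn_addr (m := a * d)); last by rewrite dvdn_mull ?dvdn_gcdr.
  by rewrite -hcb dvdn_mulr ?dvdn_gcdl.
case: (Rle_dec (x * (INR b + INR d)) (INR a + INR c)) => hm.
  exists a, b; split; first by split => //; lia.
  have e : x - INR a / INR b = (x * INR b - INR a) / INR b by field; lra.
  rewrite Rabs_pos_eq; last by rewrite e; apply: Rdiv_le_0_compat; lra.
  have -> : (x - INR a / INR b) * (INR b * (INR Q.+1 + 1)) = (x * INR b - INR a) * (INR Q.+1 + 1) by field; lra.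
  apply: (Rle_trans _ ((x * INR b - INR a) * (INR b + INR d))); first by apply: Rmult_le_compat_l; lra.
  by nra.
exists c, d; split; first by split => //; lia.
have e : x - INR c / INR d = - ((INR c - x * INR d) / INR d) by field; lra.
rewrite e Rabs_Ropp Rabs_pos_eq; last by apply: Rdiv_le_0_compat; lra.
have -> : (INR c - x * INR d) / INR d * (INR d * (INR Q.+1 + 1)) = (INR c - x * INR d) * (INR Q.+1 + 1) by field; lra.
apply: (Rle_trans _ ((INR c - x * INR d) * (INR b + INR d))); first by apply: Rmult_le_compat_l; lra.
by nra.
Qed.

Arguments INR : simpl never.

Lemma INR_gt0 n : (0 < n)%N -> 0 < INR n.
Proof. by move=> h; apply: lt_0_INR; lia. Qed.

Lemma INR_ge1 n : (0 < n)%N -> 1 <= INR n.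
Proof. by move=> h; rewrite -INR_1; apply: le_INR; lia. Qed.

Lemma INR_nat_mul k n : INR (k * n) = IZR (Z.of_nat k) * INR n.
Proof. by rewrite mult_INR INR_IZR_INZ. Qed.

Lemma INR_mul4 n : INR (4 * n) = 4 * INR n.
Proof. exact: (INR_nat_mul 4). Qed.

Lemma INR_le_mul k m n : (m <= k * n)%N -> INR m <= IZR (Z.of_nat k) * INR n.
Proof. by move=> h; rewrite -INR_nat_mul; apply: le_INR; lia. Qed.

Lemma INR_mul_le k m n : (k * m <= n)%N -> IZR (Z.of_nat k) * INR m <= INR n.
Proof. by move=> h; rewrite -INR_nat_mul; apply: le_INR; lia. Qed.

(** * Tent-weighted Weyl sums *)

(** Expand the square and bound each product F_i F_j by (F_i^2 + F_j^2)/2. *)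
Lemma cauchy_rsum n (F : 'I_n -> R) :
  (\rsum_(i < n) F i) * (\rsum_(i < n) F i) <= INR n * \rsum_(i < n) (F i * F i).
Proof.
rewrite big_distrl /= -(rsumMl _ _ (INR n)).
have -> : \rsum_(i < n) (INR n * (F i * F i)) =
  \rsum_(i < n) (\rsum_(j < n) ((F i * F i + F j * F j) / 2)).
  have -> : \rsum_(i < n) \rsum_(j < n) ((F i * F i + F j * F j) / 2) =
    \rsum_(i < n) (INR n * (F i * F i / 2) + \rsum_(j < n) (F j * F j / 2)).
    apply: eq_bigr => i _; rewrite -rsum_ord_const -rsumD; apply: eq_bigr => j _; field.
  rewrite rsumD rsum_ord_const -rsumMl -rsumD; apply: eq_bigr => i _; field.
apply: rsum_le => i _; rewrite big_distrr /=; apply: rsum_le => j _.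
by have := Rle_0_sqr (F i - F j); rewrite /Rsqr; lra.
Qed.

(** A tent-weighted Weyl sum: the shift k = u - v occurs L - |k| times. The centre [c] is an
    arbitrary real, so that all bounds are uniform under translation and reflection of the range of
    summation. *)
Definition hat L c x : C :=
  (RtoC (/ INR L)%R * \csum_(u < L) \csum_(v < L)
    expi (2 * PI * ((c + INR u - INR v) * (c + INR u - INR v) * x)))%C.

Lemma big_ord_window L s (F : nat -> R) :
  (forall i, 0 <= F i) ->
  \rsum_(u < L) F (u + s)%N <= \rsum_(0 <= i < L + s) F i.
Proof.
move=> hF; apply: Rle_trans (@rsum_subrange 0 (L + s) s (L + s) F _ _ hF) => //.
by rewrite -{2}(add0n s) big_addn addnK big_mkord; apply: Rle_refl.
Qed.

(** Every u < L equals i - j for each j < L with i = u + j < 2L. Enlarging to all such i and j costs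
    only nonnegative terms and produces a double sum in which exponentials factor. *)
Lemma rsum_window L (G : R -> R) : (forall t, 0 <= G t) ->
  INR L * \rsum_(u < L) G (INR u) <= \rsum_(j < L) \rsum_(i < (2 * L)) G (INR i - INR j).
Proof.
move=> hG; rewrite -rsum_ord_const; apply: rsum_le => j _.
have h := @big_ord_window L j (fun i => G (INR i - INR j)) (fun=> hG _).
apply: Rle_trans (_ : \rsum_(0 <= i < L + j) G (INR i - INR j) <= _).
  apply: Rle_trans h; right; apply: eq_bigr => u _; congr G; rewrite plus_INR; ring.
rewrite -[X in _ <= X](big_mkord xpredT (fun i => G (INR i - INR j))).
by apply: rsum_subrange => //; have := ltn_ord j; lia.
Qed.

(** For fixed [v] each offset |v - w| > 0 occurs at most twice. *)
Lemma toeplitz_le L (k : R -> R) : (forall t, 0 <= k t) -> (forall t, k (- t) = k t) ->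
  \rsum_(v < L) \rsum_(w < L) k (INR v - INR w) <=
  INR L * (k 0 + 2 * \rsum_(1 <= m < L) k (INR m)).
Proof.
move=> k0 kN; rewrite -rsum_ord_const; apply: rsum_le => v _.
have hv := ltn_ord v.
rewrite -(big_mkord xpredT (fun w => k (INR v - INR w))).
rewrite (big_cat_nat (n := v)) /=; [|lia|lia].
have -> : \rsum_(0 <= i < v) k (INR v - INR i) = \rsum_(1 <= i < v.+1) k (INR i).
  rewrite big_nat_rev /= big_add1 /=; apply: eq_big_nat => i hi.
  have e : (nat_of_ord v = (0 + v - i.+1) + i.+1)%N by lia.
  by congr k; have := f_equal INR e; rewrite plus_INR; lra.
have -> : \rsum_(v <= i < L) k (INR v - INR i) = \rsum_(0 <= i < L - v) k (INR i).
  rewrite -{1}(add0n (v : nat)) big_addn; apply: eq_big_nat => i hi.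
  by rewrite plus_INR -kN; congr k; ring.
have h1 : \rsum_(1 <= i < v.+1) k (INR i) <= \rsum_(1 <= i < L) k (INR i) by exact: rsum_subrange.
have h2 : \rsum_(0 <= i < L - v) k (INR i) <= k 0 + \rsum_(1 <= i < L) k (INR i).
  rewrite big_ltn /=; last by lia.
  by apply: Rplus_le_compat_l; apply: rsum_subrange => //; lia.
by lra.
Qed.

(** The bilinear form evaluates the kernel at even multiples of x; adding the odd ones allows all
    frequencies below 2L to be treated alike. *)
Lemma rsum_even_le L (k : nat -> R) : (forall t, 0 <= k t) ->
  \rsum_(1 <= m < L) k (2 * m)%N <= \rsum_(1 <= m < 2 * L) k m.
Proof.
move=> k0; case: L => [|L]; first by rewrite !big_geq //; lra.
elim: L => [|L ih]; first by rewrite big_geq //; apply: rsum_ge0.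
have e : \rsum_(1 <= m < 2 * L.+2) k m =
    \rsum_(1 <= m < 2 * L.+1) k m + k (2 * L.+1)%N + k (2 * L.+1).+1.
  have -> : (2 * L.+2 = (2 * L.+1).+2)%N by lia.
  by rewrite big_nat_recr // big_nat_recr //=; lia.
have {}e2 : \rsum_(1 <= m < L.+2) k (2 * m)%N = \rsum_(1 <= m < L.+1) k (2 * m)%N + k (2 * L.+1)%N.
  by rewrite big_nat_recr.
rewrite e e2.
by have := k0 (2 * L.+1).+1; lra.
Qed.

(* Writing (c+u-v)^2 = (c+u)^2 + (v^2-2cv) - 2uv turns the tent-weighted sum into a bilinear form with kernel e(-2uvx). *)
Lemma hat_sqr_le L c x : (0 < L)%N ->
  Cmod (hat L c x) * Cmod (hat L c x) <=
  2 * INR L + 2 / INR L * \rsum_(1 <= m < 2 * L) kap L (INR m * x).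
Proof.
move=> hL; have L0 : 0 < INR L by apply: lt_0_INR; lia.
pose th (t : R) (v : 'I_L) := 2 * PI * ((INR v * INR v - 2 * c * INR v) * x) - 2 * PI * (2 * t * INR v * x).
pose B (t : R) : C := (\csum_(v < L) (RtoC 1 * expi (th t v)))%C.
pose S := \rsum_(u < L) (Cmod (B (INR u)) * Cmod (B (INR u))).
pose K := \rsum_(1 <= m < 2 * L) kap L (INR m * x).
have e1 : Cmod (hat L c x) <= / INR L * \rsum_(u < L) Cmod (B (INR u)).
  rewrite /hat Cmod_mult Cmod_R Rabs_pos_eq; last by left; apply: Rinv_0_lt_compat.
  apply: Rmult_le_compat_l; first by left; apply: Rinv_0_lt_compat.
  apply: Rle_trans (Cmod_csum _ _ _) _; apply: rsum_le => u _; right.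
  have -> : (\csum_(v < L) expi (2 * PI * ((c + INR u - INR v) * (c + INR u - INR v) * x)) =
    expi (2 * PI * ((c + INR u) * (c + INR u) * x)) * B (INR u))%C.
    rewrite /B -csumMl; apply: eq_bigr => v _; rewrite Cmult_1_l -expiD; congr expi.
    by rewrite /th; ring.
  by rewrite Cmod_mult Cmod_expi Rmult_1_l.
(* After passing from u to the differences i - j and expanding the squares, the sum over i and j is
   a product of two Dirichlet kernels. *)
have e2 : INR L * S <= INR L * (2 * (INR L * INR L) + 2 * K).
  apply: Rle_trans (rsum_window L (G := fun t => Cmod (B t) * Cmod (B t)) _) _.
    by move=> t; apply: Rle_0_sqr.
  have -> : \rsum_(j < L) \rsum_(i < (2 * L)) (Cmod (B (INR i - INR j)) * Cmod (B (INR i - INR j))) =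
    \rsum_(v < L) \rsum_(w < L) (\rsum_(j < L) \rsum_(i < (2 * L)) cos (th (INR i - INR j) v - th (INR i - INR j) w)).
    transitivity (\rsum_(j < L) \rsum_(v < L) \rsum_(w < L) \rsum_(i < (2 * L)) cos (th (INR i - INR j) v - th (INR i - INR j) w)).
      apply: eq_bigr => j _.
      transitivity (\rsum_(i < (2 * L)) \rsum_(v < L) \rsum_(w < L) cos (th (INR i - INR j) v - th (INR i - INR j) w)).
        apply: eq_bigr => i _; rewrite Cmod_sqr_expi_sum.
        by apply: eq_bigr => v _; apply: eq_bigr => w _; ring.
      rewrite exchange_big; apply: eq_bigr => v _; exact: exchange_big.
    rewrite exchange_big; apply: eq_bigr => v _; exact: exchange_big.
  apply: Rle_trans (_ : \rsum_(v < L) \rsum_(w < L) kap L (2 * (INR v - INR w) * x) <= _).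
    apply: rsum_le => v _; apply: rsum_le => w _.
    pose t := 2 * (INR v - INR w) * x.
    pose ph := 2 * PI * ((INR v * INR v - 2 * c * INR v) * x) - 2 * PI * ((INR w * INR w - 2 * c * INR w) * x).
    have -> : \rsum_(j < L) \rsum_(i < (2 * L)) cos (th (INR i - INR j) v - th (INR i - INR j) w) =
      fst (expi ph * (dirk L t * dirk (2 * L) (- t)))%C.
      rewrite /dirk big_distrl -csumMl fst_csum; apply: eq_bigr => j _.
      rewrite big_distrr -csumMl fst_csum; apply: eq_bigr => i _.
      have e a b d : (expi a * (expi b * expi d))%C = expi (a + (b + d)) by rewrite !expiD.
      apply: (eq_trans _ (esym (f_equal fst (e _ _ _)))).
      by rewrite /expi /=; congr cos; rewrite /th /ph /t; ring.
    have h z : fst z <= Cmod z by apply: Rle_trans (Rle_abs _) _; exact: re_le_Cmod.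
    apply: Rle_trans (h _) _.
    by rewrite !Cmod_mult Cmod_expi Cmod_dirkN /kap -/t; lra.
  apply: Rle_trans (@toeplitz_le L (fun t => kap L (2 * t * x)) _ _) _.
  - by move=> t; exact: kap_ge0.
  - by move=> t; rewrite -kapN; congr kap; ring.
  apply: Rmult_le_compat_l; first lra.
  apply: Rplus_le_compat; first exact: kap_le.
  apply: Rmult_le_compat_l; first lra.
  apply: Rle_trans (@rsum_even_le L (fun m => kap L (INR m * x)) _).
    right; apply: eq_bigr => m _; rewrite mult_INR /=; congr kap; ring.
  by move=> t; exact: kap_ge0.
have e3 : S <= 2 * (INR L * INR L) + 2 * K by apply: Rmult_le_reg_l e2.
have e4 := cauchy_rsum (fun u : 'I_L => Cmod (B (INR u))).
rewrite -/S in e4.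
have h0 := Cmod_ge_0 (hat L c x).
apply: Rle_trans (Rmult_le_compat _ _ _ _ h0 h0 e1 e1) _.
set Q := \rsum_(u < L) Cmod (B (INR u)) in e4 *.
have -> : / INR L * Q * (/ INR L * Q) = / INR L * / INR L * (Q * Q) by ring.
apply: (Rle_trans _ (/ INR L * / INR L * (INR L * (2 * (INR L * INR L) + 2 * K)))).
  apply: Rmult_le_compat_l; first by apply: Rmult_le_pos; left; apply: Rinv_0_lt_compat.
  by apply: Rle_trans e4 _; apply: Rmult_le_compat_l; lra.
by rewrite -/K; right; field; lra.
Qed.

(** * Major arcs *)

Lemma rsum_blocks K q (F : nat -> R) :
  \rsum_(0 <= m < K * q) F m = \rsum_(k < K) \rsum_(r < q) F (k * q + r)%N.
Proof.
elim: K => [|K ih]; first by rewrite big_ord0 big_geq.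
rewrite big_ord_recr -ih /= (big_cat_nat (n := K * q)) /=; [|lia|lia].
congr (_ + _); rewrite -{1}(add0n (K * q)%N) big_addn mulSn addnK big_mkord.
by apply: eq_bigr => r _; congr F; lia.
Qed.

Lemma rsum_inv_sqr q : \rsum_(1 <= r < q) / (INR r * INR r) <= 2.
Proof.
case: q => [|[|n]]; try by rewrite big_geq //; lra.
suff : \rsum_(1 <= r < n.+2) / (INR r * INR r) <= 2 - / INR n.+1.
  have : 0 < / INR n.+1 by apply: Rinv_0_lt_compat; apply: lt_0_INR; lia.
  by lra.
elim: n => [|n ih]; first by rewrite big_nat1 INR_1; lra.
rewrite big_nat_recr //.
suff : / (INR n.+2 * INR n.+2) <= / INR n.+1 - / INR n.+2 by rewrite /=; lra.
have h1 : 0 < INR n.+1 by apply: lt_0_INR; lia.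
rewrite !(S_INR n.+1).
have -> : / INR n.+1 - / (INR n.+1 + 1) = / (INR n.+1 * (INR n.+1 + 1)) by field; lra.
by apply: Rinv_le_contravar; nra.
Qed.

(** Telescoping: c/(1+ck)^2 is at most 1/(1+c(k-1)) - 1/(1+ck), so the bound is uniform in [c]. *)
Lemma rsum_inv_lin_sqr c K : 0 <= c ->
  c * \rsum_(1 <= k < K) / ((1 + c * INR k) * (1 + c * INR k)) <= 1.
Proof.
move=> hc; case: K => [|n]; first by rewrite big_geq //; lra.
suff : c * \rsum_(1 <= k < n.+1) / ((1 + c * INR k) * (1 + c * INR k)) <= 1 - / (1 + c * INR n).
  have : 0 < / (1 + c * INR n) by apply: Rinv_0_lt_compat; have := pos_INR n; nra.
  by lra.
elim: n => [|n ih]; first by rewrite big_geq // INR_0 Rmult_0_r Rplus_0_r Rinv_1; lra.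
rewrite big_nat_recr //= Rmult_plus_distr_l.
suff : c * / ((1 + c * INR n.+1) * (1 + c * INR n.+1)) <= / (1 + c * INR n) - / (1 + c * INR n.+1) by lra.
have hn := pos_INR n; have h1 : 0 < 1 + c * INR n by nra.
rewrite S_INR.
have -> : / (1 + c * INR n) - / (1 + c * (INR n + 1)) = c * / ((1 + c * INR n) * (1 + c * (INR n + 1))) by field; nra.
by apply: Rmult_le_compat_l => //; apply: Rinv_le_contravar; nra.
Qed.

(** Multiplication by the unit [a] is a permutation of the residues mod [q] fixing 0. *)
Lemma rsum_residues q a (G : nat -> R) : (0 < q)%N -> coprime a q ->
  \rsum_(r < q | (0 < r)%N) G (r * a %% q)%N = \rsum_(r < q | (0 < r)%N) G r.
Proof.
move=> hq hcop; pose h (r : 'I_q) : 'I_q := Ordinal (ltn_pmod (r * a) hq).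
have hinj : injective h.
  move=> r s /(congr1 val) /= /eqP e; apply: val_inj => /=.
  wlog hrs : r s e / (r <= s)%N.
    move=> H; case/orP: (leq_total r s) => h'; first exact: H.
    by symmetry; apply: H => //; rewrite eq_sym.
  rewrite eq_sym eqn_mod_dvd ?leq_mul2r ?hrs ?orbT // -mulnBl in e.
  rewrite Gauss_dvdl in e; last by rewrite coprime_sym.
  case: (posnP (s - r)) => h0; first by lia.
  by have := dvdn_leq h0 e; have := ltn_ord s; lia.
rewrite [RHS](reindex_inj hinj) /=; apply: eq_bigl => r.
rewrite !lt0n; congr negb; apply/eqP/eqP => /= [->|]; first by rewrite mul0n mod0n.
move/eqP; rewrite -/(dvdn q (r * a)) Gauss_dvdl; last by rewrite coprime_sym.
by case: (posnP r) => // h0 hd; have := dvdn_leq h0 hd; have := ltn_ord r; lia.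
Qed.

(* On the arc |x - a/q| <= 1/(4qL) the frequencies m divisible by q give the peak, the others behave as at x = a/q. *)
Lemma kap_sum_le L x : (0 < L)%N -> 0 <= x <= 1 -> exists a q : nat,
  (0 < q <= 4 * L)%N /\ (a <= q)%N /\
  \rsum_(1 <= m < 2 * L) kap L (INR m * x) <=
  384 * (INR L * INR L) +
  24 * (INR L * INR L * INR L) / (INR q * (1 + INR L * INR L * Rabs (x - INR a / INR q))).
Proof.
move=> hL hx.
(* Approximation of order 4L makes |m (x - a/q)| at most 1/(2q) for all m <= 2L, so m x stays within
   half a spacing of m a/q. *)
have h4 : (0 < 4 * L)%N by lia.
have [a [q [[/andP [q0 qL] haq hcop] hap]]] := dirichlet_approx h4 hx.
exists a, q; split; first by rewrite q0.
split => //.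
set be := x - INR a / INR q in hap *.
have L0 : 0 < INR L by apply: lt_0_INR; lia.
have L1 : 1 <= INR L by rewrite -INR_1; apply: le_INR; lia.
have Q0 : 0 < INR q by apply: lt_0_INR; lia.
have Q1 : 1 <= INR q by rewrite -INR_1; apply: le_INR; lia.
have QL : INR q <= 4 * INR L by apply: (@INR_le_mul 4); lia.
rewrite INR_mul4 in hap.
have hb0 := Rabs_pos be.
have hmb m : (m <= 2 * L)%N -> INR m * Rabs be <= / (2 * INR q).
  move=> hm; have hmR : INR m <= 2 * INR L by apply: (@INR_le_mul 2); lia.
  apply: (Rmult_le_reg_r (2 * INR q)); first lra.
  rewrite Rinv_l; last lra.
  have := pos_INR m => hm0.
  apply: (Rle_trans _ (2 * INR L * Rabs be * (2 * INR q))); last by nra.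
  apply: Rmult_le_compat_r; first lra.
  by apply: Rmult_le_compat_r.
pose c := INR L * INR q * Rabs be.
have hc : 0 <= c by apply: Rmult_le_pos => //; nra.
(* For m = kq the product [c * INR k] is L |m be|, and 8 L^2/(1+ck)^2 dominates the smaller of 2 L^2
   and 1/(m be)^2. The value at 0 is 0 since m = 0 is not summed. *)
pose A (k : nat) := if k == 0%N then 0 else 8 * (INR L * INR L) * / ((1 + c * INR k) * (1 + c * INR k)).
(* For m a congruent to r <> 0 the perturbation at most halves the distances r/q and (q - r)/q to
   the two neighbouring integers; the sum of both bounds avoids asking which is nearer. *)
pose G (r : nat) := 4 * (INR q * INR q) * (/ (INR r * INR r) + / (INR (q - r) * INR (q - r))).
pose g (m : nat) := if (m %% q == 0)%N then A (m %/ q)%N else G (m * a %% q)%N.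
have A0 k : 0 <= A k.
  rewrite /A; case: eqP => _; first lra.
  apply: Rmult_le_pos; first by nra.
  by left; apply: Rinv_0_lt_compat; have := pos_INR k; nra.
have hinv t : 0 <= / (t * t).
  by rewrite Rinv_mult; apply: Rle_0_sqr.
have G0 r : 0 <= G r.
  by apply: Rmult_le_pos; [nra|apply: Rplus_le_le_0_compat; apply: hinv].
have g0 m : 0 <= g m by rewrite /g; case: ifP.
have hkg m : (1 <= m < 2 * L)%N -> kap L (INR m * x) <= g m.
  move=> /andP [hm1 hm2]; have hmb' := hmb m (ltnW hm2).
  have ex : INR m * x = INR (m * a) / INR q + INR m * be by rewrite mult_INR /be; field; lra.
  rewrite /g; case: eqP => hmq.
    have em : m = (m %/ q * q)%N by rewrite {1}(divn_eq m q) hmq addn0.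
    set k := (m %/ q)%N in em *.
    have k0 : (0 < k)%N by case: (posnP k) => // e; rewrite e in em; lia.
    have k1 : 1 <= INR k by rewrite -INR_1; apply: le_INR; lia.
    rewrite /A; case: eqP => [|_]; first lia.
    have eI : INR (m * a) / INR q = INR (k * a) by rewrite em !mult_INR; field; lra.
    rewrite eI in ex.
    pose t := INR m * Rabs be.
    have ht0 : 0 <= t by apply: Rmult_le_pos => //; exact: pos_INR.
    have ht1 : t <= 1/2.
      apply: Rle_trans hmb' _; apply: Rle_trans (Rinv_le_contravar 2 _ _ _) _; lra.
    have hsin : t <= Rabs (sin (PI * (INR m * x))).
      rewrite ex sin_shift_sqr.
      apply: (Rle_trans _ (sin (PI * t))); first by apply: sin_pi_ge; lra.
      rewrite /t; case: (Rle_dec 0 be) => hbe.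
        by rewrite (Rabs_pos_eq be) //; exact: Rle_abs.
      rewrite (Rabs_left be); last lra.
      have -> : PI * (INR m * - be) = - (PI * (INR m * be)) by ring.
      by rewrite sin_neg -Rabs_Ropp; exact: Rle_abs.
    have ec : c * INR k = INR L * t by rewrite /c /t em mult_INR; ring.
    rewrite ec; set s := INR L * t.
    have hs0 : 0 <= s by apply: Rmult_le_pos; lra.
    have hpos : 0 < (1 + s) * (1 + s) by nra.
    apply: (Rmult_le_reg_r ((1 + s) * (1 + s))) => //.
    rewrite Rmult_assoc Rinv_l ?Rmult_1_r; last lra.
    have hk1 := kap_le L (INR m * x); have hk0 := kap_ge0 L (INR m * x).
    case: (Rle_dec s 1) => hs.
      have : (1 + s) * (1 + s) <= 4 by nra.
      by nra.
    have tpos : 0 < t by case: ht0 => // e; rewrite /s -e in hs; lra.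
    have hk2 := kap_of_sin L tpos hsin.
    apply: (Rle_trans _ (/ (t * t) * (4 * (s * s)))).
      by apply: Rmult_le_compat; nra.
    have -> : / (t * t) * (4 * (s * s)) = 4 * (INR L * INR L) by rewrite /s; field; lra.
    by nra.
  pose r := (m * a %% q)%N; pose j := (m * a %/ q)%N.
  have er : (m * a = j * q + r)%N := divn_eq _ _.
  have rq : (r < q)%N by apply: ltn_pmod.
  have r0 : (0 < r)%N.
    rewrite lt0n; apply/eqP => e; apply: hmq; apply/eqP.
    by move/eqP: e; rewrite -!/(dvdn _ _) Gauss_dvdl // coprime_sym.
  rewrite -/r.
  have R1 : 1 <= INR r by rewrite -INR_1; apply: le_INR; lia.
  have eqr : INR (q - r) = INR q - INR r by rewrite minus_INR //; lia.
  have R2 : 1 <= INR q - INR r by rewrite -eqr -INR_1; apply: le_INR; lia.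
  have e2 : INR m * x = INR j + (INR r / INR q + INR m * be).
    by rewrite ex er plus_INR mult_INR; field; lra.
  set t := INR r / INR q + INR m * be in e2.
  have hmbe : Rabs (INR m * be) <= / (2 * INR q).
    by rewrite Rabs_mult Rabs_pos_eq //; exact: pos_INR.
  have [hl hu] := (proj1 (Rabs_le_between _ _) hmbe).
  have e3 : / (2 * INR q) = / INR q / 2 by field; lra.
  have iq := Rinv_0_lt_compat _ Q0.
  have t1 : INR r / (2 * INR q) <= t.
    have -> : INR r / (2 * INR q) = INR r * / INR q / 2 by field; lra.
    rewrite /t; rewrite e3 in hl; have : / INR q <= INR r * / INR q by nra.
    by rewrite /Rdiv; lra.
  have t2 : (INR q - INR r) / (2 * INR q) <= 1 - t.
    have -> : (INR q - INR r) / (2 * INR q) = (INR q - INR r) * / INR q / 2 by field; lra.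
    rewrite /t; rewrite e3 in hu; have : / INR q <= (INR q - INR r) * / INR q by nra.
    have : INR q * / INR q = 1 by rewrite Rinv_r; lra.
    by rewrite /Rdiv; nra.
  have p1 : 0 < INR r / (2 * INR q) by apply: Rdiv_lt_0_compat; lra.
  have p2 : 0 < (INR q - INR r) / (2 * INR q) by apply: Rdiv_lt_0_compat; lra.
  have t3 := Rlt_le_trans _ _ _ p1 t1; have t4 := Rlt_le_trans _ _ _ p2 t2.
  have i1 := hinv (INR r); have i2 := hinv (INR (q - r)).
  have Q2 : 0 < 4 * (INR q * INR q) by nra.
  case: (Rle_dec t (1/2)) => ht.
    apply: Rle_trans (_ : 4 * (INR q * INR q) * / (INR r * INR r) <= _); last first.
      by rewrite /G; apply: Rmult_le_compat_l; lra.
    have -> : 4 * (INR q * INR q) * / (INR r * INR r) = / (INR r / (2 * INR q) * (INR r / (2 * INR q))) by field; lra.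
    apply: kap_of_sin => //; rewrite e2 sin_shift_sqr.
    apply: Rle_trans t1 _; apply: Rle_trans (sin_pi_ge _) (Rle_abs _); split; lra.
  apply: Rle_trans (_ : 4 * (INR q * INR q) * / (INR (q - r) * INR (q - r)) <= _); last first.
    by rewrite /G; apply: Rmult_le_compat_l; lra.
  rewrite eqr.
  have -> : 4 * (INR q * INR q) * / ((INR q - INR r) * (INR q - INR r)) = / ((INR q - INR r) / (2 * INR q) * ((INR q - INR r) / (2 * INR q))) by field; lra.
  apply: kap_of_sin => //; rewrite e2 sin_shift_sqr.
  apply: Rle_trans t2 _.
  have -> : sin (PI * t) = sin (PI * (1 - t)).
    by rewrite -[LHS]sin_PI_x; congr sin; ring.
  apply: Rle_trans (sin_pi_ge _) (Rle_abs _); split; lra.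
(* [K] blocks of length [q] cover the range of m, and completing the last block adds only
   nonnegative terms. *)
pose K := (2 * L %/ q).+1.
have hK : (2 * L <= K * q)%N by rewrite /K; have := divn_eq (2 * L) q; have := ltn_pmod (2 * L) q0; nia.
have KR : INR K <= 2 * INR L / INR q + 1.
  rewrite /K S_INR; apply: Rplus_le_compat_r.
  apply: (Rmult_le_reg_r (INR q)) => //.
  have -> : 2 * INR L / INR q * INR q = INR (2 * L) by rewrite (INR_nat_mul 2) /=; field; lra.
  by rewrite -mult_INR; apply: le_INR; have := leq_trunc_div (2 * L) q; lia.
apply: (Rle_trans _ (\rsum_(0 <= m < K * q) g m)).
  apply: (Rle_trans _ (\rsum_(1 <= m < 2 * L) g m)); first by apply: rsum_nat_le.
  by apply: rsum_subrange.
have hblock : \rsum_(0 <= m < K * q) g m =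
   \rsum_(0 <= k < K) A k + INR K * \rsum_(r < q | (0 < r)%N) G r.
  rewrite rsum_blocks big_mkord -rsum_ord_const -rsumD; apply: eq_bigr => k _.
  rewrite (bigD1 (Ordinal q0)) //=; congr (_ + _).
    by rewrite /g addn0 modnMl eqxx mulnK.
  rewrite -(rsum_residues _ q0 hcop); apply: eq_big => [r|r hr]; first by rewrite lt0n -val_eqE.
  have hr0 : (0 < r)%N by rewrite lt0n; move: hr; rewrite -val_eqE.
  rewrite /g modnMDl modn_small // (gtn_eqF hr0) mulnDl.
  by rewrite mulnAC modnMDl.
rewrite hblock.
have hG : \rsum_(r < q | (0 < r)%N) G r <= 16 * (INR q * INR q).
  have -> : \rsum_(r < q | (0 < r)%N) G r = \rsum_(1 <= r < q) G r.
    rewrite -(big_mkord (fun r => (0 < r)%N)) (big_cat_nat (n := 1%N)) //=.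
    rewrite [X in X + _](_ : _ = 0) ?Rplus_0_l; last by rewrite big_mkcond big_nat1.
    rewrite big_mkcond /=; apply: eq_big_nat => r hr.
    by rewrite ifT //; lia.
  rewrite /G rsumMl rsumD.
  have e : \rsum_(1 <= r < q) / (INR (q - r) * INR (q - r)) = \rsum_(1 <= r < q) / (INR r * INR r).
    rewrite big_nat_rev /=; apply: eq_big_nat => r hr.
    by have -> : (q - (1 + q - r.+1) = r)%N by lia.
  rewrite e; have := rsum_inv_sqr q; nra.
(* The sum [S] is at most 1/c by telescoping and at most 2L/q by counting; the two together yield
   the factor 1/(1 + L^2 |be|). *)
have hS : \rsum_(0 <= k < K) A k <=
  24 * (INR L * INR L * INR L) / (INR q * (1 + INR L * INR L * Rabs be)).
  pose S := \rsum_(1 <= k < K) / ((1 + c * INR k) * (1 + c * INR k)).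
  have -> : \rsum_(0 <= k < K) A k = 8 * (INR L * INR L) * S.
    rewrite big_ltn // {1}/A /= Rplus_0_l -rsumMl; apply: eq_big_nat => k hk.
    by rewrite /A; case: eqP => //; lia.
  have s1 : c * S <= 1 by apply: rsum_inv_lin_sqr.
  have s2 : S <= 2 * INR L / INR q.
    apply: (Rle_trans _ (\rsum_(1 <= k < K) 1)).
      apply: rsum_nat_le => k _; rewrite -[X in _ <= X]Rinv_1.
      by apply: Rinv_le_contravar; first lra; have := pos_INR k; nra.
    by rewrite rsum_nat_const // INR_1; lra.
  have s3 : S * (1 + INR L * INR L * Rabs be) <= 3 * INR L / INR q.
    have e : S * (1 + INR L * INR L * Rabs be) = S + c * S * (INR L / INR q) by rewrite /c; field; lra.
    rewrite e; have : 0 < INR L / INR q by apply: Rdiv_lt_0_compat.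
    by move=> h; have -> : 3 * INR L / INR q = 2 * INR L / INR q + 1 * (INR L / INR q); [field; lra|nra].
  have D0 : 0 < 1 + INR L * INR L * Rabs be by nra.
  apply: (Rmult_le_reg_r (1 + INR L * INR L * Rabs be)) => //.
  have -> : 24 * (INR L * INR L * INR L) / (INR q * (1 + INR L * INR L * Rabs be)) * (1 + INR L * INR L * Rabs be)
    = 8 * (INR L * INR L) * (3 * INR L / INR q) by field; lra.
  by rewrite Rmult_assoc; apply: Rmult_le_compat_l => //; nra.
(* With K <= 2L/q + 1 and q <= 4L this is at most 128 L^2 + 256 L^2. *)
have hK2 : INR K * \rsum_(r < q | (0 < r)%N) G r <= 384 * (INR L * INR L).
  apply: (Rle_trans _ ((2 * INR L / INR q + 1) * (16 * (INR q * INR q)))).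
    apply: Rmult_le_compat => //; first exact: pos_INR.
    by apply: rsum_ge0.
  have -> : (2 * INR L / INR q + 1) * (16 * (INR q * INR q)) = 32 * INR L * INR q + 16 * (INR q * INR q) by field; lra.
  by nra.
by lra.
Qed.

Lemma hat_pointwise L c x : (0 < L)%N -> 0 <= x <= 1 -> exists a q : nat,
  (0 < q <= 4 * L)%N /\ (a <= q)%N /\
  Cmod (hat L c x) * Cmod (hat L c x) <=
  1000 * (INR L + INR L * INR L / (INR q * (1 + INR L * INR L * Rabs (x - INR a / INR q)))).
Proof.
move=> hL hx; have [a [q [hq [ha h]]]] := kap_sum_le hL hx.
exists a, q; split => //; split => //.
apply: Rle_trans (hat_sqr_le _ _ hL) _.
have L0 : 0 < INR L by apply: lt_0_INR; lia.
have Q0 : 0 < INR q by apply: lt_0_INR; lia.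
have hb := Rabs_pos (x - INR a / INR q).
set D := INR q * _ in h *.
have D0 : 0 < D by apply: Rmult_lt_0_compat => //; nra.
have hl : 0 < 2 / INR L by apply: Rdiv_lt_0_compat; lra.
have := Rmult_le_compat_l _ _ _ (Rlt_le _ _ hl) h.
have -> : 2 / INR L * (384 * (INR L * INR L) + 24 * (INR L * INR L * INR L) / D) =
  768 * INR L + 48 * (INR L * INR L / D) by field; lra.
have : 0 < INR L * INR L / D by apply: Rdiv_lt_0_compat => //; nra.
by lra.
Qed.

(** * Integration over the arcs *)

Lemma cont_inv f : cont f -> (forall x, f x <> 0) -> cont (fun x => / f x).
Proof.
by move=> hf h x; apply: (continuous_comp f Rinv); [exact: hf|exact: continuous_Rinv].
Qed.

Lemma cont_peak_pw A al r : 0 < A -> 0 < r ->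
  cont (fun x => pw (/ (1 + A * Rabs (x - al))) r).
Proof.
move=> hA hr; apply: cont_pw => //.
apply: cont_inv => [|y]; last by have := Rabs_pos (y - al); nra.
apply: contD; first exact: cont_const.
apply: cont_scal.
by apply: cont_abs; apply: contB; [exact: cont_id|exact: cont_const].
Qed.

(** One side of the peak, selected by the sign [s]. The antiderivative is -s (1 + A s (x -
    al))^(1-r) / (A (r - 1)), and the power in it lies between 0 and 1 at both ends. *)
Lemma RInt_peak_half s A al r : s * s = 1 -> 0 < A -> 1 < r -> forall u v, u <= v ->
  (forall x, u <= x <= v -> 0 <= s * (x - al)) ->
  RInt (fun x => pw (/ (1 + A * Rabs (x - al))) r) u v <= / (A * (r - 1)).
Proof.
move=> hs hA hr u v huv hsign.
pose F x := - s * (exp ((1 - r) * ln (1 + A * (s * (x - al)))) / (A * (r - 1))).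
have hd : A * (r - 1) <> 0 by apply: Rmult_integral_contrapositive_currified; lra.
have hpos x : u <= x <= v -> 0 < 1 + A * (s * (x - al)).
  by move=> hx; have := hsign x hx; nra.
have hder x : u <= x <= v -> is_derive F x (pw (/ (1 + A * Rabs (x - al))) r).
  move=> hx; have h1 := hsign x hx; have h2 := hpos x hx.
  have -> : Rabs (x - al) = s * (x - al).
    rewrite -(Rabs_pos_eq (s * (x - al))) // Rabs_mult.
    suff -> : Rabs s = 1 by ring.
    have : Rabs s * Rabs s = 1 by rewrite -Rabs_mult hs Rabs_R1.
    by have := Rabs_pos s; nra.
  rewrite pw_inv // pwE // -Rpower_Ropp /Rpower.
  rewrite /F; auto_derive; first by lra.
  have e : exp ((1 - r) * ln (1 + A * (s * (x - al)))) =
     exp (- r * ln (1 + A * (s * (x - al)))) * (1 + A * (s * (x - al))).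
    by rewrite -{3}(exp_ln _ h2) -exp_plus; congr exp; ring.
  have -> : 1 + A * (s * (x + - al)) = 1 + A * (s * (x - al)) by ring.
  rewrite e; set z := exp _; set w := 1 + A * _ in h2 *.
  transitivity (s * s * z); last by rewrite hs; ring.
  by field; repeat split; lra.
have hint : is_RInt (fun x => pw (/ (1 + A * Rabs (x - al))) r) u v (minus (F v) (F u)).
  apply: (is_RInt_derive F (fun x => pw (/ (1 + A * Rabs (x - al))) r)); rewrite Rmin_left ?Rmax_right // => x hx.
  by apply: cont_peak_pw; lra.
rewrite (is_RInt_unique _ _ _ _ hint) /minus /plus /opp /= /F.
have hE x : u <= x <= v -> 0 < exp ((1 - r) * ln (1 + A * (s * (x - al)))) <= 1.
  move=> hx; split; first exact: exp_pos.
  have hln : ln 1 <= ln (1 + A * (s * (x - al))).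
    by apply: ln_le; [lra|have := hsign x hx; nra].
  rewrite ln_1 in hln.
  rewrite -[X in _ <= X]exp_0; case: hln => [h|<-]; first by left; apply: exp_increasing; nra.
  by rewrite Rmult_0_r; lra.
have hv := hE v _; have hu := hE u _.
have {hv} := hv (conj huv (Rle_refl v)); have {hu} := hu (conj (Rle_refl u) huv).
set a := exp _; set b := exp _ => ha hb.
have i0 : 0 < / (A * (r - 1)) by apply: Rinv_0_lt_compat; nra.
have -> : - s * (b / (A * (r - 1))) + - (- s * (a / (A * (r - 1)))) = s * (a - b) * / (A * (r - 1)) by field; lra.
rewrite -[X in _ <= X]Rmult_1_l; apply: Rmult_le_compat_r; first lra.
have : s = 1 \/ s = - 1.
  have : (s - 1) * (s + 1) = 0 by lra.
  by move/Rmult_integral => [h|h]; [left|right]; lra.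
by case=> ->; lra.
Qed.

Lemma RInt_peak A al r : 0 < A -> 1 < r -> 0 <= al <= 1 ->
  RInt (fun x => pw (/ (1 + A * Rabs (x - al))) r) 0 1 <= 2 / (A * (r - 1)).
Proof.
move=> hA hr [h0 h1].
have hc : cont (fun x => pw (/ (1 + A * Rabs (x - al))) r).
  by apply: cont_peak_pw; lra.
rewrite -(RInt_Chasles _ 0 al 1); try exact: cont_ex_RInt.
have e1 : -1 * -1 = 1 by ring.
have e2 : 1 * 1 = 1 by ring.
have i1 := RInt_peak_half e1 hA hr h0 (al := al) _.
have i2 := RInt_peak_half e2 hA hr h1 (al := al) _.
rewrite /plus /=.
have {}i1 := i1 _; have {}i2 := i2 _.
have j1 : forall x, 0 <= x <= al -> 0 <= -1 * (x - al) by move=> x ?; lra.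
have j2 : forall x, al <= x <= 1 -> 0 <= 1 * (x - al) by move=> x ?; lra.
have := i1 j1; have := i2 j2; rewrite /Rdiv; lra.
Qed.

Lemma pw_add_le a b r : 0 <= r -> 0 <= a -> 0 <= b ->
  pw (a + b) r <= pw 2 r * (pw a r + pw b r).
Proof.
move=> hr ha hb; have h2 : 0 <= 2 by lra.
case: (Rle_dec a b) => hab.
  apply: (Rle_trans _ (pw (2 * b) r)); first by apply: pw_le; lra.
  rewrite pwM //; apply: Rmult_le_compat_l; first exact: pw_ge0.
  by have := pw_ge0 a r; lra.
apply: (Rle_trans _ (pw (2 * a) r)); first by apply: pw_le; lra.
rewrite pwM //; apply: Rmult_le_compat_l; first exact: pw_ge0.
by have := pw_ge0 b r; lra.
Qed.

Lemma contC_hat L c : contC (hat L c).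
Proof.
apply: contC_M; first exact: contC_const.
apply: contC_sum => u _; apply: contC_sum => v _; apply: contC_expi.
apply: cont_scal.
by exact: cont_lin.
Qed.

Lemma rsum_ge_term n (F : nat -> R) m i : (m <= i < n)%N -> (forall j, 0 <= F j) ->
  F i <= \rsum_(m <= j < n) F j.
Proof.
move=> hi h; apply: Rle_trans (@rsum_subrange m n i i.+1 F _ _ h); [|lia|lia].
by rewrite big_nat1; apply: Rle_refl.
Qed.

(** The expected p-th moment of a tent of length L: L^(p/2) from square-root cancellation, and from
    the arcs a height L^p q^(-p/2), a width L^(-2) and about q numerators. *)
Definition hat_energy p L := pw (INR L) (p / 2) +
  pw (INR L) (p - 2) * \rsum_(1 <= q < (4 * L).+1) pw (INR q) (1 - p / 2).

(** The fraction in [hat_pointwise] depends on x, so its peak is replaced by the sum of the peaks at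
    all a/q with q <= 4L, integrated term by term. The hypothesis p > 2 gives the exponent p/2 > 1
    that [RInt_peak] asks for. *)
Lemma hat_Lp p : 2 < p -> exists C0, 0 < C0 /\ forall L c, (0 < L)%N ->
  RInt (fun x => pw (Cmod (hat L c x)) p) 0 1 <= C0 * hat_energy p L.
Proof.
move=> hp; pose r := p / 2; have hr : 1 < r by rewrite /r; lra.
have k1 : 0 < pw 1000 r by apply: pw_gt0; lra.
have k2 : 0 < pw 2 r by apply: pw_gt0; lra.
have k3 : 0 < 4 / (r - 1) by apply: Rdiv_lt_0_compat; lra.
exists (pw 1000 r * pw 2 r * (1 + 4 / (r - 1))); split.
  by apply: Rmult_lt_0_compat; [apply: Rmult_lt_0_compat|lra].
move=> L c hL.
have L0 : 0 < INR L by apply: lt_0_INR; lia.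
pose Y q a x := pw (INR L * INR L) r * pw (/ INR q) r *
  pw (/ (1 + INR L * INR L * Rabs (x - INR a / INR q))) r.
have hYc q a : cont (Y q a).
  apply: cont_scal.
  by apply: cont_peak_pw; [nra|lra].
have hY0 q a x : 0 <= Y q a x.
  by repeat apply: Rmult_le_pos; exact: pw_ge0.
pose M x := pw 1000 r * pw 2 r * (pw (INR L) r +
  \rsum_(1 <= q < (4 * L).+1) \rsum_(0 <= a < q.+1) Y q a x).
have hYs : cont (fun x => \rsum_(1 <= q < (4 * L).+1) \rsum_(0 <= a < q.+1) Y q a x).
  by apply: cont_rsum => q _; apply: cont_rsum => a _.
have hMc : cont M.
  apply: cont_scal.
  by apply: contD => //; exact: cont_const.
apply: (Rle_trans _ (RInt M 0 1)).
  apply: RInt_le01 => //; first by apply: cont_pw; [lra|apply: contC_Cmod; exact: contC_hat].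
  move=> x hx; have [a [q [/andP [q0 hq] [ha h]]]] := hat_pointwise c hL hx.
  have Q0 : 0 < INR q by apply: lt_0_INR; lia.
  have hbe := Rabs_pos (x - INR a / INR q).
  set D := 1 + INR L * INR L * Rabs (x - INR a / INR q) in h.
  have D0 : 0 < D by rewrite /D; nra.
  have e : pw (Cmod (hat L c x)) p = pw (Cmod (hat L c x) * Cmod (hat L c x)) r.
    by rewrite -pw_2 ?pwA; [congr pw; rewrite /r; field|exact: Cmod_ge_0].
  have hfr : 0 < INR L * INR L / (INR q * D) by apply: Rdiv_lt_0_compat; nra.
  rewrite e; apply: Rle_trans (pw_le _ h) _; first lra.
  rewrite pwM; try lra.
  rewrite /M Rmult_assoc; apply: Rmult_le_compat_l; first lra.
  apply: Rle_trans (pw_add_le _ _ _) _; try lra.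
  apply: Rmult_le_compat_l; first lra.
  apply: Rplus_le_compat_l.
  have -> : pw (INR L * INR L / (INR q * D)) r = Y q a x.
    have iq := Rinv_0_lt_compat _ Q0; have iD := Rinv_0_lt_compat _ D0.
    have p1 : 0 <= INR L * INR L by nra.
    have p2 : 0 <= INR L * INR L * / INR q by apply: Rmult_le_pos; lra.
    have -> : INR L * INR L / (INR q * D) = INR L * INR L * / INR q * / D by field; lra.
    by rewrite (pwM _ p2) ?(pwM _ p1) //; lra.
  apply: Rle_trans (@rsum_ge_term (4 * L).+1 (fun q => \rsum_(0 <= a < q.+1) Y q a x) 1 q _ _).
  - by apply: (@rsum_ge_term q.+1 (fun a => Y q a x)); [lia|].
  - by lia.
  - by move=> j; apply: rsum_ge0.
rewrite RInt_Ml; last by apply: contD => //; exact: cont_const.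
rewrite [X in _ <= X]Rmult_assoc; apply: Rmult_le_compat_l; first by apply: Rmult_le_pos; lra.
rewrite RInt_D //; last exact: cont_const.
rewrite RInt_const01 RInt_rsum; last by move=> q _; apply: cont_rsum => a _.
rewrite /hat_energy Rmult_plus_distr_r.
pose Lp := pw (INR L) (p - 2).
have hLp : 0 <= Lp by exact: pw_ge0.
pose S := \rsum_(1 <= q < (4 * L).+1) pw (INR q) (1 - p / 2).
have hS0 : 0 <= S by apply: rsum_ge0 => q _; exact: pw_ge0.
suff : \rsum_(1 <= q < (4 * L).+1) RInt (fun x => \rsum_(0 <= a < q.+1) Y q a x) 0 1 <=
   4 / (r - 1) * (Lp * S).
  rewrite -/Lp -/S -/r Rmult_plus_distr_l Rmult_1_l; have : 0 <= pw (INR L) r by exact: pw_ge0.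
  have : 0 <= Lp * S by apply: Rmult_le_pos.
  move=> h1 h2 h3; have := Rmult_le_pos _ _ (Rlt_le _ _ k3) h2.
  by lra.
rewrite /S -rsumMl -rsumMl; apply: rsum_nat_le => q /andP [q0 _].
have Q1 : 1 <= INR q by rewrite -INR_1; apply: le_INR; lia.
rewrite RInt_rsum //.
apply: (Rle_trans _ (\rsum_(0 <= a < q.+1) (Lp * pw (/ INR q) r * (2 / (r - 1))))).
  apply: rsum_nat_le => a /andP [_ ha].
  rewrite /Y RInt_Ml; last first.
    by apply: cont_peak_pw; [nra|lra].
  have eLp : pw (INR L * INR L) r = Lp * (INR L * INR L).
    by rewrite -{1}pw_2 ?pwA ?/Lp -?pw_sub2; try lra; congr pw; rewrite /r; field.
  rewrite eLp.
  have hpk := @RInt_peak (INR L * INR L) (INR a / INR q) r.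
  have {}hpk := hpk _ hr _.
  apply: (Rle_trans _ (Lp * (INR L * INR L) * pw (/ INR q) r * (2 / (INR L * INR L * (r - 1))))).
    apply: Rmult_le_compat_l.
      apply: Rmult_le_pos; last exact: pw_ge0.
      by apply: Rmult_le_pos => //; exact: Rle_0_sqr.
    apply: hpk; first exact: Rmult_lt_0_compat.
    split; first by apply: Rdiv_le_0_compat; [exact: pos_INR|lra].
    apply: (Rmult_le_reg_r (INR q)); first lra.
    rewrite /Rdiv Rmult_assoc Rinv_l ?Rmult_1_l ?Rmult_1_r; try lra.
    by apply: le_INR; lia.
  by right; field; lra.
(* There are q + 1 <= 2q numerators, which turns 2/(r - 1) into 4/(r - 1). *)
rewrite rsum_nat_const // INR_0 Rminus_0_r S_INR.
have -> : pw (INR q) (1 - p / 2) = INR q * pw (/ INR q) r.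
  rewrite pw_inv; last lra.
  rewrite -pwN; last lra.
  rewrite -{2}(pw_1 (t := INR q)); last lra.
  by rewrite -pwD; congr pw; rewrite /r; ring.
have hq : 0 <= pw (/ INR q) r by exact: pw_ge0.
have -> : 4 / (r - 1) * (Lp * (INR q * pw (/ INR q) r)) = (2 * INR q) * (Lp * pw (/ INR q) r * (2 / (r - 1))) by field; lra.
apply: Rmult_le_compat_r; last lra.
apply: Rmult_le_pos; first by apply: Rmult_le_pos.
by lra.
Qed.

(** * From tents to sharp cutoffs *)

Definition qe c x n : C := expi (2 * PI * ((c + INR n) * (c + INR n) * x)).

Definition ramp L c x : C := (\csum_(n < L) (RtoC (INR n / INR L)%R * qe c x n))%C.

Definition sharp c M x : C := (\csum_(n < M) qe c x n)%C.

Lemma csum_shift_weights (G : nat -> C) k :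
  (\csum_(n < k.+1) (RtoC (INR n) * G n.+1) + \csum_(n < k) G n.+1 =
   \csum_(n < k) (RtoC (INR n) * G n) + RtoC (INR k) * G k + RtoC (INR k) * G k.+1)%C.
Proof.
elim: k => [|k ih]; first by rewrite big_ord_recr !big_ord0 /= INR_0; ring.
have {}ih : (\csum_(n < k.+1) (RtoC (INR n) * G n.+1) =
   \csum_(n < k) (RtoC (INR n) * G n) + RtoC (INR k) * G k + RtoC (INR k) * G k.+1 - \csum_(n < k) G n.+1)%C.
  by rewrite -ih; ring.
rewrite big_ord_recr /= ih [X in (_ + X)%C]big_ord_recr /= [X in _ = (X + _ + _)%C]big_ord_recr /=.
by rewrite !S_INR !RtoC_plus; ring.
Qed.

Lemma RtoC_2 : RtoC 2 = (1 + 1)%C.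
Proof. by rewrite -RtoC_plus; congr RtoC; ring. Qed.

(** Comparison of weights: u + v + 1 = n has min(n, 2L - n) solutions, and min(n, 2L - n) + 2 max(n
    - L, 0) = n. *)
Lemma tent_ramp (g : nat -> C) L :
  (\csum_(u < L) \csum_(v < L) g (u + v).+1 + 2 * \csum_(n < L) (RtoC (INR n) * g (L + n)%N) =
   \csum_(n < 2 * L) (RtoC (INR n) * g n))%C.
Proof.
elim: L => [|L ih]; first by rewrite muln0 !big_ord0; ring.
have -> : (2 * L.+1 = (2 * L).+2)%N by lia.
rewrite [RHS]big_ord_recr /= [X in _ = (X + _)%C]big_ord_recr /= -ih.
have hS : (\csum_(u < L.+1) \csum_(v < L.+1) g (u + v).+1 =
   \csum_(u < L) \csum_(v < L) g (u + v).+1 + 2 * \csum_(u < L) g (L + u.+1)%N + g (2 * L).+1)%C.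
  rewrite big_ord_recr /= big_ord_recr /=.
  have -> : (\csum_(u < L) \csum_(v < L.+1) g (u + v).+1 =
     \csum_(u < L) \csum_(v < L) g (u + v).+1 + \csum_(u < L) g (L + u.+1)%N)%C.
    rewrite -csumD; apply: eq_bigr => u _; rewrite big_ord_recr /=.
    by congr (_ + g _)%C; lia.
  have -> : (\csum_(v < L) g (L + v).+1 = \csum_(u < L) g (L + u.+1)%N)%C.
    by apply: eq_bigr => u _; congr g; lia.
  have -> : (L + L).+1 = (2 * L).+1 by lia.
  by rewrite RtoC_2 Cmult_plus_distr_r !Cmult_1_l !Cplus_assoc.
have hR := csum_shift_weights (fun n => g (L + n)%N) L.
rewrite hS.
have e1 : (L + L.+1)%N = (2 * L).+1 by lia.
have e2 : (L + L)%N = (2 * L)%N by lia.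
rewrite e1 e2 in hR.
have -> : (\csum_(n < L.+1) (RtoC (INR n) * g (L.+1 + n)%N) = \csum_(n < L.+1) (RtoC (INR n) * g (L + n.+1)%N))%C.
  by apply: eq_bigr => n _; congr (_ * g _)%C; lia.
have {}hR : (\csum_(n < L.+1) (RtoC (INR n) * g (L + n.+1)%N) =
   \csum_(n < L) (RtoC (INR n) * g (L + n)%N) + RtoC (INR L) * g (2 * L)%N + RtoC (INR L) * g (2 * L).+1 - \csum_(n < L) g (L + n.+1)%N)%C.
  by rewrite -hR; ring.
rewrite hR S_INR mult_INR (S_INR 1) INR_1 RtoC_2 !(RtoC_plus, RtoC_mult); ring.
Qed.

(** Reversing v to L - 1 - v turns the differences in the tent into the sums counted by
    [tent_ramp]. *)
Lemma hat_qe L c x :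
  hat L (c + INR L) x = (RtoC (/ INR L)%R * \csum_(u < L) \csum_(v < L) qe c x (u + v).+1)%C.
Proof.
rewrite /hat; congr (_ * _)%C; apply: eq_bigr => u _.
rewrite [RHS](reindex_inj rev_ord_inj) /=; apply: eq_bigr => v _.
have e : (L = (L - v.+1) + v.+1)%N by have := ltn_ord v; lia.
have := f_equal INR e; rewrite plus_INR (S_INR v) => eR.
rewrite /qe S_INR plus_INR.
have -> : c + INR L + INR u - INR v = c + (INR u + INR (L - v.+1) + 1) by lra.
by [].
Qed.

(** [tent_ramp] divided by 2L. Its iteration writes a ramp as a sum of tents of dyadic lengths. *)
Lemma ramp_double L c x : (0 < L)%N ->
  ramp (2 * L) c x = (RtoC (/ 2)%R * hat L (c + INR L) x + ramp L (c + INR L) x)%C.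
Proof.
move=> hL; have L0 : 0 < INR L by apply: lt_0_INR; lia.
rewrite hat_qe.
have -> : ramp (2 * L) c x = (RtoC (/ (2 * INR L))%R * \csum_(n < 2 * L) (RtoC (INR n) * qe c x n))%C.
  rewrite /ramp -csumMl; apply: eq_bigr => n _; rewrite Cmult_assoc -RtoC_mult.
  by congr (RtoC _ * _)%C; rewrite mult_INR (S_INR 1) INR_1; field; lra.
have -> : ramp L (c + INR L) x = (RtoC (/ INR L)%R * \csum_(n < L) (RtoC (INR n) * qe c x (L + n)))%C.
  rewrite /ramp -csumMl; apply: eq_bigr => n _; rewrite Cmult_assoc -RtoC_mult.
  congr (RtoC _ * _)%C; first by field; lra.
  by rewrite /qe plus_INR; congr expi; ring.
rewrite -tent_ramp.
have -> : / (2 * INR L) = / 2 * / INR L by field; lra.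
rewrite RtoC_mult.
set a := \big[_/_]_(_ < _) _; set b := \big[_/_]_(_ < _) _.
have h2 : (RtoC (/ 2)%R * RtoC 2 = RtoC 1)%C by rewrite -RtoC_mult; congr RtoC; field.
transitivity (RtoC (/ 2)%R * RtoC (/ INR L)%R * a + (RtoC (/ 2)%R * RtoC 2) * RtoC (/ INR L)%R * b)%C; first by ring.
by rewrite h2; ring.
Qed.

(** Partition of unity 1 = n/L + (L - n)/L. The falling part is again a ramp, centred at -(c + L),
    because the phase is even in c + n; its top, at n = 0, is the isolated term [qe]. *)
Lemma sharp_ramp L c x : (0 < L)%N ->
  sharp c L x = (ramp L c x + (ramp L (- (c + INR L)) x + qe (- (c + INR L)) x L))%C.
Proof.
move=> hL; have L0 : 0 < INR L by apply: lt_0_INR; lia.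
have -> : (ramp L (- (c + INR L)) x + qe (- (c + INR L)) x L)%C =
   (\csum_(n < L.+1) (RtoC (INR n / INR L)%R * qe (- (c + INR L)) x n))%C.
  rewrite big_ord_recr /=; congr (_ + _)%C.
  have -> : INR L / INR L = 1 by field; lra.
  by rewrite Cmult_1_l.
rewrite big_ord_recl /=.
have -> : (RtoC (INR 0 / INR L)%R * qe (- (c + INR L)) x 0 = 0)%C.
  have -> : INR 0 / INR L = 0 by rewrite INR_0; field; lra.
  by ring.
rewrite Cplus_0_l (reindex_inj rev_ord_inj) /= /ramp -csumD; apply: eq_bigr => n _.
have e : (L = (L - n.+1).+1 + n)%N by have := ltn_ord n; lia.
have := f_equal INR e; rewrite plus_INR => eR.
have -> : qe (- (c + INR L)) x (bump 0 (L - n.+1)) = qe c x n.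
  by rewrite /qe /bump /= add1n; congr expi; rewrite {1 2}eR; ring.
rewrite /bump /= add1n -Cmult_plus_distr_r -RtoC_plus.
have -> : INR n / INR L + INR (L - n.+1).+1 / INR L = 1.
  by apply: (Rmult_eq_reg_r (INR L)); last lra; field_simplify; lra.
by rewrite Cmult_1_l.
Qed.

Lemma contC_qe c n : contC (fun x => qe c x n).
Proof.
apply: contC_expi; apply: cont_scal.
by exact: cont_lin.
Qed.

Lemma Lc_zero p a : 0 < p -> 0 < a -> Lc p (fun=> RtoC 0) a.
Proof.
move=> hp ha; split; first exact: contC_const.
split; first by apply: (@cont_ext (fun=> 0)) => [x|]; [rewrite Cmod_0|exact: cont_const].
split => //.
rewrite (RInt_eq01 (g := fun=> 0)) => [|x]; last by rewrite Cmod_0 pw0 //; lra.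
by rewrite RInt_const01; exact: pw_ge0.
Qed.

Lemma Lc_qe p c n : 0 < p -> Lc p (fun x => qe c x n) 1.
Proof.
move=> hp; split; first exact: contC_qe.
split; first by apply: contC_Cmod; exact: contC_qe.
split; first lra.
rewrite (RInt_eq01 (g := fun=> 1)) => [|x]; last by rewrite /qe Cmod_expi pw1.
by rewrite RInt_const01 pw1; lra.
Qed.

(** Iterates [ramp_double] down to the ramp of length 1, which vanishes. The leading 1 supplies the
    positive bound that [Lc] demands there. *)
Lemma Lc_ramp p h k : 1 <= p ->
  (forall i c, (i < k)%N -> Lc p (hat (2 ^ i) c) (h i)) ->
  forall c, Lc p (ramp (2 ^ k) c) (1 + \rsum_(i < k) h i).
Proof.
move=> hp; elim: k => [|k ih] hh c.
  rewrite big_ord0 Rplus_0_r; apply: (@Lc_ext _ (fun=> RtoC 0)); last by apply: Lc_zero; lra.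
  by move=> x; rewrite /ramp expn0 big_ord_recr big_ord0 /= INR_0 /Rdiv Rmult_0_l; ring.
have h0 : (0 < 2 ^ k)%N by rewrite expn_gt0.
apply: (@Lc_ext _ (fun x => (RtoC (/ 2)%R * hat (2 ^ k) (c + INR (2 ^ k)) x + ramp (2 ^ k) (c + INR (2 ^ k)) x)%C)).
  by move=> x; rewrite expnS ramp_double.
rewrite big_ord_recr /=.
have -> : 1 + (\rsum_(i < k) h i + h k) = 1 * h k + (1 + \rsum_(i < k) h i) by ring.
apply: Lc_D => //.
  apply: Lc_scal; try lra; last by apply: hh.
  by rewrite Cmod_R Rabs_pos_eq; lra.
by apply: ih => i c' hi; apply: hh; lia.
Qed.

Lemma Lc_sharp_pow2 p h k : 1 <= p ->
  (forall i c, (i < k)%N -> Lc p (hat (2 ^ i) c) (h i)) ->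
  forall c, Lc p (sharp c (2 ^ k)) (3 + 2 * \rsum_(i < k) h i).
Proof.
move=> hp hh c.
apply: (@Lc_ext _ (fun x => (ramp (2 ^ k) c x + (ramp (2 ^ k) (- (c + INR (2 ^ k))) x + qe (- (c + INR (2 ^ k))) x (2 ^ k)))%C)).
  by move=> x; rewrite -sharp_ramp // expn_gt0.
have -> : 3 + 2 * \rsum_(i < k) h i = (1 + \rsum_(i < k) h i) + ((1 + \rsum_(i < k) h i) + 1) by ring.
by apply: Lc_D => //; [|apply: Lc_D => //]; try apply: Lc_ramp => //; apply: Lc_qe; lra.
Qed.

Lemma sharp_split c M M' x : sharp c (M + M') x = (sharp c M x + sharp (c + INR M) M' x)%C.
Proof.
rewrite /sharp big_split_ord /=; congr (_ + _)%C; apply: eq_bigr => i _.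
by rewrite /qe plus_INR; congr expi; ring.
Qed.

Lemma Lc_sharp p h k : 1 <= p ->
  (forall i c, (i < k)%N -> Lc p (hat (2 ^ i) c) (h i)) ->
  forall M c, (M < 2 ^ k)%N ->
  Lc p (sharp c M) (1 + \rsum_(i < k) (3 + 2 * \rsum_(j < i) h j)).
Proof.
move=> hp; elim: k => [|k ih] hh M c hM.
  have -> : M = 0%N by rewrite expn0 in hM; lia.
  rewrite big_ord0 Rplus_0_r; apply: (@Lc_ext _ (fun=> RtoC 0)); last by apply: Lc_zero; lra.
  by move=> x; rewrite /sharp big_ord0.
have hh' : forall i c, (i < k)%N -> Lc p (hat (2 ^ i) c) (h i).
  by move=> i c' hi; apply: hh; lia.
have hk := Lc_sharp_pow2 hp hh'.
rewrite big_ord_recr /=.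
have -> : 1 + (\rsum_(i < k) (3 + 2 * \rsum_(j < i) h j) + (3 + 2 * \rsum_(j < k) h j)) =
  (3 + 2 * \rsum_(j < k) h j) + (1 + \rsum_(i < k) (3 + 2 * \rsum_(j < i) h j)) by ring.
have [_ [_ [pos _]]] := hk c.
case: (ltnP M (2 ^ k)) => h1.
  by apply: Lc_le (ih hh' M c h1); lra.
have eM : M = (2 ^ k + (M - 2 ^ k))%N by lia.
apply: (@Lc_ext _ (fun x => (sharp c (2 ^ k) x + sharp (c + INR (2 ^ k)) (M - 2 ^ k) x)%C)).
  by move=> x; rewrite -sharp_split -eM.
apply: Lc_D => //; apply: ih => //.
by rewrite expnS in hM; lia.
Qed.

Lemma rsum_geom rho k : 1 < rho -> \rsum_(i < k) (rho ^ i)%R <= rho ^ k / (rho - 1).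
Proof.
move=> hr; elim: k => [|k ih].
  rewrite big_ord0 /=; have : 0 < / (rho - 1) by apply: Rinv_0_lt_compat; lra.
  by rewrite /Rdiv; lra.
rewrite big_ord_recr /=.
have -> : rho * rho ^ k / (rho - 1) = rho ^ k / (rho - 1) + rho ^ k by field; lra.
exact: Rplus_le_compat_r.
Qed.

Definition sharp_const rho := 1 + (3 + 2 / (rho - 1)) / (rho - 1).

Lemma sharp_const_gt0 rho : 1 < rho -> 0 < sharp_const rho.
Proof.
move=> hr; have h : 0 < / (rho - 1) by apply: Rinv_0_lt_compat; lra.
by rewrite /sharp_const /Rdiv; nra.
Qed.

(** For geometrically growing tent bounds, the sum over the tents in a ramp and the sum over binary
    digits are both dominated by their last terms. Hence a sharp cutoff costs only a constant. *)
Lemma Lc_sharp_geom p A rho k : 1 <= p -> 1 <= A -> 1 < rho ->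
  (forall i c, (i < k)%N -> Lc p (hat (2 ^ i) c) (A * rho ^ i)) ->
  forall M c, (M < 2 ^ k)%N -> Lc p (sharp c M) (sharp_const rho * (A * rho ^ k)).
Proof.
move=> hp hA hr hh M c hM.
apply: Lc_le (Lc_sharp hp hh _ hM); first lra.
have hk j : 1 <= rho ^ j by apply: pow_R1_Rle; lra.
have hi : 0 < / (rho - 1) by apply: Rinv_0_lt_compat; lra.
have h1 i : 3 + 2 * \rsum_(j < i) (A * rho ^ j) <= (3 + 2 / (rho - 1)) * A * rho ^ i.
  rewrite rsumMl; set S := \big[_/_]_(_ < _) _.
  have h3 : S <= rho ^ i / (rho - 1) by exact: rsum_geom.
  have h2 := hk i; rewrite /Rdiv in h3 *.
  have h4 : A * S <= A * (rho ^ i * / (rho - 1)) by apply: Rmult_le_compat_l; lra.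
  have h5 : 1 * 1 <= A * rho ^ i by apply: Rmult_le_compat; lra.
  by lra.
apply: (Rle_trans _ (1 + \rsum_(i < k) ((3 + 2 / (rho - 1)) * A * rho ^ i))).
  by apply: Rplus_le_compat_l; apply: rsum_le => i _; exact: h1.
rewrite rsumMl /sharp_const; set S := \big[_/_]_(_ < _) _.
have h3 : S <= rho ^ k / (rho - 1) by exact: rsum_geom.
have h5 : 1 * 1 <= A * rho ^ k by apply: Rmult_le_compat; try lra; exact: hk.
have h6 : 0 <= (3 + 2 / (rho - 1)) * A by rewrite /Rdiv; apply: Rmult_le_pos; nra.
have h7 := Rmult_le_compat_l _ _ _ h6 h3.
have -> : (1 + (3 + 2 / (rho - 1)) / (rho - 1)) * (A * rho ^ k) =
   A * rho ^ k + (3 + 2 / (rho - 1)) * A * (rho ^ k / (rho - 1)) by field; lra.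
by lra.
Qed.

(** * Power sums and harmonic sums *)

Lemma ln_le_sub1 x : 0 < x -> ln x <= x - 1.
Proof. by move=> h; have := exp_ineq1_le (ln x); rewrite exp_ln //; lra. Qed.

(** The concave case follows from [bernoulli_pw] with exponent 1/r applied to t^r. *)
Lemma bernoulli_pw_le1 t r : 0 < r <= 1 -> 0 <= t -> pw t r <= 1 + r * (t - 1).
Proof.
move=> [h0 h1] ht.
have hp : 1 <= / r by rewrite -Rinv_1; apply: Rinv_le_contravar.
have := bernoulli_pw hp (pw_ge0 t r).
rewrite pwA Rinv_r ?pw_1 //; last lra.
move=> h; have := Rmult_le_compat_l r _ _ (Rlt_le _ _ h0) h.
have -> : r * (1 + / r * (pw t r - 1)) = r + pw t r - 1 by field; lra.
by lra.
Qed.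

(** Each new term is at most the increment of n^(1-d)/(1-d), by the concave Bernoulli inequality at
    n/(n+1). *)
Lemma psum_lt1 d n : 0 <= d < 1 ->
  \rsum_(1 <= q < n.+1) pw (INR q) (- d) <= pw (INR n) (1 - d) / (1 - d).
Proof.
move=> [d0 d1]; elim: n => [|n ih].
  by rewrite big_geq // INR_0 pw0 /Rdiv; [rewrite Rmult_0_l; lra|lra].
rewrite big_nat_recr //=.
suff h : pw (INR n.+1) (- d) <= pw (INR n.+1) (1 - d) / (1 - d) - pw (INR n) (1 - d) / (1 - d) by lra.
have m0 : 0 < INR n.+1 by apply: INR_gt0.
have n0 := pos_INR n.
have e : pw (INR n) (1 - d) = pw (INR n.+1) (1 - d) * pw (INR n / INR n.+1) (1 - d).
  rewrite -pwM; [congr pw; field; lra|lra|].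
  by apply: Rdiv_le_0_compat.
have e2 : pw (INR n.+1) (1 - d) = INR n.+1 * pw (INR n.+1) (- d).
  by rewrite pwD pw_1 //; lra.
have h3 : 0 <= INR n / INR n.+1 by apply: Rdiv_le_0_compat.
have h4 : 0 < 1 - d <= 1 by lra.
have hB := bernoulli_pw_le1 h4 h3.
have eq1 : INR n / INR n.+1 - 1 = - / INR n.+1 by rewrite S_INR; field; rewrite -S_INR; lra.
rewrite eq1 in hB.
have p0 := pw_gt0 (- d) m0.
have i0 : 0 < / (1 - d) by apply: Rinv_0_lt_compat; lra.
have hh : pw (INR n) (1 - d) <= INR n.+1 * pw (INR n.+1) (- d) * (1 + (1 - d) * - / INR n.+1).
  by rewrite e e2; apply: Rmult_le_compat_l => //; apply: Rmult_le_pos; lra.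
have -> : pw (INR n.+1) (1 - d) / (1 - d) - pw (INR n) (1 - d) / (1 - d) =
  (pw (INR n.+1) (1 - d) - pw (INR n) (1 - d)) / (1 - d) by field; lra.
apply: (Rmult_le_reg_r (1 - d)); first lra.
rewrite /Rdiv Rmult_assoc Rinv_l ?Rmult_1_r; try lra.
have e3 : INR n.+1 * pw (INR n.+1) (- d) * (1 + (1 - d) * - / INR n.+1) =
  INR n.+1 * pw (INR n.+1) (- d) - pw (INR n.+1) (- d) * (1 - d) by field; lra.
by lra.
Qed.

(** Each new term is at most the drop of n^(1-d)/(d-1), through exp(y) >= 1 + y and ln(x) <= x - 1;
    the first term gives the 1. *)
Lemma psum_gt1 d n : 1 < d ->
  \rsum_(1 <= q < n.+1) pw (INR q) (- d) <= 1 + / (d - 1).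
Proof.
move=> hd; have i0 : 0 < / (d - 1) by apply: Rinv_0_lt_compat; lra.
case: n => [|n]; first by rewrite big_geq //; lra.
suff h : \rsum_(1 <= q < n.+2) pw (INR q) (- d) <= 1 + / (d - 1) * (1 - pw (INR n.+1) (1 - d)).
  have := pw_ge0 (INR n.+1) (1 - d); nra.
elim: n => [|n ih]; first by rewrite big_nat1 INR_1 !pw1; lra.
rewrite big_nat_recr //=.
suff h : pw (INR n.+2) (- d) <= / (d - 1) * (pw (INR n.+1) (1 - d) - pw (INR n.+2) (1 - d)) by lra.
have m0 : 0 < INR n.+2 by apply: INR_gt0.
have n0 : 0 < INR n.+1 by apply: INR_gt0.
have x0 : 0 < INR n.+1 / INR n.+2 by apply: Rdiv_lt_0_compat.
have e : pw (INR n.+1) (1 - d) = pw (INR n.+2) (1 - d) * pw (INR n.+1 / INR n.+2) (1 - d).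
  by rewrite -pwM; [congr pw; field; lra|lra|lra].
have e2 : pw (INR n.+2) (1 - d) = INR n.+2 * pw (INR n.+2) (- d).
  by rewrite pwD pw_1 //; lra.
have hB : 1 + (d - 1) * / INR n.+2 <= pw (INR n.+1 / INR n.+2) (1 - d).
  rewrite pwE // /Rpower.
  apply: Rle_trans (exp_ineq1_le _).
  have := ln_le_sub1 x0.
  have -> : INR n.+1 / INR n.+2 - 1 = - / INR n.+2 by rewrite (S_INR n.+1); field; rewrite -S_INR; lra.
  by nra.
have p0 := pw_gt0 (- d) m0.
have hh : INR n.+2 * pw (INR n.+2) (- d) * (1 + (d - 1) * / INR n.+2) <= pw (INR n.+1) (1 - d).
  by rewrite e e2; apply: Rmult_le_compat_l => //; apply: Rmult_le_pos; lra.
apply: (Rmult_le_reg_l (d - 1)); first lra.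
rewrite -Rmult_assoc Rinv_r ?Rmult_1_l; try lra.
have e3 : INR n.+2 * pw (INR n.+2) (- d) * (1 + (d - 1) * / INR n.+2) =
  INR n.+2 * pw (INR n.+2) (- d) + pw (INR n.+2) (- d) * (d - 1) by field; lra.
by lra.
Qed.

Lemma harmonic_le n : (0 < n)%N -> \rsum_(1 <= q < n.+1) / INR q <= 1 + ln (INR n).
Proof.
case: n => // n _; elim: n => [|n ih]; first by rewrite big_nat1 INR_1 ln_1 Rinv_1; lra.
rewrite big_nat_recr //=.
have m0 : 0 < INR n.+2 by apply: INR_gt0.
have n0 : 0 < INR n.+1 by apply: INR_gt0.
have x0 : 0 < INR n.+1 / INR n.+2 by apply: Rdiv_lt_0_compat.
have := ln_le_sub1 x0; rewrite ln_div //.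
have -> : INR n.+1 / INR n.+2 - 1 = - / INR n.+2 by rewrite (S_INR n.+1); field; rewrite -S_INR; lra.
by lra.
Qed.

Lemma harmonic_ge n : ln (INR n.+1) <= \rsum_(1 <= q < n.+1) / INR q.
Proof.
elim: n => [|n ih]; first by rewrite big_geq // INR_1 ln_1; lra.
rewrite big_nat_recr //=.
have m0 : 0 < INR n.+2 by apply: INR_gt0.
have n0 : 0 < INR n.+1 by apply: INR_gt0.
have x0 : 0 < INR n.+2 / INR n.+1 by apply: Rdiv_lt_0_compat.
have := ln_le_sub1 x0; rewrite ln_div //.
have -> : INR n.+2 / INR n.+1 - 1 = / INR n.+1 by rewrite (S_INR n.+1); field; lra.
by lra.
Qed.

(** * Growth rates of sharp cutoffs *)

Lemma INR_pow2 k : INR (2 ^ k) = (2 ^ k)%R.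
Proof. by elim: k => [|k ih]; rewrite ?expn0 ?INR_1 // expnS mult_INR ih (S_INR 1) INR_1 /=; ring. Qed.

Lemma pw_pow t k a : 0 < t -> pw (t ^ k) a = (pw t a) ^ k.
Proof.
move=> ht; elim: k => [|k ih] /=; first by rewrite pw1.
by rewrite pwM ?ih //; [lra|left; apply: pow_lt].
Qed.

(** Uniform growth of sharp cutoffs of length below 2^k: [rho] is the exponential rate and [l] a
    slowly varying loss, equal below to 1 or to (k+1)^(1/4). *)
Definition sharp_rate p rho (l : nat -> R) := exists C0, 0 < C0 /\
  forall k M c, (M < 2 ^ k)%N -> Lc p (sharp c M) (C0 * l k * rho ^ k).

Lemma Lc_hat_of_energy p C0 a L c : 0 < p -> 0 < a -> (0 < L)%N ->
  RInt (fun x => pw (Cmod (hat L c x)) p) 0 1 <= C0 ->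
  C0 <= pw a p -> Lc p (hat L c) a.
Proof.
move=> hp ha hL h1 h2; split; first exact: contC_hat.
split; first by apply: contC_Cmod; exact: contC_hat.
by split => //; lra.
Qed.

(* From the energy bound on tents of length 2^i to sharp cutoffs, with a slowly varying loss l. *)
Lemma sharp_rate_of_energy p e l : 2 < p -> 0 < e -> (forall k, 1 <= l k) ->
  (forall i k, (i <= k)%N -> l i <= l k) ->
  (exists C1, 0 < C1 /\ forall i, hat_energy p (2 ^ i) <= C1 * pw (l i * (pw 2 e) ^ i) p) ->
  sharp_rate p (pw 2 e) l.
Proof.
move=> hp he l1 lm [C1 [hC1 hE]]; have [C0 [hC0 hH]] := hat_Lp hp.
pose A := pw (C0 * C1 + 1) (/ p).
have hC : 0 < C0 * C1 by apply: Rmult_lt_0_compat.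
have hA : 1 <= A by apply: pw_ge1; [left; apply: Rinv_0_lt_compat; lra|lra].
have hAp : pw A p = C0 * C1 + 1 by rewrite pwA Rinv_l ?pw_1; lra.
have hr : 1 < pw 2 e.
  by rewrite pwE; [rewrite -(Rpower_O 2); [apply: Rpower_lt; lra|lra]|lra].
exists (sharp_const (pw 2 e) * A); split.
  by apply: Rmult_lt_0_compat; [exact: sharp_const_gt0|lra].
move=> k M c hM.
have -> : sharp_const (pw 2 e) * A * l k * pw 2 e ^ k =
   sharp_const (pw 2 e) * ((A * l k) * pw 2 e ^ k) by ring.
apply: Lc_sharp_geom hM => //; first lra.
  by have := l1 k; nra.
move=> i c' hi.
have p1 : 0 < pw 2 e ^ i by apply: pow_lt; lra.
have q1 := l1 i; have q2 := lm _ _ (ltnW hi).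
apply: (Lc_le (a := A * l i * pw 2 e ^ i)); first lra.
  apply: Rmult_le_compat_r; first lra.
  by apply: Rmult_le_compat_l; lra.
have h2 : (0 < 2 ^ i)%N by rewrite expn_gt0.
apply: (Lc_hat_of_energy _ _ h2 (hH (2 ^ i)%N c' h2)); first lra.
  by apply: Rmult_lt_0_compat => //; nra.
have pp := pw_ge0 (l i * pw 2 e ^ i) p.
rewrite Rmult_assoc pwM; [|lra|by apply: Rmult_le_pos; lra].
rewrite hAp.
have h3 := Rmult_le_compat_l _ _ _ (Rlt_le _ _ hC0) (hE i).
by lra.
Qed.

Lemma pw2_pow e i : (pw 2 e) ^ i = pw (INR (2 ^ i)) e.
Proof. by rewrite INR_pow2 pw_pow //; lra. Qed.

(** With d = p/2 - 1 < 1 the sum over q is of order L^(2 - p/2), so both terms of [hat_energy] have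
    size L^(p/2). *)
Lemma sharp_rate_lt4 p : 2 < p < 4 -> sharp_rate p (pw 2 (1/2)) (fun=> 1).
Proof.
move=> [h2 h4]; apply: sharp_rate_of_energy => //; try lra.
  by move=> *; lra.
  by move=> *; lra.
pose d := p / 2 - 1.
have k1 : 0 < pw 4 (1 - d) / (1 - d).
  by apply: Rdiv_lt_0_compat; [apply: pw_gt0; lra|rewrite /d; lra].
exists (1 + pw 4 (1 - d) / (1 - d)); split; first lra.
move=> i; rewrite Rmult_1_l pw2_pow pwA.
have L0 : 0 < INR (2 ^ i) by apply: INR_gt0; rewrite expn_gt0.
set L := (2 ^ i)%N in L0 *.
have hd : 0 <= d < 1 by rewrite /d; lra.
have := psum_lt1 (4 * L) hd; rewrite /hat_energy.
have -> : - d = 1 - p / 2 by rewrite /d; ring.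
set S := \big[_/_]_(_ <= _ < _) _ => hS.
rewrite INR_mul4 pwM in hS; try lra.
have hS2 := Rmult_le_compat_l _ _ _ (pw_ge0 (INR L) (p - 2)) hS.
have e1 : pw (INR L) (p - 2) * pw (INR L) (1 - d) = pw (INR L) (p / 2).
  by rewrite -pwD; congr pw; rewrite /d; field.
have -> : 1 / 2 * p = p / 2 by field.
have e2 : pw (INR L) (p - 2) * (pw 4 (1 - d) * pw (INR L) (1 - d) / (1 - d)) =
  pw 4 (1 - d) / (1 - d) * pw (INR L) (p / 2) by rewrite -e1; field; lra.
by rewrite e2 in hS2; lra.
Qed.

(** Here the sum over q converges and L^(p-2) dominates L^(p/2). *)
Lemma sharp_rate_gt4 p : 4 < p -> sharp_rate p (pw 2 (1 - 2 / p)) (fun=> 1).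
Proof.
move=> h4; have hp2 : 2 / p < 1/2.
  apply: (Rmult_lt_reg_r p); first lra.
  by rewrite /Rdiv Rmult_assoc Rinv_l; lra.
apply: sharp_rate_of_energy => //; try lra.
  by move=> *; lra.
  by move=> *; lra.
pose d := p / 2 - 1.
have hd : 1 < d by rewrite /d; lra.
have k1 : 0 < / (d - 1) by apply: Rinv_0_lt_compat; lra.
exists (2 + / (d - 1)); split; first lra.
move=> i; rewrite Rmult_1_l pw2_pow pwA.
have L1 : 1 <= INR (2 ^ i) by apply: INR_ge1; rewrite expn_gt0.
set L := (2 ^ i)%N in L1 *.
have := psum_gt1 (4 * L) hd; rewrite /hat_energy.
have -> : - d = 1 - p / 2 by rewrite /d; ring.
set S := \big[_/_]_(_ <= _ < _) _ => hS.
have -> : (1 - 2 / p) * p = p - 2 by field; lra.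
have hS2 := Rmult_le_compat_l _ _ _ (pw_ge0 (INR L) (p - 2)) hS.
have : pw (INR L) (p / 2) <= pw (INR L) (p - 2) by apply: pw_le_e; lra.
by lra.
Qed.

(** The sum over q is harmonic, of order i + 1 for L = 2^i; the loss is its fourth root. *)
Lemma sharp_rate_4 : sharp_rate 4 (pw 2 (1/2)) (fun k => pw (INR k.+1) (1/4)).
Proof.
apply: sharp_rate_of_energy => //; try lra.
- by move=> k; apply: pw_ge1; [lra|exact: INR_ge1].
- by move=> i k hik; apply: pw_le; [lra|apply: le_INR; lia].
exists 6; split; first lra.
move=> i; rewrite pw2_pow.
have L1 : 1 <= INR (2 ^ i) by apply: INR_ge1; rewrite expn_gt0.
have h4 : (0 < 4 * 2 ^ i)%N by rewrite muln_gt0 /= expn_gt0.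
have := harmonic_le h4; rewrite /hat_energy INR_mul4.
have -> : \rsum_(1 <= q < (4 * 2 ^ i).+1) / INR q = \rsum_(1 <= q < (4 * 2 ^ i).+1) pw (INR q) (1 - 4 / 2).
  apply: eq_big_nat => q hq; have q0 : 0 < INR q by apply: INR_gt0; lia.
  have -> : 1 - 4 / 2 = - 1 by field.
  by rewrite pwN // pw_1 //; lra.
set S := \big[_/_]_(_ <= _ < _) _ => hS.
have -> : pw (pw (INR i.+1) (1 / 4) * pw (INR (2 ^ i)) (1 / 2)) 4 =
   INR i.+1 * pw (INR (2 ^ i)) 2.
  rewrite pwM; try exact: pw_ge0; rewrite !pwA.
  have -> : 1 / 4 * 4 = 1 by field.
  have -> : 1 / 2 * 4 = 2 by field.
  by rewrite pw_1 //; exact: pos_INR.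
have -> : 4 / 2 = 2 by field.
have -> : 4 - 2 = 2 by ring.
have hln : ln (4 * INR (2 ^ i)) <= 3 + INR i.
  rewrite ln_mult; try lra.
  have := @ln_le_sub1 4 ltac:(lra).
  suff : ln (INR (2 ^ i)) <= INR i by lra.
  rewrite INR_pow2 ln_pow; last lra.
  have := @ln_le_sub1 2 ltac:(lra); have := pos_INR i; nra.
have P0 := pw_ge0 (INR (2 ^ i)) 2.
have := Rmult_le_compat_l _ _ _ P0 hS.
have := Rmult_le_compat_l _ _ _ P0 hln.
have := Rmult_le_pos _ _ P0 (pos_INR i).
rewrite S_INR; lra.
Qed.

(** * Weighted sums *)

(** The exponent [sg] is left free because differentiation and integration in x shift it by 2. *)
Definition wsum sg a b x : C :=
  (\csum_(a <= n < b) (RtoC (pw (INR n) (- sg)) * expi (2 * PI * (INR n * INR n * x))))%C.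

Lemma abel_csum (w : nat -> R) (g : nat -> C) a b : (a <= b)%N ->
  (\csum_(a <= n < b) (RtoC (w n) * g n) =
   \csum_(a <= n < b) (RtoC (w n - w n.+1)%R * \csum_(a <= i < n.+1) g i) +
   RtoC (w b) * \csum_(a <= i < b) g i)%C.
Proof.
move=> hab; rewrite -(subnKC hab); elim: (b - a)%N => [|k ih].
  by rewrite addn0 !big_geq //; ring.
rewrite addnS !big_nat_recr ?leq_addr //= ih.
by rewrite /Rminus RtoC_plus RtoC_opp; ring.
Qed.

Lemma sharp_nat a m x : (a <= m)%N ->
  (\csum_(a <= i < m) expi (2 * PI * (INR i * INR i * x)) = sharp (INR a) (m - a) x)%C.
Proof.
move=> h; rewrite -{1}(add0n a) big_addn big_mkord; apply: eq_bigr => i _.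
by rewrite /qe plus_INR; congr expi; ring.
Qed.

Lemma pw_neg_anti s t a : 0 <= a -> 0 < s -> s <= t -> pw t (- a) <= pw s (- a).
Proof.
move=> ha hs hst; rewrite !pwN; try lra.
by apply: Rinv_le_contravar; [exact: pw_gt0|exact: pw_le].
Qed.

(** The factor 1 + 2^(-sg) covers both signs of [sg]: decreasing weights are largest at 2^j,
    increasing ones at 2^(j+1). *)
Lemma dyadic_weight_le sg j n : (2 ^ j <= n <= 2 ^ j.+1)%N ->
  pw (INR n) (- sg) <= (1 + pw 2 (- sg)) * pw 2 (- sg) ^ j.
Proof.
move=> /andP [h1 h2].
have h0 : (0 < 2 ^ j)%N by rewrite expn_gt0.
have n0 : 0 < INR n by apply: INR_gt0; lia.
have P0 : 0 < pw 2 (- sg) by apply: pw_gt0; lra.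
have Pj : 0 < pw 2 (- sg) ^ j by apply: pow_lt.
case: (Rle_dec 0 sg) => hs.
  apply: (Rle_trans _ (pw 2 (- sg) ^ j)); last by nra.
  rewrite pw2_pow; apply: pw_neg_anti => //; first exact: INR_gt0.
  by apply: le_INR; lia.
apply: (Rle_trans _ (pw 2 (- sg) ^ j.+1)); last by rewrite /=; nra.
by rewrite pw2_pow; apply: pw_le; [lra|apply: le_INR; lia].
Qed.

Lemma tv_monotone (w : nat -> R) a b : (a <= b)%N ->
  (forall n, (a <= n < b)%N -> w n.+1 <= w n) ->
  \rsum_(a <= n < b) Rabs (w n - w n.+1) = w a - w b.
Proof.
move=> hab; rewrite -(subnKC hab); elim: (b - a)%N => [|k ih] h.
  by rewrite addn0 big_geq //; lra.
rewrite addnS big_nat_recr ?leq_addr //= ih; last by move=> n hn; apply: h; lia.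
have := h (a + k)%N _; rewrite addnS ltnS leqnn leq_addr => /(_ isT) h2.
by rewrite Rabs_pos_eq; lra.
Qed.

Lemma dyadic_tv_le sg j b : (2 ^ j <= b <= 2 ^ j.+1)%N ->
  \rsum_(2 ^ j <= n < b) Rabs (pw (INR n) (- sg) - pw (INR n.+1) (- sg)) <=
  (1 + pw 2 (- sg)) * pw 2 (- sg) ^ j.
Proof.
move=> hb; have /andP [h1 h2] := hb.
have h0 : (0 < 2 ^ j)%N by rewrite expn_gt0.
have hwb := dyadic_weight_le sg hb.
have hwa : pw (INR (2 ^ j)) (- sg) <= (1 + pw 2 (- sg)) * pw 2 (- sg) ^ j.
  by apply: dyadic_weight_le; rewrite leqnn expnS; lia.
have p1 := pw_ge0 (INR b) (- sg); have p2 := pw_ge0 (INR (2 ^ j)) (- sg).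
case: (Rle_dec 0 sg) => hs.
  rewrite (@tv_monotone (fun n => pw (INR n) (- sg))) //; first lra.
  move=> n hn; apply: pw_neg_anti => //; first by apply: INR_gt0; lia.
  by apply: le_INR; lia.
have -> : \rsum_(2 ^ j <= n < b) Rabs (pw (INR n) (- sg) - pw (INR n.+1) (- sg)) =
  \rsum_(2 ^ j <= n < b) Rabs ((- pw (INR n) (- sg)) - (- pw (INR n.+1) (- sg))).
  by apply: eq_bigr => n _; rewrite -Rabs_Ropp; congr Rabs; ring.
rewrite (@tv_monotone (fun n => - pw (INR n) (- sg))) //; first lra.
move=> n hn; apply: Ropp_le_contravar; apply: pw_le; first lra.
by apply: le_INR; lia.
Qed.

(** Abel summation writes the block as a combination of sharp cutoffs starting at 2^j. The weights
    are monotone, so the coefficients have total size O(2^(-sg j)). *)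
Lemma Lc_block p rho l sg : 1 <= p -> 0 < rho -> sharp_rate p rho l ->
  exists C1, 0 < C1 /\ forall j b, (2 ^ j <= b <= 2 ^ j.+1)%N ->
  Lc p (wsum sg (2 ^ j) b) (C1 * l j.+1 * (rho * pw 2 (- sg)) ^ j).
Proof.
move=> hp hrho [C0 [hC0 hS]].
have P0 : 0 < pw 2 (- sg) by apply: pw_gt0; lra.
exists (4 * (1 + pw 2 (- sg)) * C0 * rho); split.
  by repeat apply: Rmult_lt_0_compat; lra.
move=> j b hb; have /andP [h1 h2] := hb.
have h20 : (0 < 2 ^ j)%N by rewrite expn_gt0.
pose H := C0 * l j.+1 * rho ^ j.+1.
pose W := (1 + pw 2 (- sg)) * pw 2 (- sg) ^ j.
have Pj : 0 < pw 2 (- sg) ^ j by apply: pow_lt.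
have W0 : 0 < W by apply: Rmult_lt_0_compat; lra.
pose w n := pw (INR n) (- sg).
(* The extra index n = b carries the boundary term of the Abel summation. *)
pose d n := if (n < b)%N then w n - w n.+1 else w b.
pose m n := if (n < b)%N then n.+1 else b.
(* The summand W/2^j makes each coefficient bound strictly positive, as [Lc_scal] demands; over at
   most 2^j + 1 indices it costs no more than 2W. *)
pose k n := Rabs (d n) + W / INR (2 ^ j).
have J0 : 0 < INR (2 ^ j) by apply: INR_gt0; rewrite expn_gt0.
have hk0 n : 0 < k n.
  have h : 0 < W / INR (2 ^ j) by apply: Rdiv_lt_0_compat.
  by have := Rabs_pos (d n); rewrite /k; lra.
have hM M : (M <= 2 ^ j)%N -> Lc p (sharp (INR (2 ^ j)) M) H.
  by move=> hM; apply: hS; rewrite expnS; lia.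
have H0 : 0 < H by case: (hM 0%N isT) => _ [_ []].
have hterm : {in index_iota (2 ^ j) b.+1, forall n,
   Lc p (fun x => RtoC (d n) * sharp (INR (2 ^ j)) (m n - 2 ^ j) x)%C (k n * H)}.
  move=> n; rewrite mem_index_iota => hn; apply: Lc_scal; [lra|exact: hk0| |].
    rewrite Cmod_R /k; have hWJ : 0 < W / INR (2 ^ j) by apply: Rdiv_lt_0_compat.
    by lra.
  by apply: hM; rewrite /m expnS in h2 *; case: ifP; lia.
have hsum := Lc_sum hp hterm.
have hksum : \rsum_(2 ^ j <= n < b.+1) (k n * H) <= 4 * W * H.
  rewrite rsumMr; apply: Rmult_le_compat_r; first lra.
  rewrite /k rsumD rsum_nat_const; last by lia.
  rewrite big_nat_recr //= {2}/d ltnn.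
  pose S := \rsum_(2 ^ j <= i < b) Rabs (w i - w i.+1).
  have t1 : S <= W by exact: dyadic_tv_le.
  have -> : \rsum_(2 ^ j <= i < b) Rabs (d i) = S.
    by apply: eq_big_nat => i /andP [_ hi]; rewrite /d hi.
  have t2 : w b <= W by exact: dyadic_weight_le.
  rewrite Rabs_pos_eq; last exact: pw_ge0.
  have t3 : (INR b.+1 - INR (2 ^ j)) * (W / INR (2 ^ j)) <= 2 * W.
    have hb1 : INR b.+1 <= 3 * INR (2 ^ j) by rewrite expnS in h2; apply: (@INR_le_mul 3); lia.
    have -> : 2 * W = (2 * INR (2 ^ j)) * (W / INR (2 ^ j)) by field; lra.
    apply: Rmult_le_compat_r; last lra.
    by left; apply: Rdiv_lt_0_compat.
  by lra.
have -> : 4 * (1 + pw 2 (- sg)) * C0 * rho * l j.+1 * (rho * pw 2 (- sg)) ^ j = 4 * W * H.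
  by rewrite /W /H Rpow_mult_distr /=; ring.
apply: (Lc_le _ hksum); first lra.
apply: (Lc_ext _ (hsum _)).
  move=> x; rewrite /wsum.
  rewrite (@abel_csum w (fun n => expi (2 * PI * (INR n * INR n * x)))) //.
  rewrite big_nat_recr //=; congr (_ + _)%C.
    apply: eq_big_nat => n hn; rewrite /d /m; case/andP: hn => hn1 ->.
    by rewrite sharp_nat //; lia.
  by rewrite /d /m ltnn sharp_nat.
rewrite rsumMr; apply: Rmult_lt_0_compat => //.
rewrite big_ltn; last by lia.
have : 0 <= \rsum_((2 ^ j).+1 <= i < b.+1) k i by apply: rsum_ge0 => i _; left.
by have := hk0 (2 ^ j)%N; lra.
Qed.

Lemma wsum_dyadic sg J x : wsum sg 1 (2 ^ J) x = (\csum_(j < J) wsum sg (2 ^ j) (2 ^ j.+1) x)%C.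
Proof.
elim: J => [|J ih]; first by rewrite big_ord0 /wsum big_geq.
rewrite big_ord_recr /= -ih /wsum (big_cat_nat (n := 2 ^ J)) //=; first by rewrite expn_gt0.
by rewrite leq_exp2l.
Qed.

Lemma wsum_last sg J N x : (2 ^ J <= N)%N ->
  wsum sg 1 N.+1 x = (wsum sg 1 (2 ^ J) x + wsum sg (2 ^ J) N.+1 x)%C.
Proof.
move=> h; rewrite /wsum (big_cat_nat (n := 2 ^ J)) //=; first by rewrite expn_gt0.
by lia.
Qed.

Lemma T_wsum s N x : T s N x = wsum (2 * s) 1 N.+1 x.
Proof.
rewrite /T /wsum; elim: N => [|N ih]; first by rewrite sum_n_m_zero ?big_geq //; lia.
rewrite sum_n_Sm; last by lia.
rewrite big_nat_recr // -ih; congr Cplus.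
have -> : - (2 * s) = - 2 * s by ring.
rewrite pwE; last exact: INR_gt0.
by rewrite mult_INR; congr (_ * expi _)%C; ring.
Qed.

(** * Littlewood-Paley by telescoping *)

(** From exp(v) - 1 <= v exp(v), the tangent bound at -v, the remainder exp(v) - 1 - v is at most v
    (exp(v) - 1), which is of second order. *)
Lemma exp_quadratic v c : Rabs v <= c -> exp v <= 1 + v + v * v * exp c.
Proof.
move=> hv; have h1 : exp v - 1 <= v * exp v.
  have := exp_ineq1_le (- v); rewrite exp_Ropp => h; have p := exp_pos v.
  have := Rmult_le_compat_l _ _ _ (Rlt_le _ _ p) h; rewrite Rinv_r; lra.
have c0 : 0 <= c by have := Rabs_pos v; lra.
have e1 : 1 <= exp c by have := exp_ineq1_le c; lra.
case: (Rle_dec 0 v) => h.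
  rewrite Rabs_pos_eq // in hv.
  have h2 : exp v <= exp c.
    by case: hv => [hv|->]; [left; exact: exp_increasing|lra].
  suff : v * (exp v - 1) <= v * v * exp c by lra.
  rewrite Rmult_assoc; apply: Rmult_le_compat_l => //.
  by apply: Rle_trans h1 _; apply: Rmult_le_compat_l.
have h2 := exp_ineq1_le v.
suff : v * (exp v - 1) <= v * v * exp c by lra.
have h3 : v * (exp v - 1) <= v * v by nra.
have h4 : 0 <= v * v by nra.
by nra.
Qed.

(** Meant for A = 1 + |P|^2, s = P . D and B = |D|^2, so that the base on the left is 1 + |P + D|^2.
    If A >= 16 B, expand through (1 + t)^r <= exp(r t); otherwise every term is controlled by
    B^r. *)
Lemma pw_second_order r : 1 <= r -> exists K, 1 <= K /\ forall A B s,
  1 <= A -> 0 <= B -> s * s <= A * B -> 0 < A + 2 * s + B ->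
  pw (A + 2 * s + B) r <= pw A r + 2 * r * (pw A (r - 1) * s) +
    K * (pw A (r - 1) * B + pw B r).
Proof.
move=> hr; pose K1 := r + 6 * (r * r) * exp r; pose K2 := pw 25 r + 8 * r * pw 16 (r - 1).
have er := exp_pos r.
have P25 : 0 <= pw 25 r by exact: pw_ge0.
have P16 : 0 <= pw 16 (r - 1) by exact: pw_ge0.
have er2 : 0 <= 6 * (r * r) * exp r by apply: Rmult_le_pos; nra.
have hK1 : 1 <= K1 by rewrite /K1; lra.
have hK2 : 0 <= K2 by rewrite /K2; nra.
exists (K1 + K2); split; first lra.
move=> A B s hA hB hs hpos.
have pA := pw_gt0 (r - 1) (Rlt_le_trans _ _ _ Rlt_0_1 hA); have pB := pw_ge0 B r.
set a := pw A (r - 1) in pA *.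
have eA : pw A r = a * A by apply: pw_sub1; lra.
have haB : 0 <= a * B by nra.
(* The cut at 16 gives |s| <= A/4, hence |t| <= 9/16, and 1 + t stays away from 0. *)
case: (Rle_dec (16 * B) A) => hAB.
  pose t := (2 * s + B) / A.
  have hs4 : Rabs s <= A / 4.
    by apply: Rabs_le; split; nra.
  have [s1 s2] := proj1 (Rabs_le_between _ _) hs4.
  have et : A * t = 2 * s + B by rewrite /t; field; lra.
  have ht : Rabs t <= 1.
    by apply: Rabs_le; split; apply: (Rmult_le_reg_l A); rewrite ?et; lra.
  have [t1 t2] := proj1 (Rabs_le_between _ _) ht.
  have t3 : - (9/16) <= t by apply: (Rmult_le_reg_l A); rewrite ?et; lra.
  have htt : A * (t * t) <= 6 * B.
    apply: (Rmult_le_reg_l A); first lra.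
    have -> : A * (A * (t * t)) = (2 * s + B) * (2 * s + B) by rewrite -et; ring.
    have : s * B <= A / 4 * B by apply: Rmult_le_compat_r; lra.
    by nra.
  have -> : A + 2 * s + B = A * (1 + t) by rewrite Rmult_plus_distr_l et; ring.
  rewrite pwM; try lra.
  have hb : pw (1 + t) r <= 1 + r * t + r * r * (t * t) * exp r.
    rewrite pwE; last lra.
    rewrite /Rpower; have hl := @ln_le_sub1 (1 + t) ltac:(lra).
    apply: (Rle_trans _ (exp (r * t))).
      have : r * ln (1 + t) <= r * t by apply: Rmult_le_compat_l; lra.
      by case=> [h|->]; [left; exact: exp_increasing|lra].
    have -> : r * r * (t * t) * exp r = (r * t) * (r * t) * exp r by ring.
    apply: exp_quadratic; rewrite Rabs_mult Rabs_pos_eq; last lra.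
    by rewrite -[X in _ <= X]Rmult_1_r; apply: Rmult_le_compat_l; lra.
  rewrite eA; apply: Rle_trans (Rmult_le_compat_l _ _ _ _ hb) _; first by nra.
  have -> : a * A * (1 + r * t + r * r * (t * t) * exp r) =
    a * A + r * a * (A * t) + r * r * exp r * a * (A * (t * t)) by ring.
  rewrite et.
  have hc : 0 <= r * r * exp r * a by apply: Rmult_le_pos; [nra|lra].
  have h1 := Rmult_le_compat_l _ _ _ hc htt.
  have h2 : 0 <= K2 * (a * B) by apply: Rmult_le_pos.
  have h3 : 0 <= (K1 + K2) * pw B r by apply: Rmult_le_pos; lra.
  have h4 : K1 * (a * B) = r * (a * B) + 6 * (r * r * exp r * a) * B by rewrite /K1; ring.
  by lra.
have hAB' : A <= 16 * B by lra.
have hs4 : Rabs s <= 4 * B by apply: Rabs_le; split; nra.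
have [s1 s2] := proj1 (Rabs_le_between _ _) hs4.
have h1 : pw (A + 2 * s + B) r <= pw 25 r * pw B r.
  by rewrite -pwM; [apply: pw_le; lra|lra|lra].
have h2 : - (8 * r * pw 16 (r - 1) * pw B r) <= 2 * r * (a * s).
  have ha : a * B <= pw 16 (r - 1) * pw B r.
    rewrite (pw_sub1 r hB) -Rmult_assoc -pwM; try lra.
    by apply: Rmult_le_compat_r => //; apply: pw_le; lra.
  have : - (4 * (a * B)) <= a * s by nra.
  by nra.
have h3 : 0 <= (K1 + K2) * (a * B) by apply: Rmult_le_pos; lra.
have h4 : 0 <= K1 * pw B r by apply: Rmult_le_pos; lra.
have h5 : K2 * pw B r = pw 25 r * pw B r + 8 * r * pw 16 (r - 1) * pw B r by rewrite /K2; ring.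
have h6 := pw_ge0 A r.
by lra.
Qed.

(** Each factor is at most the largest of the three numbers, whose p-th power is among the
    summands. *)
Lemma young3 p a b c : 2 <= p -> 0 <= a -> 0 <= b -> 0 <= c ->
  pw a (p - 2) * b * c <= pw a p + pw b p + pw c p.
Proof.
move=> hp ha hb hc; pose m := Rmax a (Rmax b c).
have m1 : a <= m by exact: Rmax_l.
have m2 : b <= m by apply: Rle_trans (Rmax_l _ _) (Rmax_r _ _).
have m3 : c <= m by apply: Rle_trans (Rmax_r _ _) (Rmax_r _ _).
apply: (Rle_trans _ (pw m p)).
  rewrite (@pw_sub2 m p) -?Rmult_assoc; last lra.
  have p0 := pw_ge0 a (p - 2).
  apply: Rmult_le_compat => //; first by apply: Rmult_le_pos.
  by apply: Rmult_le_compat => //; apply: pw_le; lra.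
have := pw_ge0 a p; have := pw_ge0 b p; have := pw_ge0 c p.
by rewrite /m /Rmax; case: Rle_dec => _; [case: Rle_dec => _|]; lra.
Qed.

(** Hoelder's inequality with exponents p/(p-2), p, p, up to a factor 3: [young3] is applied after
    dividing each function by its norm bound, and each normalised power then has integral at most
    1. *)
Lemma RInt_young3 p u v w X b c : 2 < p -> cont u -> (forall x, 0 <= u x) ->
  0 < X -> RInt (fun x => pw (u x) p) 0 1 <= pw X p ->
  (forall x, 0 <= v x) -> Lr p v b -> (forall x, 0 <= w x) -> Lr p w c ->
  RInt (fun x => pw (u x) (p - 2) * v x * w x) 0 1 <= 3 * (pw X (p - 2) * b * c).
Proof.
move=> hp hu u0 hX hui v0 [hv [hb hvi]] w0 [hw [hc hwi]].
pose M := pw X (p - 2) * b * c.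
have PX := pw_gt0 (p - 2) hX; have PXp := pw_gt0 p hX; have Pb := pw_gt0 p hb; have Pc := pw_gt0 p hc.
have hM : 0 < M by repeat apply: Rmult_lt_0_compat.
have cu : cont (fun x => pw (u x) p) by apply: cont_pw => //; lra.
have cv : cont (fun x => pw (v x) p) by apply: cont_pw => //; lra.
have cw : cont (fun x => pw (w x) p) by apply: cont_pw => //; lra.
pose F x := (M / pw X p) * pw (u x) p + ((M / pw b p) * pw (v x) p + (M / pw c p) * pw (w x) p).
have c1 : cont (fun x => (M / pw X p) * pw (u x) p) by exact: cont_scal.
have c2 : cont (fun x => (M / pw b p) * pw (v x) p) by exact: cont_scal.
have c3 : cont (fun x => (M / pw c p) * pw (w x) p) by exact: cont_scal.
have c23 := contD c2 c3.
apply: (Rle_trans _ (RInt F 0 1)).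
  apply: RInt_le01.
  - apply: contM => //; apply: contM => //; apply: cont_pw => //; lra.
  - exact: contD.
  move=> x _.
  have d1 : 0 <= u x / X by apply: Rdiv_le_0_compat.
  have d2 : 0 <= v x / b by apply: Rdiv_le_0_compat.
  have d3 : 0 <= w x / c by apply: Rdiv_le_0_compat.
  have e t y : 0 < y -> 0 <= t -> pw t p = pw (t / y) p * pw y p.
    move=> hy ht; rewrite -pwM; [congr pw; field; lra| |lra].
    by apply: Rdiv_le_0_compat.
  have hp2 : 2 <= p by lra.
  have := Rmult_le_compat_l _ _ _ (Rlt_le _ _ hM) (young3 hp2 d1 d2 d3).
  have -> : M * (pw (u x / X) (p - 2) * (v x / b) * (w x / c)) = pw (u x) (p - 2) * v x * w x.
    have -> : pw (u x) (p - 2) = pw (u x / X) (p - 2) * pw X (p - 2).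
      by rewrite -pwM; [congr pw; field; lra|lra|lra].
    by rewrite /M; field; lra.
  move=> h; apply: Rle_trans h _; right.
  by rewrite /F (e (u x) X) // (e (v x) b) // (e (w x) c) //; field; lra.
rewrite RInt_D // RInt_D // !RInt_Ml //.
have q t y : 0 < y -> t <= y -> M / y * t <= M.
  move=> hy hty; apply: (Rle_trans _ (M / y * y)); last by right; field; lra.
  by apply: Rmult_le_compat_l => //; left; apply: Rdiv_lt_0_compat.
have := q _ _ PXp hui; have := q _ _ Pb hvi; have := q _ _ Pc hwi.
by rewrite -/M; lra.
Qed.

(** * Real inner product and derivatives of complex-valued functions *)

Definition dot (z w : C) := fst z * fst w + snd z * snd w.

Definition derC (f f' : R -> C) := forall x,
  is_derive (fun t => fst (f t)) x (fst (f' x)) /\ is_derive (fun t => snd (f t)) x (snd (f' x)).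

Lemma derE (f : R -> R) (x a b : R) : is_derive f x a -> b = a -> is_derive f x b.
Proof. by move=> h ->. Qed.

Lemma derD f g x a b : is_derive f x a -> is_derive g x b ->
  is_derive (fun t => f t + g t) x (a + b).
Proof. exact: (@is_derive_plus R_AbsRing R_NormedModule). Qed.

Lemma derM f g x a b : is_derive f x a -> is_derive g x b ->
  is_derive (fun t => f t * g t) x (a * g x + f x * b).
Proof.
move=> hf hg; apply: (is_derive_mult f g) => //.
by move=> n m; rewrite /mult /=; ring.
Qed.

Lemma derC_cont f f' : derC f f' -> contC f.
Proof.
move=> h; split=> x; have [h1 h2] := h x;
  apply: (@ex_derive_continuous R_AbsRing R_NormedModule); [by exists (fst (f' x))|by exists (snd (f' x))].
Qed.

Lemma derC_sum (I : Type) (r : seq I) (F F' : I -> R -> C) :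
  (forall i, derC (F i) (F' i)) ->
  derC (fun x => \big[Cplus/RtoC 0]_(i <- r) F i x) (fun x => \big[Cplus/RtoC 0]_(i <- r) F' i x).
Proof.
move=> h x; rewrite fst_csum snd_csum; split.
  apply: (is_derive_ext (fun t => \rsum_(i <- r) fst (F i t))).
    by move=> t; rewrite fst_csum.
  elim: r => [|i r ih].
    rewrite big_nil; apply: (is_derive_ext (fun=> 0)); last exact: is_derive_const.
    by move=> t; rewrite big_nil.
  rewrite big_cons; apply: (is_derive_ext (fun t => fst (F i t) + \rsum_(j <- r) fst (F j t))).
    by move=> t; rewrite big_cons.
  by apply: derD => //; case: (h i x).
apply: (is_derive_ext (fun t => \rsum_(i <- r) snd (F i t))).
  by move=> t; rewrite snd_csum.
elim: r => [|i r ih].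
  rewrite big_nil; apply: (is_derive_ext (fun=> 0)); last exact: is_derive_const.
  by move=> t; rewrite big_nil.
rewrite big_cons; apply: (is_derive_ext (fun t => snd (F i t) + \rsum_(j <- r) snd (F j t))).
  by move=> t; rewrite big_cons.
by apply: derD => //; case: (h i x).
Qed.

Lemma dot_abs z w : Rabs (dot z w) <= Cmod z * Cmod w.
Proof.
apply: Rsqr_incr_0_var; last by apply: Rmult_le_pos; exact: Cmod_ge_0.
rewrite -Rsqr_abs /Rsqr.
have -> : Cmod z * Cmod w * (Cmod z * Cmod w) = (Cmod z * Cmod z) * (Cmod w * Cmod w) by ring.
rewrite !Cmod_sqr /dot.
by have := Rle_0_sqr (fst z * snd w - snd z * fst w); rewrite /Rsqr; lra.
Qed.

Lemma cont_dot f g : contC f -> contC g -> cont (fun x => dot (f x) (g x)).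
Proof. by move=> [h1 h2] [h3 h4]; apply: contD; apply: contM. Qed.

Lemma der_dot f f' g g' x : derC f f' -> derC g g' ->
  is_derive (fun t => dot (f t) (g t)) x (dot (f' x) (g x) + dot (f x) (g' x)).
Proof.
move=> hf hg; have [f1 f2] := hf x; have [g1 g2] := hg x.
by apply: derE (derD (derM f1 g1) (derM f2 g2)) _; rewrite /dot; ring.
Qed.

Lemma one_add_dot_ge1 z : 1 <= 1 + dot z z.
Proof. by rewrite /dot; have := Rle_0_sqr (fst z); have := Rle_0_sqr (snd z); rewrite /Rsqr; lra. Qed.

(* Integration by parts moves the derivative onto the low-frequency factor; the boundary terms cancel by periodicity. *)
Lemma cross_term p P P' D E (A := fun x => 1 + dot (P x) (P x)) (q := p / 2 - 1) :
  2 < p -> derC P P' -> derC E D -> contC P' -> contC D -> P 1 = P 0 -> E 1 = E 0 ->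
  RInt (fun x => pw (A x) q * dot (P x) (D x)) 0 1 <=
  (p - 1) * RInt (fun x => pw (A x) q * Cmod (P' x) * Cmod (E x)) 0 1.
Proof.
move=> hp dP dE cP' cD P01 E01.
have cP := derC_cont dP; have cE := derC_cont dE.
have A1 x : 1 <= A x by exact: one_add_dot_ge1.
have cA : cont A by apply: contD; [exact: cont_const|exact: cont_dot].
have cAq : cont (fun x => pw (A x) q) by apply: cont_pw => //; rewrite /q; lra.
pose Psi x := pw (A x) q * dot (P x) (E x).
(* [G] collects the terms of the derivative of [Psi] other than the integrand to be bounded, so the
   two integrals are opposite. *)
pose G x := q * (dot (P' x) (P x) + dot (P x) (P' x)) * / A x * pw (A x) q * dot (P x) (E x) +
  pw (A x) q * dot (P' x) (E x).
pose Psi' x := G x + pw (A x) q * dot (P x) (D x).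
have cG : cont G.
  apply: contD; last by apply: contM => //; exact: cont_dot.
  apply: contM; last exact: cont_dot.
  apply: contM => //; apply: contM; last by apply: cont_inv => // x; have := A1 x; lra.
  by apply: cont_scal; apply: contD; exact: cont_dot.
have cX : cont (fun x => pw (A x) q * dot (P x) (D x)) by apply: contM => //; exact: cont_dot.
have cY : cont (fun x => pw (A x) q * Cmod (P' x) * Cmod (E x)).
  by apply: contM; [apply: contM => //|]; exact: contC_Cmod.
have hder x : is_derive Psi x (Psi' x).
  have dA : is_derive A x (dot (P' x) (P x) + dot (P x) (P' x)).
    apply: derE (derD (@is_derive_const R_AbsRing R_NormedModule 1 x) (der_dot x dP dP)) _.
    by rewrite /zero /= Rplus_0_l.
  have dpw : is_derive (fun t => pw (A t) q) x (q * (dot (P' x) (P x) + dot (P x) (P' x)) * / A x * pw (A x) q).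
    apply: (is_derive_ext (fun t => exp (q * ln (A t)))).
      by move=> t; rewrite pwE //; have := A1 t; lra.
    have df : is_derive (fun t => exp (q * ln t)) (A x) (q * / A x * exp (q * ln (A x))).
      by auto_derive; [have := A1 x; lra|field; have := A1 x; lra].
    apply: derE (is_derive_comp _ _ _ _ _ df dA) _.
    rewrite pwE /Rpower; last by have := A1 x; lra.
    by rewrite /scal /= /mult /=; ring.
  by apply: derE (derM dpw (der_dot x dP dE)) _; rewrite /Psi' /G; ring.
have hint : is_RInt Psi' 0 1 (minus (Psi 1) (Psi 0)).
  apply: (is_RInt_derive Psi Psi') => x _; first exact: hder.
  exact: contD.
have h0 : RInt G 0 1 + RInt (fun x => pw (A x) q * dot (P x) (D x)) 0 1 = 0.
  rewrite -RInt_D // (is_RInt_unique _ _ _ _ hint) /Psi /A P01 E01.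
  by rewrite /minus /plus /opp /=; ring.
have hG : RInt (fun x => - G x) 0 1 <= (p - 1) * RInt (fun x => pw (A x) q * Cmod (P' x) * Cmod (E x)) 0 1.
  rewrite -RInt_Ml //; apply: RInt_le01; first exact: contN.
    by exact: cont_scal.
  move=> x _; have h1 := A1 x.
  have d1 := dot_abs (P' x) (E x); have d2 := dot_abs (P x) (P' x); have d3 := dot_abs (P x) (E x).
  have pq := pw_ge0 (A x) q.
  have m1 := Cmod_ge_0 (P x); have m2 := Cmod_ge_0 (P' x); have m3 := Cmod_ge_0 (E x).
  have eP : Cmod (P x) * Cmod (P x) <= A x by rewrite Cmod_sqr /A /dot; lra.
  have q0 : 0 < q by rewrite /q; lra.
  have -> : G x = pw (A x) q * (2 * q * (dot (P x) (P' x) * dot (P x) (E x) / A x) + dot (P' x) (E x)).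
    by rewrite /G /dot; field; lra.
  set M := Cmod (P' x) * Cmod (E x).
  have hM : 0 <= M by apply: Rmult_le_pos.
  (* Differentiating A^q costs a factor |P|^2/A <= 1, whence 2q = p - 2; the term with P' . E adds
     1, which explains p - 1. *)
  have b1 : Rabs (dot (P x) (P' x) * dot (P x) (E x) / A x) <= M.
    rewrite /Rdiv !Rabs_mult (Rabs_pos_eq (/ A x)); last by left; apply: Rinv_0_lt_compat; lra.
    apply: (Rmult_le_reg_r (A x)); first lra.
    rewrite Rmult_assoc Rinv_l ?Rmult_1_r; last lra.
    apply: (Rle_trans _ ((Cmod (P x) * Cmod (P' x)) * (Cmod (P x) * Cmod (E x)))).
      by apply: Rmult_le_compat => //; exact: Rabs_pos.
    have -> : Cmod (P x) * Cmod (P' x) * (Cmod (P x) * Cmod (E x)) = M * (Cmod (P x) * Cmod (P x)) by rewrite /M; ring.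
    by apply: Rmult_le_compat_l.
  have [b2 _] := proj1 (Rabs_le_between _ _) b1.
  have [b3 _] := proj1 (Rabs_le_between _ _) d1.
  rewrite -/M in b3.
  have -> : (p - 1) * (pw (A x) q * Cmod (P' x) * Cmod (E x)) = pw (A x) q * ((2 * q + 1) * M).
    by rewrite /M /q; field.
  rewrite -Ropp_mult_distr_r_reverse.
  apply: Rmult_le_compat_l => //.
  have := Rmult_le_compat_l (2 * q) _ _ ltac:(lra) b2; lra.
have eN : RInt (fun x => - G x) 0 1 = - RInt G 0 1.
  have -> : - RInt G 0 1 = -1 * RInt G 0 1 by ring.
  by rewrite -RInt_Ml //; apply: RInt_eq01 => x; ring.
by lra.
Qed.

(* Telescoping the regularised p-th power of the partial sums replaces the Littlewood-Paley inequality. *)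
Lemma square_sum_bound p : 2 < p -> exists K, 1 <= K /\
  forall (D D' E : nat -> R -> C) (a b e : nat -> R),
  (forall j, derC (E j) (D j)) -> (forall j, derC (D j) (D' j)) -> (forall j, contC (D' j)) ->
  (forall j, E j 1 = E j 0) -> (forall j, D j 1 = D j 0) ->
  (forall j, Lc p (D j) (a j)) -> (forall j, Lc p (E j) (e j)) ->
  (forall j, Lc p (fun x => \csum_(i < j) D' i x)%C (b j)) ->
  (forall j, b j * e j <= a j * a j) ->
  forall J, Lc p (fun x => \csum_(j < J) D j x)%C (pw (K * (1 + \rsum_(j < J) (a j * a j))) (1/2)).
Proof.
move=> hp; have hr : 1 <= p / 2 by lra.
have [K0 [hK0 hstep]] := pw_second_order hr.
(* The part 3p(p-1) pays for the cross term, with 3 from [RInt_young3]; the two error terms of the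
   expansion cost 3 K0 and K0. *)
pose K := 3 * p * (p - 1) + 4 * K0.
have hK : 1 <= K by rewrite /K; nra.
exists K; split => // D D' E a b e dE dD cD' E01 D01 hD hE hb hbe J.
pose P j x := (\csum_(i < j) D i x)%C.
pose A j x := 1 + dot (P j x) (P j x).
pose u j x := pw (A j x) (1/2).
pose S j := \rsum_(i < j) (a i * a i).
have cD j : contC (D j) := derC_cont (dD j).
have cP j : contC (P j) by apply: contC_sum => i _.
have cA j : cont (A j) by apply: contD; [exact: cont_const|exact: cont_dot].
have cu j : cont (u j) by apply: cont_pw => //; lra.
have A1 j x : 1 <= A j x by exact: one_add_dot_ge1.
have a0 j : 0 < a j by case: (hD j) => _ [_ []].
have aa0 j : 0 < a j * a j by apply: Rmult_lt_0_compat.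
have Srec j : S j.+1 = S j + a j * a j by rewrite /S big_ord_recr.
have Smon j k : (j <= k)%N -> S j <= S k.
  move=> /subnKC <-; elim: (k - j)%N => [|n ih]; first by rewrite addn0; lra.
  by rewrite addnS Srec; have := aa0 (j + n)%N; lra.
have S0 : S 0%N = 0 by rewrite /S big_ord0.
(* The final bound is fixed in advance, because Hoelder's inequality at each step j needs a norm
   bound for the partial sum. *)
pose X := pw (K * (1 + S J)) (1/2).
have SJ : 0 <= S J by rewrite -S0; apply: Smon.
have V1 : 1 <= K * (1 + S J) by nra.
have X1 : 1 <= X by apply: pw_ge1 => //; lra.
have XX : X * X = K * (1 + S J) by apply: pw_half; lra.
have euq j x : pw (A j x) (p / 2 - 1) = pw (u j x) (p - 2).
  by rewrite pwA; congr pw; field.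
have eup j x : pw (A j x) (p / 2) = pw (u j x) p.
  by rewrite pwA; congr pw; field.
have XP2 : 1 <= pw X (p - 2) by apply: pw_ge1 => //; lra.
have XP : pw X p = pw X (p - 2) * (K * (1 + S J)).
  by rewrite -XX; apply: pw_sub2; lra.
pose Phi j := RInt (fun x => pw (u j x) p) 0 1.
have KX : 1 <= K * pw X (p - 2) by nra.
(* Step j adds at most K X^(p-2) a_j^2. As X^p = K X^(p-2) (1 + S_J) and K X^(p-2) >= 1, every stage
   stays below X^p. *)
have key j : (j <= J)%N -> Phi j <= 1 + K * pw X (p - 2) * S j.
  elim: j => [|j ih] hj.
    rewrite S0 Rmult_0_r Rplus_0_r /Phi (RInt_eq01 (g := fun=> 1)) ?RInt_const01; first lra.
    move=> x; rewrite -eup /A /P big_ord0 /dot /=.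
    by rewrite !Rmult_0_l !Rplus_0_r pw1.
  have {}ih := ih (ltnW hj).
  have hS1 : S j + a j * a j <= S J.
    by have := Smon _ _ hj; rewrite Srec.
  have Sj0 : 0 <= S j by rewrite -S0; apply: Smon.
  have hX : Phi j <= pw X p.
    apply: Rle_trans ih _; rewrite XP.
    have -> : pw X (p - 2) * (K * (1 + S J)) = K * pw X (p - 2) + K * pw X (p - 2) * S J by ring.
    by apply: Rplus_le_compat => //; apply: Rmult_le_compat_l; have := aa0 j; lra.
  have haX : a j <= X.
    apply: Rsqr_incr_0_var; last lra.
    by rewrite /Rsqr XX; nra.
  have c1 : cont (fun x => pw (u j x) p) by apply: cont_pw => //; lra.
  have c1' : cont (fun x => pw (u j.+1 x) p) by apply: cont_pw => //; lra.
  have cq : cont (fun x => pw (u j x) (p - 2)) by apply: cont_pw => //; lra.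
  have cm := contC_Cmod (cD j).
  have c2 : cont (fun x => pw (A j x) (p / 2 - 1) * dot (P j x) (D j x)).
    by apply: contM; [apply: cont_pw => //; lra|exact: cont_dot].
  have c3 : cont (fun x => pw (u j x) (p - 2) * Cmod (D j x) * Cmod (D j x)).
    by apply: contM => //; apply: contM.
  have c4 : cont (fun x => pw (Cmod (D j x)) p) by apply: cont_pw => //; lra.
  pose R1 x := p * (pw (A j x) (p / 2 - 1) * dot (P j x) (D j x)).
  pose R2 x := K0 * (pw (u j x) (p - 2) * Cmod (D j x) * Cmod (D j x)).
  pose R3 x := K0 * pw (Cmod (D j x)) p.
  have d1 : cont R1 by exact: cont_scal.
  have d2 : cont R2 by exact: cont_scal.
  have d3 : cont R3 by exact: cont_scal.
  have d12 := contD d1 d2; have d123 := contD d12 d3.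
  have hPhi : Phi j.+1 <= RInt (fun x => pw (u j x) p + (R1 x + R2 x + R3 x)) 0 1.
    apply: RInt_le01 => //; first exact: contD.
    move=> x _; rewrite -!eup.
    have eA : A j.+1 x = A j x + 2 * dot (P j x) (D j x) + dot (D j x) (D j x).
      by rewrite /A /P big_ord_recr /= /dot /=; ring.
    have hB : dot (D j x) (D j x) = Cmod (D j x) * Cmod (D j x) by rewrite Cmod_sqr.
    have B0 : 0 <= dot (D j x) (D j x) by rewrite hB; apply: Rle_0_sqr.
    have hs : dot (P j x) (D j x) * dot (P j x) (D j x) <= A j x * dot (D j x) (D j x).
      have := dot_abs (P j x) (D j x).
      have := Rle_0_sqr (fst (P j x) * snd (D j x) - snd (P j x) * fst (D j x)).
      by rewrite /A /Rsqr /dot; nra.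
    have hpos : 0 < A j x + 2 * dot (P j x) (D j x) + dot (D j x) (D j x).
      by rewrite -eA; have := A1 j.+1 x; lra.
    have := hstep _ _ _ (A1 j x) B0 hs hpos; rewrite -eA => h.
    apply: Rle_trans h _; rewrite /R1 /R2 /R3 -euq hB.
    rewrite -(pw_2 (Cmod_ge_0 (D j x))) pwA.
    have -> : 2 * (p / 2) = p by field.
    by rewrite pw_2; [lra|exact: Cmod_ge_0].
  rewrite RInt_D // RInt_D // RInt_D // !RInt_Ml // in hPhi.
  have X0 : 0 < X by lra.
  have u0 i x : 0 <= u i x by exact: pw_ge0.
  have [_ lD] := hD j; have [_ lE] := hE j; have [_ lb] := hb j.
  have i2 := RInt_young3 hp (cu j) (u0 j) X0 hX (fun x => Cmod_ge_0 _) lD (fun x => Cmod_ge_0 _) lD.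
  have i1 := RInt_young3 hp (cu j) (u0 j) X0 hX (fun x => Cmod_ge_0 _) lb (fun x => Cmod_ge_0 _) lE.
  have dP : derC (P j) (fun x => \csum_(i < j) D' i x)%C by apply: derC_sum => i.
  have cP' : contC (fun x => \csum_(i < j) D' i x)%C by apply: contC_sum => i _.
  have P01 : P j 1 = P j 0 by apply: eq_bigr => i _.
  have i0 := cross_term hp dP (dE j) cP' (cD j) P01 (E01 j).
  have eI : RInt (fun x => pw (1 + dot (P j x) (P j x)) (p / 2 - 1) * Cmod (\csum_(i < j) D' i x)%C * Cmod (E j x)) 0 1 =
    RInt (fun x => pw (u j x) (p - 2) * Cmod (\csum_(i < j) D' i x)%C * Cmod (E j x)) 0 1.
    by apply: RInt_eq01 => x; rewrite -euq.
  rewrite eI in i0.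
  have [_ [_ [_ i3]]] := hD j.
  (* Here a_j <= X turns the p-th power into a square. *)
  have i4 : pw (a j) p <= pw X (p - 2) * (a j * a j).
    rewrite (pw_sub2 p (Rlt_le _ _ (a0 j))).
    by apply: Rmult_le_compat_r; [have := aa0 j; lra|apply: pw_le; lra].
  set M := pw X (p - 2) in XP2 XP ih i1 i2 i4 *.
  have i5 : M * b j * e j <= M * (a j * a j) by rewrite Rmult_assoc; apply: Rmult_le_compat_l; [lra|exact: hbe].
  rewrite Srec.
  set I0 := RInt _ 0 1 in i0 hPhi.
  set I1 := RInt _ 0 1 in i0 i1.
  set I2 := RInt _ 0 1 in i2 hPhi.
  set I3 := RInt _ 0 1 in i3 hPhi.
  have hp0 : 0 <= p by lra.
  have k0 : p * I0 <= p * ((p - 1) * (3 * (M * (a j * a j)))).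
    apply: Rmult_le_compat_l => //; apply: Rle_trans i0 _; apply: Rmult_le_compat_l; lra.
  have k2 : K0 * I2 <= K0 * (3 * (M * (a j * a j))).
    by apply: Rmult_le_compat_l; lra.
  have k3 : K0 * I3 <= K0 * (M * (a j * a j)).
    by apply: Rmult_le_compat_l; lra.
  have -> : 1 + K * M * (S j + a j * a j) = 1 + K * M * S j + p * ((p - 1) * (3 * (M * (a j * a j)))) + K0 * (3 * (M * (a j * a j))) + K0 * (M * (a j * a j)).
    by rewrite /K; ring.
  by rewrite /Phi in ih hPhi *; lra.
split; first exact: cP.
split; first exact: (contC_Cmod (cP J)).
split; first by rewrite -/(S J) -/X; lra.
rewrite -/(S J) -/X.
apply: (Rle_trans _ (Phi J)).
  apply: RInt_le01; [by apply: cont_pw; [lra|exact: (contC_Cmod (cP J))]|by apply: cont_pw => //; lra|].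
  move=> x _; apply: pw_le; first lra.
  apply: Rsqr_incr_0_var; last exact: pw_ge0.
  rewrite /Rsqr pw_half; last by have := A1 J x; lra.
  change (Cmod (P J x) * Cmod (P J x) <= A J x).
  by rewrite Cmod_sqr /A /dot; lra.
apply: Rle_trans (key J (leqnn J)) _; rewrite XP.
have -> : pw X (p - 2) * (K * (1 + S J)) = K * pw X (p - 2) + K * pw X (p - 2) * S J by ring.
by lra.
Qed.

(** * Square-root summation of the dyadic blocks *)

Definition block_end N J j := if j == J then N.+1 else (2 ^ j.+1)%N.

Lemma wsum_blocks sg N J x : (2 ^ J <= N)%N ->
  wsum sg 1 N.+1 x = (\csum_(j < J.+1) wsum sg (2 ^ j) (block_end N J j) x)%C.
Proof.
move=> h; rewrite (wsum_last _ _ h) wsum_dyadic big_ord_recr /= {2}/block_end eqxx.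
congr (_ + _)%C; apply: eq_bigr => j _.
by rewrite /block_end (ltn_eqF (ltn_ord j)).
Qed.

Lemma block_end_bounds N J j : (2 ^ J <= N < 2 ^ J.+1)%N -> (2 ^ j <= block_end N J j <= 2 ^ j.+1)%N.
Proof.
move=> h; rewrite /block_end; case: eqP => [->|_]; first by lia.
by rewrite leqnn andbT leq_exp2l.
Qed.

Lemma expi_period k : expi (2 * PI * INR k) = expi 0.
Proof.
have -> : 2 * PI * INR k = 0 + 2 * INR k * PI by ring.
by rewrite /expi cos_period sin_period.
Qed.

Lemma wsum_periodic sg a b : wsum sg a b 1 = wsum sg a b 0.
Proof.
apply: eq_bigr => n _; congr (_ * _)%C.
by rewrite Rmult_1_r !Rmult_0_r -mult_INR expi_period.
Qed.

Definition twopi_i : C := (0, 2 * PI).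
Definition inv_twopi_i : C := (0, - / (2 * PI)).

Lemma inv_twopi_iK : (inv_twopi_i * twopi_i = 1)%C.
Proof. by rewrite /inv_twopi_i /twopi_i /Cmult /RtoC /=; congr pair; field; exact: PI_neq0. Qed.

Lemma derC_scal c f f' : derC f f' -> derC (fun x => (c * f x)%C) (fun x => (c * f' x)%C).
Proof.
move=> h x; have [h1 h2] := h x; split.
  apply: (is_derive_ext (fun t => fst c * fst (f t) + - snd c * snd (f t))).
    by move=> t; rewrite /Cmult /= /Rminus Ropp_mult_distr_l.
  apply: derE (derD (derM (@is_derive_const R_AbsRing R_NormedModule (fst c) x) h1)
     (derM (@is_derive_const R_AbsRing R_NormedModule (- snd c) x) h2)) _ => /=.
  by rewrite /zero /=; ring.
apply: derE (derD (derM (@is_derive_const R_AbsRing R_NormedModule (fst c) x) h2)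
   (derM (@is_derive_const R_AbsRing R_NormedModule (snd c) x) h1)) _ => /=.
by rewrite /zero /=; ring.
Qed.

Lemma derC_ext f f' g' : (forall x, f' x = g' x) -> derC f f' -> derC f g'.
Proof. by move=> h hf x; rewrite -h. Qed.

(** Differentiation multiplies the n-th term by 2 pi i n^2, which lowers the exponent by 2. *)
Lemma derC_wsum sg a b : derC (wsum sg a b) (fun x => (twopi_i * wsum (sg - 2) a b x)%C).
Proof.
apply: (@derC_ext _ (fun x => \big[Cplus/RtoC 0]_(n <- index_iota a b)
   (RtoC (pw (INR n) (- sg)) * (twopi_i * RtoC (INR n * INR n) * expi (2 * PI * (INR n * INR n * x))))%C)).
  move=> x; rewrite /wsum -csumMl; apply: eq_bigr => n _.
  have -> : pw (INR n) (- (sg - 2)) = pw (INR n) (- sg) * (INR n * INR n).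
    by rewrite -pw_2 -?pwD; [congr pw; ring|exact: pos_INR].
  by rewrite (RtoC_mult (pw _ _)) !Cmult_assoc (Cmult_comm twopi_i) -!Cmult_assoc.
apply: derC_sum => n; apply: derC_scal => x; rewrite /expi /twopi_i /=.
by split; auto_derive => //; ring.
Qed.

Lemma Cmod_imag y : Cmod (0, y) = Rabs y.
Proof. by rewrite /Cmod /= Rmult_0_l Rplus_0_l Rmult_1_r -sqrt_Rsqr_abs. Qed.

(** At the critical rate every block has norm of order l_j. Its antiderivative gains 4^(-j), and the
    derivative of the lower blocks, a geometric sum dominated by its last term, loses 4^j; the
    product has the size that [square_sum_bound] allows. *)
Lemma square_wsum p rho l sg : 2 < p -> 0 < rho -> rho * pw 2 (- sg) = 1 ->
  (forall k, 0 < l k) -> (forall i k, (i <= k)%N -> l i <= l k) -> sharp_rate p rho l ->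
  exists C1, 0 < C1 /\ forall N J, (2 ^ J <= N < 2 ^ J.+1)%N ->
  Lc p (wsum sg 1 N.+1) (C1 * pw (1 + \rsum_(j < J.+1) (l j.+1 * l j.+1)) (1/2)).
Proof.
move=> hp hrho hr l0 lm hS; have hp1 : 1 <= p by lra.
have [K [hK hsq]] := square_sum_bound hp.
have [CD [CD0 hD]] := Lc_block sg hp1 hrho hS.
have [CE [CE0 hE]] := Lc_block (sg + 2) hp1 hrho hS.
have [CF [CF0 hF]] := Lc_block (sg - 2) hp1 hrho hS.
have e4 : pw 2 2 = 4 by rewrite pw_2; lra.
have rE : rho * pw 2 (- (sg + 2)) = / 4.
  have -> : - (sg + 2) = - sg + - 2 by ring.
  by rewrite pwD -Rmult_assoc hr pwN ?e4; lra.
have rF : rho * pw 2 (- (sg - 2)) = 4.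
  have -> : - (sg - 2) = - sg + 2 by ring.
  by rewrite pwD -Rmult_assoc hr e4; lra.
have hpi := PI_4; have hpi2 := PI2_3_2.
(* At least [CD], and at least 1, so that its square is at least 8 CF CE. *)
pose C4 := CD + 8 * CF * CE + 1.
have CFE : 0 < CF * CE by apply: Rmult_lt_0_compat.
have hC4 : 8 * CF * CE <= C4 * C4 by rewrite /C4; nra.
exists (pw (K * (1 + C4 * C4)) (1/2)); split; first by apply: pw_gt0; nra.
move=> N J hN.
pose B := block_end N J.
have hB j : (2 ^ j <= B j <= 2 ^ j.+1)%N by exact: block_end_bounds.
pose D j x := wsum sg (2 ^ j) (B j) x.
pose D' j x := (twopi_i * wsum (sg - 2) (2 ^ j) (B j) x)%C.
pose E j x := (inv_twopi_i * wsum (sg + 2) (2 ^ j) (B j) x)%C.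
pose a j := C4 * l j.+1.
pose e j := 1 * (CE * l j.+1 * (/ 4) ^ j).
(* The 8 exceeds 2 pi, and the powers 4^i with i < j add up to at most 4^j/3. *)
pose b j := 8 * CF * l j.+1 * 4 ^ j.
have p4 j : 0 < 4 ^ j by apply: pow_lt; lra.
have hDa j : Lc p (D j) (a j).
  apply: (Lc_le _ _ (hD j (B j) (hB j))); first lra.
  rewrite hr pow1 Rmult_1_r /a; apply: Rmult_le_compat_r; first by left.
  by rewrite /C4; lra.
have hEe j : Lc p (E j) (e j).
  apply: Lc_scal; try lra; last by rewrite -rE; apply: hE.
  rewrite /inv_twopi_i Cmod_imag Rabs_Ropp Rabs_pos_eq.
    by rewrite -Rinv_1; apply: Rinv_le_contravar; lra.
  by left; apply: Rinv_0_lt_compat; lra.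
have hF' j : Lc p (D' j) (8 * (CF * l j.+1 * 4 ^ j)).
  apply: Lc_scal; try lra; last by rewrite -rF; apply: hF.
  by rewrite /twopi_i Cmod_imag Rabs_pos_eq; lra.
have hb j : Lc p (fun x => \csum_(i < j) D' i x)%C (b j).
  case: j => [|j].
    apply: (@Lc_ext _ (fun=> RtoC 0)); first by move=> x; rewrite big_ord0.
    by apply: Lc_zero; [lra|rewrite /b; repeat apply: Rmult_lt_0_compat => //; lra].
  have hpos : 0 < \rsum_(i <- index_iota 0 j.+1) (8 * (CF * l i.+1 * 4 ^ i)).
    rewrite big_ltn //; have : 0 <= \rsum_(1 <= i < j.+1) (8 * (CF * l i.+1 * 4 ^ i)).
      by apply: rsum_ge0 => i _; left; repeat apply: Rmult_lt_0_compat => //; lra.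
    have : 0 < 8 * (CF * l 1%N * 4 ^ 0) by repeat apply: Rmult_lt_0_compat => //; lra.
    by lra.
  have := Lc_sum hp1 (fun i _ => hF' i) hpos.
  move=> h; apply: Lc_ext (Lc_le _ _ h); first by move=> x /=; rewrite big_mkord.
    by lra.
  rewrite big_mkord /b.
  apply: (Rle_trans _ (\rsum_(i < j.+1) (8 * CF * l j.+2 * 4 ^ i))).
    apply: rsum_le => i _.
    have -> : 8 * (CF * l i.+1 * 4 ^ i) = 8 * CF * 4 ^ i * l i.+1 by ring.
    have -> : 8 * CF * l j.+2 * 4 ^ i = 8 * CF * 4 ^ i * l j.+2 by ring.
    apply: Rmult_le_compat_l; first by left; repeat apply: Rmult_lt_0_compat => //; lra.
    by apply: lm; have := ltn_ord i; lia.
  rewrite rsumMl; apply: Rmult_le_compat_l.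
    by left; repeat apply: Rmult_lt_0_compat => //; lra.
  apply: Rle_trans (rsum_geom _ _) _; first lra.
  by have := p4 j.+1; rewrite /Rdiv; lra.
have hbe j : b j * e j <= a j * a j.
  have -> : b j * e j = (8 * CF * CE) * (l j.+1 * l j.+1).
    rewrite /b /e; have : 4 ^ j * (/ 4) ^ j = 1.
      by rewrite -Rpow_mult_distr Rinv_r ?pow1; lra.
    move=> h; transitivity (8 * CF * CE * (l j.+1 * l j.+1) * (4 ^ j * (/ 4) ^ j)); first by ring.
    by rewrite h; ring.
  have -> : a j * a j = (C4 * C4) * (l j.+1 * l j.+1) by rewrite /a; ring.
  by apply: Rmult_le_compat_r => //; apply: Rle_0_sqr.
have dE j : derC (E j) (D j).
  apply: derC_ext (derC_scal inv_twopi_i (derC_wsum (sg + 2) (2 ^ j) (B j))) => x.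
  rewrite Cmult_assoc inv_twopi_iK Cmult_1_l.
  by have -> : sg + 2 - 2 = sg by ring.
have dD j : derC (D j) (D' j) by exact: derC_wsum.
have cD' j : contC (D' j) by case: (hF' j).
have E01 j : E j 1 = E j 0 by rewrite /E wsum_periodic.
have D01 j : D j 1 = D j 0 by rewrite /D wsum_periodic.
have := hsq D D' E a b e dE dD cD' E01 D01 hDa hEe hb hbe J.+1.
move=> h; apply: Lc_ext (Lc_le _ _ h).
- by move=> x; rewrite (wsum_blocks _ _ (J := J)) //; case/andP: hN.
- by lra.
have -> : \rsum_(j < J.+1) (a j * a j) = C4 * C4 * \rsum_(j < J.+1) (l j.+1 * l j.+1).
  by rewrite -rsumMl; apply: eq_bigr => j _; rewrite /a; ring.
set S := \big[_/_]_(_ < _) _.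
have S0 : 0 <= S by apply: rsum_ge0 => j _; apply: Rle_0_sqr.
rewrite -pwM; [|nra|lra].
by apply: pw_le; [lra|nra].
Qed.

(** Triangle inequality over the dyadic blocks, without loss when the ratio rho 2^(-sg) differs from
    1. *)
Lemma sum_wsum p rho l sg : 1 <= p -> 0 < rho -> (forall k, 0 < l k) -> sharp_rate p rho l ->
  exists C1, 0 < C1 /\ forall N J, (2 ^ J <= N < 2 ^ J.+1)%N ->
  Lc p (wsum sg 1 N.+1) (C1 * \rsum_(j < J.+1) (l j.+1 * (rho * pw 2 (- sg)) ^ j)).
Proof.
move=> hp hrho l0 hS.
have [CD [CD0 hD]] := Lc_block sg hp hrho hS.
exists CD; split => // N J hN.
have P0 : 0 < rho * pw 2 (- sg) by apply: Rmult_lt_0_compat => //; apply: pw_gt0; lra.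
rewrite -rsumMl.
have h0 j : 0 < CD * (l j.+1 * (rho * pw 2 (- sg)) ^ j).
  by repeat apply: Rmult_lt_0_compat => //; apply: pow_lt.
apply: (@Lc_ext _ (fun x => \csum_(j < J.+1) wsum sg (2 ^ j) (block_end N J j) x)%C).
  by move=> x; rewrite -wsum_blocks //; case/andP: hN.
apply: (@Lc_sum _ _ p (fun j : 'I_J.+1 => wsum sg (2 ^ j) (block_end N J j))) => //.
  move=> j _; rewrite -Rmult_assoc; apply: hD; exact: block_end_bounds.
rewrite big_ord_recr /=; set S := \big[_/_]_(_ < _) _.
have : 0 <= S by apply: rsum_ge0 => j _; left.
by have := h0 J; lra.
Qed.

(** * Upper bounds *)

Definition upper p s (G : nat -> R) := exists C1, 0 < C1 /\
  forall N, (2 <= N)%N -> Lc p (T s N) (C1 * G N).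

Lemma trunc_log2_bounds N : (2 <= N)%N -> exists J, (2 ^ J <= N < 2 ^ J.+1)%N.
Proof. by move=> h; exists (trunc_log 2 N); apply: trunc_log_bounds; lia. Qed.

Lemma ln_ge_half N : (2 <= N)%N -> 1 / 2 <= ln (INR N).
Proof.
move=> h; have := ln_lt_2; have h2 : INR 2 <= INR N by apply: le_INR; lia.
rewrite !S_INR INR_0 in h2.
have : ln 2 <= ln (INR N) by apply: ln_le; lra.
by lra.
Qed.

Lemma log_le N J : (2 <= N)%N -> (2 ^ J <= N)%N -> INR J.+2 <= 6 * ln (INR N).
Proof.
move=> h hJ; have h1 := ln_ge_half h; have := ln_lt_2.
have h3 : INR (2 ^ J) <= INR N by apply: le_INR; lia.
have h4 : ln (INR (2 ^ J)) <= ln (INR N).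
  by apply: ln_le => //; apply: INR_gt0; rewrite expn_gt0.
rewrite INR_pow2 ln_pow in h4; last lra.
rewrite !S_INR; have := pos_INR J; nra.
Qed.

Lemma two_pw e : e <> 0 -> pw 2 e <> 1.
Proof.
move=> he; rewrite pwE; last lra.
case: (Rtotal_order e 0) => [h|[//|h]].
  by have := Rpower_lt 2 _ _ ltac:(lra) h; rewrite Rpower_O; lra.
by have := Rpower_lt 2 _ _ ltac:(lra) h; rewrite Rpower_O; lra.
Qed.

Lemma two_pw_gt1 e : 0 < e -> 1 < pw 2 e.
Proof. by move=> h; have := @two_pw e ltac:(lra); have := @pw_ge1 2 e ltac:(lra) ltac:(lra); lra. Qed.

(** The blocks grow with ratio 2^(e0 - 2s) > 1, so the last one, of length about N, dominates. *)
Lemma upper_increasing p s e0 l m : 1 <= p -> 0 < e0 - 2 * s ->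
  (forall k, 0 < l k) -> (forall i k, (i <= k)%N -> l i <= l k) ->
  sharp_rate p (pw 2 e0) l ->
  (exists c, 0 < c /\ forall N J, (2 <= N)%N -> (2 ^ J <= N)%N -> l J.+1 <= c * m N) ->
  upper p s (fun N => m N * pw (INR N) (e0 - 2 * s)).
Proof.
move=> hp he l0 lm hS [c [c0 hc]].
have r0 : 0 < pw 2 e0 by apply: pw_gt0; lra.
have [C1 [C10 hT]] := sum_wsum (2 * s) hp r0 l0 hS.
have e1 : pw 2 e0 * pw 2 (- (2 * s)) = pw 2 (e0 - 2 * s) by rewrite -pwD.
rewrite e1 in hT; set rho := pw 2 (e0 - 2 * s) in hT.
have hr : 1 < rho by exact: two_pw_gt1.
have [kk ekk] : exists k, k = rho / (rho - 1) by eexists.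
have hk : 0 < kk by rewrite ekk; apply: Rdiv_lt_0_compat; lra.
exists (C1 * c * kk); split; first by apply: Rmult_lt_0_compat => //; apply: Rmult_lt_0_compat.
move=> N hN; have [J hJ] := trunc_log2_bounds hN; have /andP [hJ1 _] := hJ.
apply: (@Lc_ext _ (wsum (2 * s) 1 N.+1)); first by move=> x; rewrite T_wsum.
apply: (Lc_le _ _ (hT N J hJ)); first lra.
rewrite !Rmult_assoc; apply: Rmult_le_compat_l; first lra.
have pJ : 0 < rho ^ J by apply: pow_lt; lra.
apply: (Rle_trans _ (l J.+1 * (kk * rho ^ J))).
  apply: (Rle_trans _ (\rsum_(j < J.+1) (l J.+1 * rho ^ j))).
    apply: rsum_le => j _; apply: Rmult_le_compat_r; first by apply: pow_le; lra.
    by apply: lm; have := ltn_ord j; lia.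
  rewrite rsumMl; apply: Rmult_le_compat_l; first by left.
  apply: Rle_trans (rsum_geom _ hr) _.
  by right; rewrite ekk /=; field; lra.
have -> : c * (kk * (m N * pw (INR N) (e0 - 2 * s))) =
  (c * m N) * (kk * pw (INR N) (e0 - 2 * s)) by ring.
apply: Rmult_le_compat; first by left.
- by apply: Rmult_le_pos; lra.
- exact: hc.
apply: Rmult_le_compat_l; first lra.
by rewrite /rho pw2_pow; apply: pw_le; [lra|apply: le_INR; lia].
Qed.

Lemma upper_decreasing p s e0 : 1 <= p -> e0 - 2 * s < 0 ->
  sharp_rate p (pw 2 e0) (fun=> 1) -> upper p s (fun=> 1).
Proof.
move=> hp he hS.
have r0 : 0 < pw 2 e0 by apply: pw_gt0; lra.
have [C1 [C10 hT]] := sum_wsum (2 * s) hp r0 (fun=> Rlt_0_1) hS.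
have e1 : pw 2 e0 * pw 2 (- (2 * s)) = pw 2 (e0 - 2 * s) by rewrite -pwD.
rewrite e1 in hT; set rho := pw 2 (e0 - 2 * s) in hT.
have rho0 : 0 < rho by apply: pw_gt0; lra.
have hr : rho < 1.
  have h := @two_pw_gt1 (- (e0 - 2 * s)) ltac:(lra).
  rewrite pwN in h; last lra.
  rewrite -/rho in h; rewrite -Rinv_1 -(Rinv_inv rho).
  by apply: Rinv_lt_contravar; lra.
have hk : 0 < / (1 - rho) by apply: Rinv_0_lt_compat; lra.
exists (C1 * / (1 - rho)); split; first by apply: Rmult_lt_0_compat.
move=> N hN; have [J hJ] := trunc_log2_bounds hN.
apply: (@Lc_ext _ (wsum (2 * s) 1 N.+1)); first by move=> x; rewrite T_wsum.
apply: (Lc_le _ _ (hT N J hJ)); first lra.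
rewrite Rmult_1_r; apply: Rmult_le_compat_l; first lra.
suff h k : \rsum_(j < k) (1 * rho ^ j) <= (1 - rho ^ k) * / (1 - rho).
  apply: Rle_trans (h _) _; have : 0 < rho ^ J.+1 by apply: pow_lt.
  by nra.
elim: k => [|k ih]; first by rewrite big_ord0 /=; lra.
rewrite big_ord_recr /=.
have -> : (1 - rho * rho ^ k) * / (1 - rho) = (1 - rho ^ k) * / (1 - rho) + 1 * rho ^ k by field; lra.
exact: Rplus_le_compat_r.
Qed.

(** The blocks have ratio exactly 1, and their norms add in squares by [square_wsum]. *)
Lemma upper_critical p s l m : 2 < p ->
  (forall k, 0 < l k) -> (forall i k, (i <= k)%N -> l i <= l k) ->
  sharp_rate p (pw 2 (2 * s)) l ->
  (exists c, 0 < c /\ forall N J, (2 <= N)%N -> (2 ^ J <= N)%N ->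
     1 + \rsum_(j < J.+1) (l j.+1 * l j.+1) <= c * m N) ->
  (forall N, (2 <= N)%N -> 0 <= m N) ->
  upper p s (fun N => pw (m N) (1/2)).
Proof.
move=> hp l0 lm hS [c [c0 hc]] m0.
have r0 : 0 < pw 2 (2 * s) by apply: pw_gt0; lra.
have r1 : pw 2 (2 * s) * pw 2 (- (2 * s)) = 1.
  by rewrite -pwD Rplus_opp_r pw_z //; lra.
have [C1 [C10 hT]] := square_wsum hp r0 r1 l0 lm hS.
exists (C1 * pw c (1/2)); split.
  by apply: Rmult_lt_0_compat => //; exact: pw_gt0.
move=> N hN; have [J hJ] := trunc_log2_bounds hN; have /andP [hJ1 _] := hJ.
apply: (@Lc_ext _ (wsum (2 * s) 1 N.+1)); first by move=> x; rewrite T_wsum.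
apply: (Lc_le _ _ (hT N J hJ)); first lra.
rewrite Rmult_assoc -pwM; [|lra|exact: m0].
apply: Rmult_le_compat_l; first lra.
by apply: pw_le; [lra|exact: hc].
Qed.

(** Comparison of norms on a probability space by a pointwise split at the bound X: t^p <= X^p +
    X^(p-r) t^r. The two terms cost the factor 2^(1/p). *)
Lemma upper_exponent p r s G : 0 < p -> p <= r -> (forall N, (2 <= N)%N -> 0 < G N) ->
  upper r s G -> upper p s G.
Proof.
move=> hp hpr hG [C1 [C10 hC]].
exists (pw 2 (/ p) * C1); split; first by apply: Rmult_lt_0_compat => //; apply: pw_gt0; lra.
move=> N hN; have [hc [hcm [hpos hint]]] := hC N hN; set X := C1 * G N in hpos hint.
have -> : pw 2 (/ p) * C1 * G N = pw 2 (/ p) * X by rewrite /X; ring.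
have P2 : 0 < pw 2 (/ p) by apply: pw_gt0; lra.
split => //; split => //; split; first by apply: Rmult_lt_0_compat.
have PX := pw_gt0 p hpos; have PXr := pw_gt0 (p - r) hpos.
have cr : cont (fun x => pw (Cmod (T s N x)) r) by apply: cont_pw => //; lra.
apply: (Rle_trans _ (RInt (fun x => pw X p + pw X (p - r) * pw (Cmod (T s N x)) r) 0 1)).
  apply: RInt_le01; first exact: cont_pw.
    by apply: contD; [exact: cont_const|exact: cont_scal].
  move=> x _; set t := Cmod _; have t0 : 0 <= t by exact: Cmod_ge_0.
  have ptr := pw_ge0 t r.
  case: (Rle_dec t X) => h.
    by have := pw_le (Rlt_le _ _ hp) h; nra.
  suff : pw t p <= pw X (p - r) * pw t r by lra.
  have -> : pw t p = pw t (p - r) * pw t r by rewrite -pwD; congr pw; ring.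
  apply: Rmult_le_compat_r => //.
  have -> : p - r = - (r - p) by ring.
  by apply: pw_neg_anti; lra.
rewrite RInt_D; [|exact: cont_const|by exact: cont_scal].
rewrite RInt_const01 RInt_Ml //.
rewrite pwM; try lra.
rewrite pwA Rinv_l ?pw_1; try lra.
have h := Rmult_le_compat_l _ _ _ (Rlt_le _ _ PXr) hint.
rewrite -pwD in h; have e : p - r + r = p by ring.
by rewrite e in h; lra.
Qed.

Lemma upper_lt4 p s : 2 < p < 4 -> s < 1/4 -> upper p s (fun N => 1 * pw (INR N) (1/2 - 2 * s)).
Proof.
move=> hp hs; apply: (@upper_increasing p s (1/2) (fun=> 1)); try lra.
- by move=> *; lra.
- by move=> *; lra.
- exact: sharp_rate_lt4.
by exists 1; split => [|*]; lra.
Qed.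

Lemma upper_4 s : s < 1/4 ->
  upper 4 s (fun N => pw (ln (INR N)) (1/4) * pw (INR N) (1/2 - 2 * s)).
Proof.
move=> hs; apply: (@upper_increasing 4 s (1/2) (fun k => pw (INR k.+1) (1/4))); try lra.
- by move=> k; apply: pw_gt0; exact: INR_gt0.
- by move=> i k h; apply: pw_le; [lra|apply: le_INR; lia].
- exact: sharp_rate_4.
exists (pw 6 (1/4)); split; first by apply: pw_gt0; lra.
move=> N J hN hJ; have hl := ln_ge_half hN; rewrite -pwM; try lra.
by apply: pw_le; [lra|exact: log_le].
Qed.

Lemma upper_gt4 p s : 4 < p -> 0 < 1 - 2 / p - 2 * s ->
  upper p s (fun N => 1 * pw (INR N) (1 - 2 / p - 2 * s)).
Proof.
move=> hp hs; apply: (@upper_increasing p s (1 - 2 / p) (fun=> 1)) => //; try lra.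
- by move=> *; lra.
- by move=> *; lra.
- exact: sharp_rate_gt4.
by exists 1; split => [|*]; lra.
Qed.

Lemma upper_bounded p s : 4 < p -> 1 - 2 / p - 2 * s < 0 -> upper p s (fun=> 1).
Proof.
move=> hp hs; apply: (@upper_decreasing p s (1 - 2 / p)) => //; first lra.
exact: sharp_rate_gt4.
Qed.

Lemma upper_critical_log p s : 2 < p -> sharp_rate p (pw 2 (2 * s)) (fun=> 1) ->
  upper p s (fun N => pw (ln (INR N)) (1/2)).
Proof.
move=> hp hS; apply: (@upper_critical p s (fun=> 1)) => //.
- by move=> *; lra.
- by move=> *; lra.
- exists 6; split; first lra.
  move=> N J hN hJ; apply: Rle_trans (log_le hN hJ).
  by rewrite rsum_ord_const (S_INR J.+1); lra.
by move=> N hN; have := ln_ge_half hN; lra.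
Qed.

(** The squared losses l_j^2 are of order j^(1/2) over about log N blocks, so their sum is of order
    (log N)^(3/2); the root of it gives the exponent 3/4. *)
Lemma upper_quarter_4 : upper 4 (1/4) (fun N => pw (pw (ln (INR N)) (3/2)) (1/2)).
Proof.
apply: (@upper_critical 4 (1/4) (fun k => pw (INR k.+1) (1/4))); try lra.
- by move=> k; apply: pw_gt0; exact: INR_gt0.
- by move=> i k h; apply: pw_le; [lra|apply: le_INR; lia].
- have -> : 2 * (1/4) = 1/2 by field.
  exact: sharp_rate_4.
- exists (2 * pw 6 (3/2)); split; first by have := @pw_gt0 6 (3/2) ltac:(lra); lra.
  move=> N J hN hJ; have hl := ln_ge_half hN.
  rewrite Rmult_assoc -pwM; try lra.
  have h6 := log_le hN hJ.
  have J1 : 1 <= INR J.+2 by exact: INR_ge1.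
  apply: (Rle_trans _ (2 * pw (INR J.+2) (3/2))); last first.
    by apply: Rmult_le_compat_l; [lra|apply: pw_le; lra].
  have hs : \rsum_(j < J.+1) (pw (INR j.+2) (1/4) * pw (INR j.+2) (1/4)) <= INR J.+1 * pw (INR J.+2) (1/2).
    rewrite -rsum_ord_const; apply: rsum_le => j _; rewrite -pwD.
    have -> : 1/4 + 1/4 = 1/2 by field.
    by apply: pw_le; [lra|apply: le_INR; have := ltn_ord j; lia].
  have h1 : 1 <= pw (INR J.+2) (3/2) by apply: pw_ge1; lra.
  have e : pw (INR J.+2) (3/2) = pw (INR J.+2) (1/2) * INR J.+2.
    by rewrite [LHS]pw_sub1; [congr (pw _ _ * _); field|lra].
  have p0 := pw_ge0 (INR J.+2) (1/2).
  have hJJ : INR J.+1 <= INR J.+2 by apply: le_INR; lia.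
  have h2 : INR J.+1 * pw (INR J.+2) (1/2) <= INR J.+2 * pw (INR J.+2) (1/2).
    exact: Rmult_le_compat_r.
  by rewrite [X in _ <= X]Rmult_comm -e in h2; move: hs; set S := \big[_/_]_(_ < _) _ => hs; lra.
by move=> N hN; exact: pw_ge0.
Qed.

(** * Orthogonality and the second moment *)

Lemma normT_le p s N a : 0 < p -> Lc p (T s N) a -> normT s p N <= a.
Proof.
move=> hp [_ [_ [ha hi]]]; rewrite /normT /Lp_norm -[X in _ <= X](pwV (t := a) hp); last lra.
by apply: pw_le => //; left; apply: Rinv_0_lt_compat.
Qed.

Lemma normT_ge p s N a : 0 < p -> 0 <= a ->
  pw a p <= RInt (fun x => pw (Cmod (T s N x)) p) 0 1 -> a <= normT s p N.
Proof.
move=> hp ha hi; rewrite /normT /Lp_norm -{1}(pwV (t := a) hp) //.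
by apply: pw_le => //; left; apply: Rinv_0_lt_compat.
Qed.

Lemma RInt_cos_freq (m n : nat) :
  RInt (fun x => cos (2 * PI * (INR m * x) - 2 * PI * (INR n * x))) 0 1 = if m == n then 1 else 0.
Proof.
have hpi := PI_RGT_0.
case: eqP => [->|hmn].
  rewrite (RInt_eq01 (g := fun=> 1)) ?RInt_const01 // => x.
  by rewrite Rminus_diag_eq // cos_0.
pose k := 2 * PI * (INR m - INR n).
have hk : k <> 0.
  have h : INR m - INR n <> 0 by move=> h; apply: hmn; apply: INR_eq; lra.
  by apply: Rmult_integral_contrapositive_currified => //; lra.
have hint : is_RInt (fun x => cos (2 * PI * (INR m * x) - 2 * PI * (INR n * x))) 0 1
    (minus (sin (k * 1) / k) (sin (k * 0) / k)).
  apply: (is_RInt_derive (fun x => sin (k * x) / k)) => x _.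
    auto_derive => //; have -> : 2 * PI * (INR m * x) - 2 * PI * (INR n * x) = k * x by rewrite /k; ring.
    by field.
  apply: cont_cos; apply: contB; apply: cont_scal;
    by exact: cont_lin.
rewrite (is_RInt_unique _ _ _ _ hint) /minus /plus /opp /= Rmult_1_r Rmult_0_r sin_0.
have -> : k = 2 * PI * INR m - 2 * PI * INR n by rewrite /k; ring.
have e1 := f_equal fst (expi_period m); have e2 := f_equal snd (expi_period m).
have e3 := f_equal fst (expi_period n); have e4 := f_equal snd (expi_period n).
rewrite /expi /= sin_0 in e2 e4; rewrite sin_minus e2 e4 /Rdiv; ring.
Qed.

Definition trig (I : Type) (r : seq I) (a : I -> R) (m : I -> nat) (x : R) : C :=
  (\csum_(i <- r) (RtoC (a i) * expi (2 * PI * (INR (m i) * x))))%C.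

Lemma contC_trig (I : Type) (r : seq I) a m : contC (trig r a m).
Proof.
apply: contC_sum => i _; apply: contC_M; first exact: contC_const.
by apply: contC_expi; apply: cont_scal; exact: cont_lin.
Qed.

(** Two families are allowed because the identity serves both for moments and for the pairing with a
    dual sum. *)
Lemma parseval (I J : Type) (r : seq I) (q : seq J) a m b k :
  RInt (fun x => dot (trig r a m x) (trig q b k x)) 0 1 =
  \rsum_(i <- r) \rsum_(j <- q) (a i * b j * (if m i == k j then 1 else 0)).
Proof.
pose F i j x := a i * b j * cos (2 * PI * (INR (m i) * x) - 2 * PI * (INR (k j) * x)).
have cF0 i j : cont (fun x => cos (2 * PI * (INR (m i) * x) - 2 * PI * (INR (k j) * x))).
  apply: cont_cos; apply: contB; apply: cont_scal;
    by exact: cont_lin.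
have cF i j : cont (F i j) by exact: cont_scal.
rewrite (RInt_eq01 (g := fun x => \rsum_(i <- r) \rsum_(j <- q) F i j x)); last first.
  move=> x; rewrite /dot /trig !fst_csum !snd_csum !big_distrl /= -rsumD.
  apply: eq_bigr => i _; rewrite !big_distrr /= -rsumD; apply: eq_bigr => j _.
  by rewrite /F cos_minus; ring.
rewrite RInt_rsum; last by move=> i _; apply: cont_rsum.
apply: eq_bigr => i _; rewrite RInt_rsum //; apply: eq_bigr => j _.
by rewrite /F RInt_Ml // RInt_cos_freq.
Qed.

Lemma T_trig s N x :
  T s N x = trig (index_iota 1 N.+1) (fun n => pw (INR n) (- (2 * s))) (fun n => (n * n)%N) x.
Proof. by rewrite T_wsum; apply: eq_bigr => n _; rewrite mult_INR. Qed.

Lemma contC_T s N : contC (T s N).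
Proof.
apply: (@contC_ext (trig (index_iota 1 N.+1) (fun n => pw (INR n) (- (2 * s))) (fun n => (n * n)%N))).
  by move=> x; rewrite T_trig.
exact: contC_trig.
Qed.

Lemma rsum_diag_le (r : seq nat) (q : seq nat) (F : nat -> nat -> R) (f : nat -> nat) :
  (forall i j, 0 <= F i j) -> {in r, forall i, f i \in q} ->
  \rsum_(i <- r) F i (f i) <= \rsum_(i <- r) \rsum_(j <- q) F i j.
Proof.
move=> h0 hf; apply: rsum_le_seq => i /hf hq.
rewrite (big_rem _ hq) /= -[X in X <= _]Rplus_0_r.
by apply: Rplus_le_compat_l; exact: rsum_ge0.
Qed.

Lemma T_L2_ge s N :
  \rsum_(1 <= n < N.+1) pw (INR n) (- (4 * s)) <= RInt (fun x => pw (Cmod (T s N x)) 2) 0 1.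
Proof.
rewrite (RInt_eq01 (g := fun x => dot (T s N x) (T s N x))); last first.
  by move=> x; rewrite pw_2 ?Cmod_sqr //; exact: Cmod_ge_0.
rewrite (RInt_eq01 (g := fun x => dot (trig (index_iota 1 N.+1) (fun n => pw (INR n) (- (2 * s))) (fun n => (n * n)%N) x)
   (trig (index_iota 1 N.+1) (fun n => pw (INR n) (- (2 * s))) (fun n => (n * n)%N) x))); last first.
  by move=> x; rewrite T_trig.
rewrite parseval; pose F (i j : nat) := pw (INR i) (- (2 * s)) * pw (INR j) (- (2 * s)) * (if (i * i == j * j)%N then 1 else 0).
apply: Rle_trans (@rsum_diag_le (index_iota 1 N.+1) (index_iota 1 N.+1) F id _ _).
- right; apply: eq_bigr => n _; rewrite /F eqxx Rmult_1_r -pwD; congr pw; ring.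
- move=> i j; rewrite /F; case: eqP => _; last lra.
  by rewrite Rmult_1_r; apply: Rmult_le_pos; exact: pw_ge0.
- by [].
Qed.

(** * Lower bounds *)

(** Only N/2 < n <= N is kept; there n^(-d) is at least (1/2)^|d| N^(-d) for either sign of [d]. *)
Lemma psum_ge d : exists c, 0 < c /\ forall N, (1 <= N)%N ->
  c * pw (INR N) (1 - d) <= \rsum_(1 <= n < N.+1) pw (INR n) (- d).
Proof.
pose c := pw (1/2) (Rabs d).
have c0 : 0 < c by apply: pw_gt0; lra.
exists (c / 2); split; first lra.
move=> N hN; have N0 : 0 < INR N by exact: INR_gt0.
pose h := (N./2)%N.
have hh : (2 * h <= N)%N by rewrite /h; have := odd_double_half N; rewrite -mul2n; lia.
have hh2 : (N < 2 * h + 2)%N by rewrite /h; have := odd_double_half N; rewrite -mul2n; case: odd; lia.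
have hR : 2 * INR h <= INR N by apply: (@INR_mul_le 2); lia.
apply: Rle_trans (@rsum_subrange 1 N.+1 h.+1 N.+1 _ _ _ (fun n => pw_ge0 (INR n) (- d))) => //.
apply: (Rle_trans _ (\rsum_(h.+1 <= n < N.+1) (c * pw (INR N) (- d)))); last first.
  apply: rsum_nat_le => n /andP [hn1 hn2].
  have n0 : 0 < INR n by apply: INR_gt0; lia.
  have hn3 : INR N / 2 <= INR n.
    suff : INR N <= 2 * INR n by lra.
    by apply: (@INR_le_mul 2); lia.
  have hn4 : INR n <= INR N by apply: le_INR; lia.
  have pN := pw_gt0 (- d) N0.
  case: (Rle_dec 0 d) => hd.
    apply: (Rle_trans _ (pw (INR N) (- d))); last exact: pw_neg_anti.
    have : c <= 1 by apply: pw_le1; [exact: Rabs_pos|lra].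
    by nra.
  have -> : c = pw (1/2) (- d) by rewrite /c Rabs_left //; lra.
  by rewrite -pwM; [apply: pw_le; lra|lra|lra].
rewrite rsum_nat_const; last by lia.
have -> : 1 - d = 1 + - d by ring.
rewrite pwD pw_1; last lra.
have pN := pw_gt0 (- d) N0.
have : 0 < c * pw (INR N) (- d) by apply: Rmult_lt_0_compat.
by rewrite !S_INR; nra.
Qed.

(* For p < 2 the L^3 upper bound prevents the mass of |f|^2 from concentrating on a small set. *)
Lemma lower_from_L2 p c C1 : 0 < p -> 0 < c -> 0 < C1 -> exists c', 0 < c' /\
  forall f X, 0 < X -> contC f -> c * (X * X) <= RInt (fun x => pw (Cmod (f x)) 2) 0 1 ->
  (p < 2 -> Lc 3 f (C1 * X)) ->
  pw (c' * X) p <= RInt (fun x => pw (Cmod (f x)) p) 0 1.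
Proof.
move=> hp hc hC.
(* Threshold [lam = k * X]. For p < 2 the values above it contribute at most C1^3 X^3/lam = (c/2)
   X^2 to the second moment; for p >= 2 those below it contribute at most lam^2 = (c/2) X^2. Half of
   the mass remains in both cases. *)
pose k := if Rlt_dec p 2 then 2 * (C1 * C1 * C1) / c else pw (c / 2) (1/2).
have hC3 : 0 < C1 * C1 * C1 by repeat apply: Rmult_lt_0_compat.
have k0 : 0 < k.
  rewrite /k; case: (Rlt_dec p 2) => /= _; first by apply: Rdiv_lt_0_compat; lra.
  by apply: pw_gt0; lra.
have pk := pw_gt0 (p - 2) k0.
have hcc : 0 < c / 2 * pw k (p - 2) by apply: Rmult_lt_0_compat; lra.
exists (pw (c / 2 * pw k (p - 2)) (/ p)); split; first exact: pw_gt0.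
move=> f X hX hf h2 h3.
have cp : cont (fun x => pw (Cmod (f x)) p) by apply: cont_pw => //; exact: contC_Cmod.
have c2 : cont (fun x => pw (Cmod (f x)) 2) by apply: cont_pw; [lra|exact: contC_Cmod].
have c3 : cont (fun x => pw (Cmod (f x)) 3) by apply: cont_pw; [lra|exact: contC_Cmod].
set I := RInt (fun x => pw (Cmod (f x)) p) 0 1.
have I0 : 0 <= I by apply: RInt_ge01 => // x; exact: pw_ge0.
set I2 := RInt _ 0 1 in h2.
pose lam := k * X.
have lam0 : 0 < lam by apply: Rmult_lt_0_compat.
have plam := pw_gt0 (2 - p) lam0.
have key : I2 <= c / 2 * (X * X) + pw lam (2 - p) * I.
  case: (Rlt_dec p 2) => hp2.
    have [_ [_ [_ h3']]] := h3 hp2.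
    have hlam : lam = 2 * (C1 * C1 * C1) / c * X by rewrite /lam /k; case: (Rlt_dec p 2) => //=; lra.
    apply: (Rle_trans _ (RInt (fun x => / lam * pw (Cmod (f x)) 3 + pw lam (2 - p) * pw (Cmod (f x)) p) 0 1)).
      apply: RInt_le01 => //.
        by apply: contD; exact: cont_scal.
      move=> x _; set t := Cmod _; have t0 : 0 <= t by exact: Cmod_ge_0.
      have e3 : pw t 3 = pw t 2 * t.
        by rewrite (pw_sub1 3 t0); congr (pw _ _ * _); ring.
      have p2 := pw_ge0 t 2; have pp := pw_ge0 t p; have p3 := pw_ge0 t 3.
      have il := Rinv_0_lt_compat _ lam0.
      case: (Rle_dec t lam) => ht.
        have -> : pw t 2 = pw t (2 - p) * pw t p by rewrite -pwD; congr pw; ring.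
        have h1 : pw t (2 - p) <= pw lam (2 - p) by apply: pw_le; lra.
        have h5 := Rmult_le_compat_r _ _ _ pp h1.
        have : 0 <= / lam * pw t 3 by apply: Rmult_le_pos; lra.
        by lra.
      have h1 : 1 <= / lam * t.
        by apply: (Rmult_le_reg_l lam) => //; rewrite -Rmult_assoc Rinv_r; lra.
      have h5 := Rmult_le_compat_l _ _ _ p2 h1.
      have : 0 <= pw lam (2 - p) * pw t p by apply: Rmult_le_pos; lra.
      by rewrite e3; lra.
    rewrite RInt_D; try by exact: cont_scal.
    rewrite !RInt_Ml //; apply: Rplus_le_compat; last by rewrite -/I; lra.
    have il := Rinv_0_lt_compat _ lam0.
    apply: Rle_trans (Rmult_le_compat_l _ _ _ (Rlt_le _ _ il) h3') _.
    have CX : 0 <= C1 * X by left; apply: Rmult_lt_0_compat.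
    have -> : pw (C1 * X) 3 = (C1 * X) * (C1 * X) * (C1 * X).
      by rewrite (pw_sub1 3 CX) -(pw_2 CX); congr (pw _ _ * _); ring.
    by right; rewrite hlam; field; lra.
  have hlam : lam * lam = c / 2 * (X * X).
    have hc2 : 0 <= c / 2 by lra.
    rewrite /lam /k; case: (Rlt_dec p 2) => //= _.
    have -> : pw (c / 2) (1 / 2) * X * (pw (c / 2) (1 / 2) * X) =
      (pw (c / 2) (1 / 2) * pw (c / 2) (1 / 2)) * (X * X) by ring.
    by rewrite pw_half.
  apply: (Rle_trans _ (RInt (fun x => c / 2 * (X * X) + pw lam (2 - p) * pw (Cmod (f x)) p) 0 1)).
    apply: RInt_le01 => //.
      by apply: contD; [exact: cont_const|exact: cont_scal].
    move=> x _; set t := Cmod _; have t0 : 0 <= t by exact: Cmod_ge_0.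
    have pp := pw_ge0 t p.
    have h6 : 0 <= pw lam (2 - p) * pw t p by apply: Rmult_le_pos; lra.
    rewrite -hlam; case: (Rle_dec t lam) => ht; first by rewrite pw_2 //; nra.
    have -> : pw t 2 = pw t (2 - p) * pw t p by rewrite -pwD; congr pw; ring.
    have e : 2 - p = - (p - 2) by ring.
    have h1 : pw t (2 - p) <= pw lam (2 - p) by rewrite e; apply: pw_neg_anti; lra.
    have := Rmult_le_compat_r _ _ _ pp h1; nra.
  rewrite RInt_D; [|exact: cont_const|by exact: cont_scal].
  by rewrite RInt_const01 RInt_Ml // -/I; lra.
have h4 : c / 2 * (X * X) <= pw lam (2 - p) * I by lra.
rewrite pwM; [|by left; exact: pw_gt0|lra].
rewrite pwA Rinv_l ?pw_1; [|lra|lra].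
have e1 : pw X p = pw X (p - 2) * (X * X) by apply: pw_sub2; lra.
have e2 : pw lam (p - 2) = pw k (p - 2) * pw X (p - 2) by rewrite -pwM //; lra.
have pl := pw_gt0 (p - 2) lam0.
have e3 : pw lam (p - 2) * pw lam (2 - p) = 1.
  by rewrite -pwD (_ : p - 2 + (2 - p) = 0) ?pw_z //; ring.
have := Rmult_le_compat_l _ _ _ (Rlt_le _ _ pl) h4.
have -> : pw lam (p - 2) * (pw lam (2 - p) * I) = I by rewrite -Rmult_assoc e3 Rmult_1_l.
rewrite e2 e1 => h5.
apply: Rle_trans h5; right; ring.
Qed.

Lemma RInt_ge_sub f d : cont f -> (forall x, 0 <= f x) -> 0 <= d <= 1 ->
  RInt f 0 d <= RInt f 0 1.
Proof.
move=> hf h [d0 d1]; rewrite -(RInt_Chasles f 0 d 1); try exact: cont_ex_RInt.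
have : 0 <= RInt f d 1 by apply: RInt_ge_0 => //; exact: cont_ex_RInt.
by rewrite /plus /=; lra.
Qed.

(* On |x| <= 1/(6N^2) all phases lie in [0, pi/3], so there is no cancellation. *)
Lemma lower_origin p s : 0 < p -> exists c, 0 < c /\ forall N, (2 <= N)%N ->
  pw (c * pw (INR N) (1 - 2 / p - 2 * s)) p <= RInt (fun x => pw (Cmod (T s N x)) p) 0 1.
Proof.
move=> hp; have [c [c0 hc]] := psum_ge (2 * s).
have P6 : 0 < pw (/ 6) (/ p) by apply: pw_gt0; lra.
exists (c / 2 * pw (/ 6) (/ p)); split; first by apply: Rmult_lt_0_compat; lra.
move=> N hN; have N1 : 1 <= INR N by apply: INR_ge1; lia.
pose d := / (6 * (INR N * INR N)).
have hNN : 1 <= INR N * INR N by nra.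
have d0 : 0 < d by apply: Rinv_0_lt_compat; lra.
have ed : INR N * INR N * d = / 6 by rewrite /d; field; lra.
have d1 : d <= 1 by rewrite -Rinv_1; apply: Rinv_le_contravar; lra.
have cT : cont (fun x => pw (Cmod (T s N x)) p) by apply: cont_pw => //; apply: contC_Cmod; exact: contC_T.
apply: Rle_trans (RInt_ge_sub cT (fun x => pw_ge0 _ _) (conj (Rlt_le _ _ d0) d1)).
pose B := c / 2 * pw (INR N) (1 - 2 * s).
have pN : 0 < pw (INR N) (1 - 2 * s) by apply: pw_gt0; lra.
have B0 : 0 < B by apply: Rmult_lt_0_compat; lra.
apply: (Rle_trans _ (RInt (fun=> pw B p) 0 d)).
  rewrite (@RInt_const R_CompleteNormedModule) /scal /= /mult /= Rminus_0_r.
  have -> : 1 - 2 / p - 2 * s = (1 - 2 * s) + - (2 / p) by ring.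
  rewrite pwD.
  have -> : c / 2 * pw (/ 6) (/ p) * (pw (INR N) (1 - 2 * s) * pw (INR N) (- (2 / p))) =
    B * (pw (/ 6) (/ p) * pw (INR N) (- (2 / p))) by rewrite /B; ring.
  have p2 : 0 < pw (INR N) (- (2 / p)) by apply: pw_gt0; lra.
  rewrite pwM; [|lra|by apply: Rmult_le_pos; lra].
  rewrite pwM; [|lra|lra].
  rewrite !pwA Rinv_l ?pw_1; [|lra|lra].
  have -> : - (2 / p) * p = - 2 by field; lra.
  rewrite pwN ?pw_2; [|lra|lra].
  by right; rewrite /d; field; lra.
apply: RInt_le; [lra|exact: ex_RInt_const|exact: cont_ex_RInt|].
move=> x hx; apply: pw_le; first lra.
apply: (Rle_trans _ (fst (T s N x))); last first.
  apply: Rle_trans (Rle_abs _) _; exact: re_le_Cmod.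
rewrite T_trig /trig fst_csum /=.
have hcN := hc N ltac:(lia).
apply: (Rle_trans _ (/ 2 * \rsum_(1 <= n < N.+1) pw (INR n) (- (2 * s)))).
  by rewrite /B; lra.
rewrite -rsumMl; apply: rsum_nat_le => n /andP [hn1 hn2].
have pn := pw_ge0 (INR n) (- (2 * s)).
suff : / 2 <= cos (2 * PI * (INR (n * n) * x)) by nra.
have hpi := PI_RGT_0.
have hnx : 0 <= INR (n * n) * x <= / 6.
  split; first by apply: Rmult_le_pos; [exact: pos_INR|lra].
  rewrite -ed; apply: Rmult_le_compat; [exact: pos_INR|lra| |lra].
  by rewrite -mult_INR; apply: le_INR; apply/leP; apply: leq_mul; lia.
have -> : / 2 = cos (PI / 3) by rewrite cos_PI3; field.
by apply: cos_decr_1; nra.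
Qed.

(** * Duality at the critical exponent *)

Definition dual_sum ga M x : C := trig (index_iota 1 M.+1) (fun m => pw (INR m) (- ga)) id x.

(** For x > 0 it lies between min(M, 1/x) and twice that minimum, and its antiderivative is a
    logarithm. *)
Definition peak (M : nat) x := 2 * INR M * / (1 + INR M * x).

Lemma exp_segment_le a b x : (a <= b)%N -> 0 < x <= 1/2 ->
  Cmod (\csum_(a <= i < b) expi (2 * PI * (INR i * x)))%C <= / x.
Proof.
move=> hab hx.
have -> : (\csum_(a <= i < b) expi (2 * PI * (INR i * x)) = expi (2 * PI * (INR a * x)) * dirk (b - a) x)%C.
  rewrite -{1}(add0n a) big_addn big_mkord /dirk -csumMl; apply: eq_bigr => i _.
  by rewrite plus_INR -expiD; congr expi; ring.
rewrite Cmod_mult Cmod_expi Rmult_1_l.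
have h1 := dirk_sin (b - a) x; have h2 := sin_pi_ge (t := x) ltac:(lra).
have h3 : x <= Rabs (sin (PI * x)) by apply: Rle_trans h2 (Rle_abs _).
have h4 := Cmod_ge_0 (dirk (b - a) x).
apply: (Rmult_le_reg_r x); first lra.
by rewrite Rinv_l; [nra|lra].
Qed.

(** Abel summation: partial exponential sums are at most 1/x, and for decreasing weights the total
    variation plus the last weight equals the first. *)
Lemma decreasing_tail_le ga a b x : 0 <= ga -> (0 < a <= b)%N -> 0 < x <= 1/2 ->
  Cmod (\csum_(a <= m < b) (RtoC (pw (INR m) (- ga)) * expi (2 * PI * (INR m * x))))%C <=
  pw (INR a) (- ga) * / x.
Proof.
move=> hg /andP [ha hab] hx.
have ix : 0 < / x by apply: Rinv_0_lt_compat; lra.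
pose w n := pw (INR n) (- ga).
have hmon n : (a <= n < b)%N -> w n.+1 <= w n.
  move=> hn; apply: pw_neg_anti => //; first by apply: INR_gt0; lia.
  by apply: le_INR; lia.
rewrite (@abel_csum w) //.
apply: Rle_trans (Cmod_triangle _ _) _.
have h1 : Cmod (\csum_(a <= n < b) (RtoC (w n - w n.+1)%R * \csum_(a <= i < n.+1) expi (2 * PI * (INR i * x))))%C <= (w a - w b) * / x.
  apply: Rle_trans (Cmod_csum _ _ _) _.
  rewrite -(tv_monotone hab hmon) -rsumMr; apply: rsum_nat_le => n hn.
  rewrite Cmod_mult Cmod_R; apply: Rmult_le_compat_l; first exact: Rabs_pos.
  by apply: exp_segment_le => //; lia.
have h2 : Cmod (RtoC (w b) * \csum_(a <= i < b) expi (2 * PI * (INR i * x)))%C <= w b * / x.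
  rewrite Cmod_mult Cmod_R Rabs_pos_eq; last exact: pw_ge0.
  by apply: Rmult_le_compat_l; [exact: pw_ge0|exact: exp_segment_le].
have -> : pw (INR a) (- ga) * / x = (w a - w b) * / x + w b * / x by rewrite /w; ring.
exact: Rplus_le_compat.
Qed.

Lemma initial_sum_le ga K x : 0 <= ga < 1 ->
  Cmod (\csum_(1 <= m < K.+1) (RtoC (pw (INR m) (- ga)) * expi (2 * PI * (INR m * x))))%C <=
  pw (INR K) (1 - ga) / (1 - ga).
Proof.
move=> hg; apply: Rle_trans (Cmod_csum _ _ _) _; apply: Rle_trans (psum_lt1 K hg).
right; apply: eq_bigr => m _.
by rewrite Cmod_mult Cmod_expi Cmod_R Rmult_1_r Rabs_pos_eq //; exact: pw_ge0.
Qed.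

(** Split at the integer part of 1/x: absolute values before it, cancellation after it, each giving
    a multiple of x^(ga-1). For M x <= 1 absolute values suffice. *)
Lemma dual_sum_half ga M x : 0 <= ga < 1 -> (0 < M)%N -> 0 <= x <= 1/2 ->
  Cmod (dual_sum ga M x) <= (/ (1 - ga) + 1) * pw (peak M x) (1 - ga).
Proof.
move=> hg hM hx; have M0 : 0 < INR M by exact: INR_gt0.
have ig : 0 < / (1 - ga) by apply: Rinv_0_lt_compat; lra.
have D0 : 0 < 1 + INR M * x by nra.
case: (Rle_dec (INR M * x) 1) => hMx.
  apply: Rle_trans (initial_sum_le M x hg) _.
  have h1 : pw (INR M) (1 - ga) <= pw (peak M x) (1 - ga).
    apply: pw_le; first lra.
    rewrite /peak; apply: (Rmult_le_reg_r (1 + INR M * x)) => //.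
    by rewrite Rmult_assoc Rinv_l; nra.
  have p0 := pw_ge0 (peak M x) (1 - ga).
  by rewrite /Rdiv; nra.
have x0 : 0 < x by case: hx => [[//|e] _]; rewrite -e Rmult_0_r in hMx; lra.
have ix := Rinv_0_lt_compat _ x0.
have [K [hK1 hK2]] := nfloor_ex (/ x) (Rlt_le _ _ ix).
have hxx : x * / x = 1 by rewrite Rinv_r; lra.
have hKM : (K < M)%N.
  apply/ltP; apply: INR_lt; apply: (Rle_lt_trans _ (/ x)) => //.
  by apply: (Rmult_lt_reg_l x) => //; rewrite hxx; lra.
have hpk : / x <= peak M x.
  rewrite /peak; apply: (Rmult_le_reg_r (1 + INR M * x)) => //.
  rewrite Rmult_assoc Rinv_l; last lra.
  have -> : / x * (1 + INR M * x) = / x + INR M * (x * / x) by ring.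
  rewrite hxx; have : / x <= INR M.
    by apply: (Rmult_le_reg_l x) => //; rewrite hxx; lra.
  by lra.
have h0 : pw (/ x) (1 - ga) <= pw (peak M x) (1 - ga) by apply: pw_le; lra.
rewrite /dual_sum /trig (big_cat_nat (n := K.+1)) //=; last exact: ltnW.
apply: Rle_trans (Cmod_triangle _ _) _.
have h1 : Cmod (\csum_(1 <= m < K.+1) (RtoC (pw (INR m) (- ga)) * expi (2 * PI * (INR m * x))))%C <= / (1 - ga) * pw (/ x) (1 - ga).
  apply: Rle_trans (initial_sum_le K x hg) _; rewrite /Rdiv Rmult_comm.
  by apply: Rmult_le_compat_l; [lra|apply: pw_le; lra].
have h2 : Cmod (\csum_(K.+1 <= m < M.+1) (RtoC (pw (INR m) (- ga)) * expi (2 * PI * (INR m * x))))%C <= pw (/ x) (1 - ga).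
  apply: Rle_trans (@decreasing_tail_le ga K.+1 M.+1 x _ _ _) _; [lra|lia|lra|].
  have -> : 1 - ga = - ga + 1 by ring.
  rewrite pwD [pw (/ x) 1]pw_1; last lra.
  apply: Rmult_le_compat_r; first lra.
  by apply: pw_neg_anti => //; rewrite ?S_INR; lra.
have p0 := pw_ge0 (peak M x) (1 - ga).
have h3 : / (1 - ga) * pw (/ x) (1 - ga) <= / (1 - ga) * pw (peak M x) (1 - ga).
  by apply: Rmult_le_compat_l; lra.
by have := Rplus_le_compat _ _ _ _ h1 h2; lra.
Qed.

Lemma dual_sum_reflect ga M x : Cmod (dual_sum ga M (1 - x)) = Cmod (dual_sum ga M x).
Proof.
have -> : dual_sum ga M (1 - x) = Cconj (dual_sum ga M x); last first.
  by rewrite /Cconj /Cmod /=; congr sqrt; ring.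
rewrite /dual_sum /trig (big_morph Cconj (id1 := RtoC 0) (op1 := Cplus)).
- apply: eq_bigr => m _; set w := pw _ _.
  have -> : expi (2 * PI * (INR m * (1 - x))) = expi (- (2 * PI * (INR m * x))).
    have -> : 2 * PI * (INR m * (1 - x)) = 2 * PI * INR m + - (2 * PI * (INR m * x)) by ring.
    by rewrite expiD expi_period expi0 Cmult_1_l.
  by rewrite expiN /Cconj /Cmult /RtoC /=; congr pair; ring.
- by case=> [? ?] [? ?]; rewrite /Cconj /Cplus /=; congr pair; ring.
- by rewrite /Cconj /RtoC /=; congr pair; ring.
Qed.

Lemma peak_ge0 M x : 0 <= x -> 0 <= peak M x.
Proof.
move=> hx; have h := pos_INR M; apply: Rmult_le_pos; first by lra.
by left; apply: Rinv_0_lt_compat; nra.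
Qed.

Lemma dual_sum_le ga M x : 0 <= ga < 1 -> (0 < M)%N -> 0 <= x <= 1 ->
  Cmod (dual_sum ga M x) <=
  (/ (1 - ga) + 1) * (pw (peak M x) (1 - ga) + pw (peak M (1 - x)) (1 - ga)).
Proof.
move=> hg hM hx; have ig : 0 < / (1 - ga) by apply: Rinv_0_lt_compat; lra.
have p1 := pw_ge0 (peak M x) (1 - ga); have p2 := pw_ge0 (peak M (1 - x)) (1 - ga).
case: (Rle_dec x (1/2)) => h.
  by apply: Rle_trans (dual_sum_half hg hM _) _; [lra|apply: Rmult_le_compat_l; lra].
rewrite -dual_sum_reflect.
by apply: Rle_trans (dual_sum_half hg hM _) _; [lra|apply: Rmult_le_compat_l; lra].
Qed.

(* Young's inequality in the form t y^(1/p') <= eps y + eps^(1-p) t^p. *)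
Lemma young_dual p eps t y : 1 < p -> 0 < eps -> 0 <= t -> 0 <= y ->
  t * pw y (1 - / p) <= eps * y + pw eps (1 - p) * pw t p.
Proof.
move=> hp he ht hy.
have ip : 0 < / p by apply: Rinv_0_lt_compat; lra.
have pe := pw_gt0 (1 - p) he; have pt := pw_ge0 t p.
have py := pw_ge0 y (1 - / p); have py2 := pw_ge0 y (/ p).
have e1 : y = pw y (/ p) * pw y (1 - / p).
  by rewrite -pwD (_ : / p + (1 - / p) = 1) ?pw_1 //; ring.
have q1 : 0 <= pw eps (1 - p) * pw t p by apply: Rmult_le_pos; lra.
have q2 : 0 <= eps * y by apply: Rmult_le_pos; lra.
case: (Rle_dec t (eps * pw y (/ p))) => h.
  suff : t * pw y (1 - / p) <= eps * y by lra.
  by rewrite {2}e1 -Rmult_assoc; apply: Rmult_le_compat_r.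
suff : t * pw y (1 - / p) <= pw eps (1 - p) * pw t p by lra.
have h2 : pw y (/ p) <= t / eps.
  by apply: (Rmult_le_reg_l eps) => //; have -> : eps * (t / eps) = t; [field|]; lra.
have h3 : pw y (1 - / p) <= pw (t / eps) (p - 1).
  have -> : 1 - / p = / p * (p - 1) by field; lra.
  by rewrite -pwA; apply: pw_le; lra.
apply: Rle_trans (Rmult_le_compat_l _ _ _ ht h3) _; right.
rewrite pwM //; last by left; apply: Rinv_0_lt_compat.
rewrite pw_inv // -pwN // (_ : - (p - 1) = 1 - p); last by ring.
by rewrite (pw_sub1 p ht); ring.
Qed.

Lemma cont_peak_free M f : cont f -> (forall x, 0 <= f x) -> cont (fun x => peak M (f x)).
Proof.
move=> hf h0; apply: cont_scal.
apply: cont_inv; last by move=> x; have := h0 x; have := pos_INR M; nra.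
by apply: contD; [exact: cont_const|exact: cont_scal].
Qed.

(** The absolute value makes the integrand continuous on the whole line, as [cont] asks; on [0,1] it
    changes nothing. *)
Lemma RInt_peak_log M : (0 < M)%N -> RInt (fun x => peak M (Rabs x)) 0 1 = 2 * ln (1 + INR M).
Proof.
move=> hM; have M0 := INR_gt0 hM.
have hint : is_RInt (fun x => peak M (Rabs x)) 0 1
    (minus (2 * ln (1 + INR M * 1)) (2 * ln (1 + INR M * 0))).
  apply: (is_RInt_derive (fun x => 2 * ln (1 + INR M * x))) => x; rewrite Rmin_left ?Rmax_right; try lra; move=> hx.
    rewrite Rabs_pos_eq; last lra.
    by rewrite /peak; auto_derive; [nra|field; nra].
  apply: cont_peak_free; last by move=> y; exact: Rabs_pos.
  by apply: cont_abs; exact: cont_id.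
rewrite (is_RInt_unique _ _ _ _ hint) /minus /plus /opp /=.
by rewrite Rmult_1_r Rmult_0_r Rplus_0_r ln_1; ring.
Qed.

Lemma RInt_reflect f : cont f -> RInt (fun x => f (1 - x)) 0 1 = RInt f 0 1.
Proof.
move=> hf.
have h : RInt (fun y => scal (-1) (f (-1 * y + 1))) 0 1 = RInt f (-1 * 0 + 1) (-1 * 1 + 1).
  by apply: RInt_comp_lin; exact: cont_ex_RInt.
rewrite (_ : -1 * 0 + 1 = 1) in h; last by ring.
rewrite (_ : -1 * 1 + 1 = 0) in h; last by ring.
have hc : cont (fun x => f (1 - x)).
  by apply: (cont_comp (g := f)) => //; apply: contB; [exact: cont_const|exact: cont_id].
have e : RInt (fun y => scal (-1) (f (-1 * y + 1))) 0 1 = -1 * RInt (fun x => f (1 - x)) 0 1.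
  rewrite -RInt_Ml //; apply: RInt_ext => x _.
  by have -> : 1 - x = -1 * x + 1 by ring.
rewrite -(opp_RInt_swap f 1 0); last exact: cont_ex_RInt.
have r (t : R) : t = - (-1 * t) by ring.
by rewrite -h e; exact: r.
Qed.

(** The paired weights are n^(-2s) (n^2)^(-1/p) = 1/n, so the pairing is at least log N. Young's
    inequality bounds it by the p-th moment plus a small multiple of the integral of the peaks,
    which is O(log N) and is absorbed. *)
Lemma lower_critical p s : 2 < p -> 2 * s + 2 / p = 1 -> exists c, 0 < c /\ forall N, (2 <= N)%N ->
  c * ln (INR N) <= RInt (fun x => pw (Cmod (T s N x)) p) 0 1.
Proof.
move=> hp hs.
have ip : 0 < / p by apply: Rinv_0_lt_compat; lra.
have ip1 : / p < 1 by rewrite -Rinv_1; apply: Rinv_lt_contravar; lra.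
pose ga := / p; have hg : 0 <= ga < 1 by rewrite /ga; lra.
have ig : 0 < / (1 - ga) by apply: Rinv_0_lt_compat; lra.
pose Cg := / (1 - ga) + 1; have Cg0 : 0 < Cg by rewrite /Cg; lra.
(* With this value the peaks contribute ln(1 + M)/6, at most half of ln N. *)
pose eps := / (24 * Cg); have eps0 : 0 < eps by apply: Rinv_0_lt_compat; lra.
have pe := pw_gt0 (1 - p) eps0.
pose c := / (4 * Cg * pw eps (1 - p)).
have hc0 : 0 < 4 * Cg * pw eps (1 - p) by apply: Rmult_lt_0_compat; lra.
exists c; split; first exact: Rinv_0_lt_compat.
(* M = N^2 makes the dual sum contain every frequency of [T s N]. *)
move=> N hN; pose M := (N * N)%N.
have hM : (0 < M)%N by rewrite muln_gt0; lia.
have M0 := INR_gt0 hM.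
have ln0 := ln_ge_half hN.
pose y1 x := peak M (Rabs x); pose y2 x := peak M (Rabs (1 - x)).
have cy1 : cont y1.
  apply: cont_peak_free; last by move=> y; exact: Rabs_pos.
  by apply: cont_abs; exact: cont_id.
have cy2 : cont y2.
  apply: cont_peak_free; last by move=> y; exact: Rabs_pos.
  by apply: cont_abs; apply: contB; [exact: cont_const|exact: cont_id].
set I := RInt _ 0 1.
have i1 : RInt y1 0 1 = 2 * ln (1 + INR M) by exact: RInt_peak_log.
have i2 : RInt y2 0 1 = 2 * ln (1 + INR M) by rewrite -i1; apply: (RInt_reflect cy1).
(* From 1 + N^2 <= N^3, valid for N >= 2. *)
have hln : ln (1 + INR M) <= 3 * ln (INR N).
  have N2 : 2 <= INR N by have : INR 2 <= INR N by [apply: le_INR; lia]; rewrite !S_INR INR_0; lra.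
  have -> : 3 * ln (INR N) = ln (INR N * (INR N * INR N)).
    by rewrite !ln_mult; try nra; ring.
  by apply: ln_le; [lra|rewrite /M mult_INR; nra].
have cTp : cont (fun x => pw (Cmod (T s N x)) p).
  by apply: cont_pw; [lra|apply: contC_Cmod; exact: contC_T].
have hdual : RInt (fun x => dot (T s N x) (dual_sum ga M x)) 0 1 <=
   Cg * (eps * (RInt y1 0 1 + RInt y2 0 1) + 2 * pw eps (1 - p) * I).
  pose F x := Cg * (eps * (y1 x + y2 x) + 2 * pw eps (1 - p) * pw (Cmod (T s N x)) p).
  have c12 := contD cy1 cy2.
  have d1 : cont (fun x => eps * (y1 x + y2 x)) by exact: cont_scal.
  have d2 : cont (fun x => 2 * pw eps (1 - p) * pw (Cmod (T s N x)) p).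
    by exact: cont_scal.
  have d := contD d1 d2.
  apply: (Rle_trans _ (RInt F 0 1)).
    apply: RInt_le01.
    - by apply: cont_dot; [exact: contC_T|exact: contC_trig].
    - by exact: cont_scal.
    move=> x hx; apply: Rle_trans (Rle_abs _) _; apply: Rle_trans (dot_abs _ _) _.
    have t0 := Cmod_ge_0 (T s N x).
    have hdx := dual_sum_le hg hM hx.
    apply: Rle_trans (Rmult_le_compat_l _ _ _ t0 hdx) _.
    rewrite /F /y1 /y2 !Rabs_pos_eq; try lra.
    have yp1 := @peak_ge0 M x ltac:(lra); have yp2 := @peak_ge0 M (1 - x) ltac:(lra).
    have p1 : 1 < p by lra.
    have w1 := young_dual p1 eps0 t0 yp1; have w2 := young_dual p1 eps0 t0 yp2.
    rewrite -/ga in w1 w2; rewrite -/Cg.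
    have := Rmult_le_compat_l _ _ _ (Rlt_le _ _ Cg0) (Rplus_le_compat _ _ _ _ w1 w2).
    by lra.
  rewrite /F (RInt_Ml _ _ _ d) (RInt_D _ _ d1 d2) (RInt_Ml _ _ _ c12) (RInt_D _ _ cy1 cy2) (RInt_Ml _ _ _ cTp).
  by right.
have hlow : ln (INR N) <= RInt (fun x => dot (T s N x) (dual_sum ga M x)) 0 1.
  rewrite (RInt_eq01 (g := fun x => dot (trig (index_iota 1 N.+1) (fun n => pw (INR n) (- (2 * s))) (fun n => (n * n)%N) x) (dual_sum ga M x))); last first.
    by move=> x; rewrite T_trig.
  rewrite parseval.
  pose F (i j : nat) := pw (INR i) (- (2 * s)) * pw (INR j) (- ga) * (if (i * i == j)%N then 1 else 0).
  apply: Rle_trans (@rsum_diag_le (index_iota 1 N.+1) (index_iota 1 M.+1) F (fun i => i * i)%N _ _).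
  - apply: (Rle_trans _ (\rsum_(1 <= n < N.+1) / INR n)).
      by apply: Rle_trans (harmonic_ge N); apply: ln_le; [apply: INR_gt0; lia|apply: le_INR; lia].
    right; apply: eq_big_nat => n /andP [n1 _].
    have n0 := INR_gt0 n1.
    rewrite /F eqxx Rmult_1_r mult_INR pwM; try lra.
    rewrite -!pwD (_ : - (2 * s) + (- ga + - ga) = - 1).
      by rewrite pwN // pw_1 //; lra.
    by rewrite /ga; rewrite /Rdiv in hs; lra.
  - move=> i j; rewrite /F; case: eqP => _; last lra.
    by rewrite Rmult_1_r; apply: Rmult_le_pos; exact: pw_ge0.
  - move=> n; rewrite !mem_index_iota => /andP [n1 n2].
    by rewrite muln_gt0 n1 /= ltnS leq_mul.
have h1 := Rle_trans _ _ _ hlow hdual.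
rewrite i1 i2 in h1.
have h2 : Cg * (eps * (2 * ln (1 + INR M) + 2 * ln (1 + INR M))) <= / 2 * ln (INR N).
  have -> : Cg * (eps * (2 * ln (1 + INR M) + 2 * ln (1 + INR M))) = / 6 * ln (1 + INR M).
    by rewrite /eps; field; lra.
  by lra.
apply: (Rmult_le_reg_l (4 * Cg * pw eps (1 - p))) => //.
rewrite /c -Rmult_assoc Rinv_r ?Rmult_1_l; last lra.
by lra.
Qed.

(** * The fourth moment *)

Lemma rsum_inj (A B : finType) (P : pred A) (Q : pred B) (f : A -> B) (F : B -> R) :
  (forall b, 0 <= F b) -> {in P &, injective f} -> (forall a, P a -> Q (f a)) ->
  \big[Rplus/0]_(a | P a) F (f a) <= \big[Rplus/0]_(b | Q b) F b.
Proof.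
move=> F0 hinj hPQ.
have -> : \big[Rplus/0]_(a | P a) F (f a) = \big[Rplus/0]_(b in [set f a | a in P]) F b.
  by rewrite big_imset.
rewrite [X in _ <= X](bigID (mem [set f a | a in P])) /= -[X in X <= _]Rplus_0_r.
apply: Rplus_le_compat; last exact: rsum_ge0.
right; apply: eq_bigl => b; apply/idP/andP => [hb|[]//]; split => //.
by case/imsetP: hb => a ha ->; apply: hPQ.
Qed.

(** The ranges place the four entries of [fourth_sol] between N/16 and N, so that their weights are
    comparable to N^(-2s). The condition 4u <= v keeps the differences positive, and coprimality
    makes the parametrisation injective. *)
Definition fourth_param N (z : ('I_N.+1 * 'I_N.+1) * ('I_N.+1 * 'I_N.+1)) : bool :=
  [&& 0 < z.1.1, 4 * z.1.1 <= z.1.2, z.1.2 <= N %/ 2 & coprime z.1.1 z.1.2]%N &&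
  [&& N %/ (2 * z.1.2) < 2 * z.2.1, z.2.1 <= N %/ (2 * z.1.2),
      N %/ (2 * z.1.2) < 2 * z.2.2 & z.2.2 <= N %/ (2 * z.1.2)]%N.

(* (a,b,c,d) = (ux+vy, vx-uy, vy-ux, uy+vx) solves a^2+b^2 = c^2+d^2, and (u,v) is recovered as the reduced ratio of a-c and d+b. *)
Definition fourth_sol N (z : ('I_N.+1 * 'I_N.+1) * ('I_N.+1 * 'I_N.+1)) :
    ('I_N.+1 * 'I_N.+1) * ('I_N.+1 * 'I_N.+1) :=
  let: ((u, v), (x, y)) := z in
  ((inord (u * x + v * y), inord (v * x - u * y)), (inord (v * y - u * x), inord (u * y + v * x))).

(** With X the integer part of N/(2v) one has N <= 4vX <= 2N. Then ux <= vX/4 and vX/2 <= vy <= vX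
    leave a difference of at least vX/4 >= N/16. *)
Lemma fourth_bounds N u v x y : (0 < u)%N -> (4 * u <= v)%N -> (v <= N %/ 2)%N ->
  (N %/ (2 * v) < 2 * x)%N -> (x <= N %/ (2 * v))%N -> (N %/ (2 * v) < 2 * y)%N -> (y <= N %/ (2 * v))%N ->
  [/\ (u * x + v * y <= N)%N, (N <= 16 * (u * x + v * y))%N, (u * x <= v * y)%N & (N <= 16 * (v * y - u * x))%N].
Proof.
move=> hu huv hv hx1 hx2 hy1 hy2; set X := (N %/ (2 * v))%N in hx1 hx2 hy1 hy2.
have h2v : (2 * v <= N)%N by have := leq_trunc_div N 2; lia.
have X1 : (0 < X)%N by rewrite divn_gt0; lia.
have e1 : (X * (2 * v) <= N)%N by apply: leq_trunc_div.
have e2 : (N < X.+1 * (2 * v))%N by apply: ltn_ceil; lia.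
have e3 : (N <= 4 * (v * X))%N by nia.
have p1 : (4 * (u * x) <= v * X)%N by nia.
have p2 : (v * X <= 2 * (v * y))%N by nia.
have p3 : (v * y <= v * X)%N by nia.
by split; lia.
Qed.

(** Differences are stated additively to avoid truncated subtraction, and the bounds by N make
    [inord] exact. [fourth_bounds] is used twice, with x and y exchanged the second time. *)
Lemma fourth_solP N z : fourth_param z -> let: ((u, v), (x, y)) := z in
  let: ((a, b), (c, d)) := @fourth_sol N z in
  [/\ (a : nat) = u * x + v * y, (v * x : nat) = b + u * y, (v * y : nat) = c + u * x & (d : nat) = u * y + v * x]%N /\
  [/\ (N <= 16 * a)%N, (N <= 16 * b)%N, (N <= 16 * c)%N & (N <= 16 * d)%N].
Proof.
case: z => [[u v] [x y]] /= /andP [/and4P [/= h1 h2 h3 h4] /and4P [/= h5 h6 h7 h8]].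
have [a1 a2 a3 a4] := fourth_bounds h1 h2 h3 h5 h6 h7 h8.
have [b1 b2 b3 b4] := fourth_bounds h1 h2 h3 h7 h8 h5 h6.
rewrite !inordK; try lia; do !split; try lia.
Qed.

(** Sums and differences of the entries determine ux, vx and vy. Hence u v' = u' v, and coprimality
    of both pairs forces u = u' and v = v'. *)
Lemma fourth_sol_inj N : {in @fourth_param N &, injective (@fourth_sol N)}.
Proof.
move=> z z' hz hz' e.
have := fourth_solP hz; have := fourth_solP hz'; rewrite -e; move: hz hz'; clear e.
case: z => [[u v] [x y]]; case: z' => [[u' v'] [x' y']].
case: (fourth_sol _) => [[a b] [c d]].
move=> /andP [/and4P [/= h1 h2 h3 h4] /and4P [/= h5 h6 h7 h8]].
move=> /andP [/and4P [/= i1 i2 i3 i4] /and4P [/= i5 i6 i7 i8]].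
move=> [[q1 q2 q3 q4] _] [[r1 r2 r3 r4] _].
have e1 : (u * x = u' * x')%N by lia.
have e2 : (v * x = v' * x')%N by lia.
have e3 : (v * y = v' * y')%N by lia.
have x0 : (0 < x)%N by lia.
have x0' : (0 < x')%N by lia.
have euv : (u * v' = u' * v)%N.
  apply/eqP; rewrite -(eqn_pmul2r (m := x * x')); last by rewrite muln_gt0 x0.
  by apply/eqP; rewrite mulnACA e1 -e2 mulnACA [(x' * x)%N]mulnC.
have d1 : (u %| u')%N by rewrite -(Gauss_dvdl _ h4) -euv dvdn_mulr.
have d2 : (u' %| u)%N by rewrite -(Gauss_dvdl _ i4) euv dvdn_mulr.
have eu : (u : nat) = u' by apply/eqP; rewrite eqn_dvd d1 d2.
have ev : (v : nat) = v' by apply/eqP; rewrite -(eqn_pmul2l h1) eq_sym euv eu.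
have ex : (x : nat) = x' by apply/eqP; rewrite -(eqn_pmul2l h1) e1 eu.
have v0 : (0 < v)%N by lia.
have ey : (y : nat) = y' by apply/eqP; rewrite -(eqn_pmul2l v0) e3 ev.
by congr ((_, _), (_, _)); apply: val_inj.
Qed.

Definition fourth_weight s N (z : ('I_N.+1 * 'I_N.+1) * ('I_N.+1 * 'I_N.+1)) :=
  pw (INR z.1.1) (- (2 * s)) * pw (INR z.1.2) (- (2 * s)) *
  (pw (INR z.2.1) (- (2 * s)) * pw (INR z.2.2) (- (2 * s))) *
  (if (z.1.1 * z.1.1 + z.1.2 * z.1.2 == z.2.1 * z.2.1 + z.2.2 * z.2.2)%N then 1 else 0).

(** Parseval for the square of [T s N], a trigonometric sum over pairs (a, b) with frequencies a^2 +
    b^2. *)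
Lemma fourth_moment_sum s N :
  \big[Rplus/0]_(z : ('I_N.+1 * 'I_N.+1) * ('I_N.+1 * 'I_N.+1)) fourth_weight s z =
  RInt (fun x => pw (Cmod (T s N x)) 4) 0 1.
Proof.
pose w (n : 'I_N.+1) := pw (INR n) (- (2 * s)).
pose Q := trig (index_enum ('I_N.+1 * 'I_N.+1)%type) (fun z => w z.1 * w z.2) (fun z => z.1 * z.1 + z.2 * z.2)%N.
have eT x : T s N x = (\csum_(n < N.+1) (RtoC (w n) * expi (2 * PI * (INR n * INR n * x))))%C.
  rewrite T_wsum /wsum -(big_mkord xpredT (fun n => RtoC (pw (INR n) (- (2 * s))) * expi (2 * PI * (INR n * INR n * x)))%C).
  (* The index 0, present among the ordinals, has weight 0 by the convention for [pw]. *)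
  by rewrite [RHS]big_ltn // INR_0 pw0 ?Cmult_0_l ?Cplus_0_l //; lra.
have eQ x : Q x = (T s N x * T s N x)%C.
  rewrite eT big_distrl /Q /trig /= -(pair_bigA _ (fun a b => RtoC (w a * w b)%R * expi (2 * PI * (INR (a * a + b * b) * x)))%C) /=.
  apply: eq_bigr => a _; rewrite -csumMl; apply: eq_bigr => b _.
  rewrite RtoC_mult plus_INR !mult_INR.
  have -> : 2 * PI * ((INR a * INR a + INR b * INR b) * x) = 2 * PI * (INR a * INR a * x) + 2 * PI * (INR b * INR b * x) by ring.
  by rewrite expiD; ring.
rewrite (RInt_eq01 (g := fun x => dot (Q x) (Q x))); last first.
  move=> x; have -> : dot (Q x) (Q x) = Cmod (Q x) * Cmod (Q x) by rewrite Cmod_sqr.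
  rewrite eQ Cmod_mult; set t := Cmod _; have t0 : 0 <= t by exact: Cmod_ge_0.
  by rewrite -(pw_2 t0) -pwD; congr pw; ring.
by rewrite parseval pair_bigA.
Qed.

Definition coprime_pair N (z : 'I_N.+1 * 'I_N.+1) : bool :=
  [&& 0 < z.1, 4 * z.1 <= z.2, z.2 <= N %/ 2 & coprime z.1 z.2]%N.

Definition any_pair N (z : 'I_N.+1 * 'I_N.+1) : bool :=
  [&& 0 < z.1, 4 * z.1 <= z.2 & z.2 <= N %/ 2]%N.

(* Grouping all pairs by their gcd d costs at most sum 1/d^2 <= 2. *)
Lemma coprime_sum_ge N :
  \big[Rplus/0]_(z | @any_pair N z) / (INR z.2 * INR z.2) <=
  2 * \big[Rplus/0]_(z | @coprime_pair N z) / (INR z.2 * INR z.2).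
Proof.
pose h (z : 'I_N.+1 * 'I_N.+1) : 'I_N.+1 * ('I_N.+1 * 'I_N.+1) :=
  (inord (gcdn z.1 z.2), (inord (z.1 %/ gcdn z.1 z.2), inord (z.2 %/ gcdn z.1 z.2))).
pose F (t : 'I_N.+1 * ('I_N.+1 * 'I_N.+1)) := / (INR t.1 * INR t.1) * / (INR t.2.2 * INR t.2.2).
pose Qb (t : 'I_N.+1 * ('I_N.+1 * 'I_N.+1)) := (0 < t.1)%N && coprime_pair t.2.
have hinv n : 0 <= / (INR n * INR n) by rewrite Rinv_mult; apply: Rle_0_sqr.
have hz z : any_pair z -> [/\ (h z).1 = gcdn z.1 z.2 :> nat, (h z).2.1 = (z.1 %/ gcdn z.1 z.2)%N :> nat,
    (h z).2.2 = (z.2 %/ gcdn z.1 z.2)%N :> nat & (0 < gcdn z.1 z.2)%N].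
  case: z => u v /and3P [/= h1 h2 h3].
  have g0 : (0 < gcdn u v)%N by rewrite gcdn_gt0 h1.
  have g1 : (gcdn u v <= u)%N by apply: dvdn_leq => //; exact: dvdn_gcdl.
  have u1 : (u %/ gcdn u v <= u)%N by apply: leq_div.
  have v1 : (v %/ gcdn u v <= v)%N by apply: leq_div.
  by have := ltn_ord u; have := ltn_ord v; rewrite !inordK //; lia.
have h1 : \big[Rplus/0]_(z | @any_pair N z) / (INR z.2 * INR z.2) = \big[Rplus/0]_(z | @any_pair N z) F (h z).
  apply: eq_bigr => z hzz; have [e1 e2 e3 g0] := hz z hzz.
  have /and3P [k1 k2 k3] := hzz.
  rewrite /F e1 e3; set g := gcdn _ _ in g0 *.
  have ev : (z.2 = z.2 %/ g * g :> nat)%N by rewrite divnK // dvdn_gcdr.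
  have q0 : (0 < z.2 %/ g)%N.
    rewrite divn_gt0 //; apply: dvdn_leq; last exact: dvdn_gcdr.
    by apply: leq_trans k2; rewrite muln_gt0.
  have g0R := INR_gt0 g0; have q0R := INR_gt0 q0.
  have e0 (A B : R) : 0 < A -> 0 < B -> / (B * A * (B * A)) = / (A * A) * / (B * B) by move=> *; field; lra.
  by rewrite {1 2}ev mult_INR; apply: e0.
rewrite h1; apply: Rle_trans (@rsum_inj _ _ _ Qb h F _ _ _) _.
- by move=> t; apply: Rmult_le_pos.
- move=> z z' hzz hzz' e; have [e1 e2 e3 g0] := hz z hzz; have [e1' e2' e3' g0'] := hz z' hzz'.
  rewrite -e in e1' e2' e3'; rewrite e1 in e1'; rewrite e2 in e2'; rewrite e3 in e3'.
  have k1 : z.1 = z'.1.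
    apply: val_inj => /=; rewrite -(divnK (dvdn_gcdl z.1 z.2)) -(divnK (dvdn_gcdl z'.1 z'.2)).
    by rewrite e2' e1'.
  have k2 : z.2 = z'.2.
    apply: val_inj => /=; rewrite -(divnK (dvdn_gcdr z.1 z.2)) -(divnK (dvdn_gcdr z'.1 z'.2)).
    by rewrite e3' e1'.
  by case: z z' k1 k2 {hzz hzz' e e1 e2 e3 g0 e1' e2' e3' g0'} => [u v] [u' v'] /= -> ->.
- move=> z hzz; have [e1 e2 e3 g0] := hz z hzz; have /and3P [k1 k2 k3] := hzz.
  rewrite /Qb /coprime_pair e1 e2 e3 g0 /=; set g := gcdn _ _ in g0 *.
  have u1 : (z.1 = z.1 %/ g * g :> nat)%N by rewrite divnK // dvdn_gcdl.
  have v1 : (z.2 = z.2 %/ g * g :> nat)%N by rewrite divnK // dvdn_gcdr.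
  apply/and4P; split.
  + by rewrite divn_gt0 //; apply: dvdn_leq; [|exact: dvdn_gcdl].
  + by rewrite -(leq_pmul2r g0) -mulnA -u1 -v1.
  + by apply: leq_trans (leq_div _ _) k3.
  + rewrite /coprime -(eqn_pmul2r g0) mul1n muln_gcdl -u1 -v1; exact: eqxx.
have -> : \big[Rplus/0]_(t | Qb t) F t =
   (\rsum_(d < N.+1 | (0 < d)%N) / (INR d * INR d)) * \big[Rplus/0]_(z | @coprime_pair N z) / (INR z.2 * INR z.2).
  rewrite /Qb /F -(pair_big (fun d : 'I_N.+1 => 0 < d)%N (@coprime_pair N)
     (fun d z => / (INR d * INR d) * / (INR z.2 * INR z.2))) /= -rsumMr.
  by apply: eq_bigr => d _; rewrite rsumMl.
apply: Rmult_le_compat_r; first by apply: rsum_ge0.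
apply: Rle_trans (rsum_inv_sqr N.+1); right.
rewrite -(big_mkord (fun d => 0 < d)%N (fun d => / (INR d * INR d))) big_ltn_cond //=.
by rewrite big_nat_cond [RHS]big_nat_cond; apply: eq_bigl => i; case: i => [|i]; rewrite ?andbT.
Qed.

(** Each v >= 4 admits floor(v/4) >= v/8 values of u, which leaves the sum of 1/(8v) up to N/2.
    Halving N costs ln 2 <= 1 and dropping v < 4 costs at most 2, whence the 3. *)
Lemma any_pair_sum_ge N : (2 <= N)%N ->
  (ln (INR N) - 3) / 8 <= \big[Rplus/0]_(z | @any_pair N z) / (INR z.2 * INR z.2).
Proof.
move=> hN; pose Y := (N %/ 2)%N.
have hY : (N <= 2 * Y.+1)%N by have := ltn_ceil N (isT : 0 < 2)%N; rewrite /Y; lia.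
have hYN : (Y <= N)%N by exact: leq_div.
have hlog : ln (INR N) - 1 <= ln (INR Y.+1).
  have h1 : INR N <= 2 * INR Y.+1 by apply: (@INR_le_mul 2); lia.
  have n0 : 0 < INR N by apply: INR_gt0; lia.
  have y0 : 0 < INR Y.+1 by exact: INR_gt0.
  have := ln_le _ _ n0 h1; rewrite ln_mult; [|lra|lra].
  by have := @ln_le_sub1 2 ltac:(lra); lra.
have hinv n : 0 <= / INR n.
  case: n => [|n]; first by rewrite INR_0 Rinv_0; lra.
  by left; apply: Rinv_0_lt_compat; exact: INR_gt0.
have hsum : ln (INR N) - 3 <= \rsum_(4 <= v < Y.+1) / INR v.
  have := harmonic_ge Y.
  have h3 : \rsum_(1 <= v < 4) / INR v <= 2.
    by rewrite big_ltn // big_ltn // big_ltn // big_geq // !S_INR INR_0; lra.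
  have h4 : \rsum_(1 <= v < Y.+1) / INR v <= \rsum_(1 <= v < 4) / INR v + \rsum_(4 <= v < Y.+1) / INR v.
    case: (leqP 4 Y.+1) => h4; first by rewrite (big_cat_nat (n := 4)) //=; exact: Rle_refl.
    rewrite [X in _ <= _ + X]big_geq ?Rplus_0_r; last by lia.
    by apply: rsum_subrange => //; lia.
  by move=> h5; have := Rle_trans _ _ _ h5 h4; set S4 := \big[_/_]_(4 <= _ < _) _; lra.
apply: (Rle_trans _ (\rsum_(4 <= v < Y.+1) (/ 8 * / INR v))).
  by rewrite rsumMl; move: hsum; set S := \big[_/_]_(_ <= _ < _) _; lra.
have hsq n : 0 <= / (INR n * INR n) by rewrite Rinv_mult; apply: Rle_0_sqr.
rewrite [X in _ <= X](_ : _ = \rsum_(v < N.+1 | (4 <= v < Y.+1)%N) \rsum_(u < N.+1 | any_pair (u, v)) / (INR v * INR v)); last first.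
  rewrite -(exchange_big_dep (P := xpredT) (fun v : 'I_N.+1 => 4 <= v < Y.+1)%N) /=.
    by rewrite pair_big_dep; apply: eq_big => [[u v]|[u v] _].
  by move=> u v _ /and3P [/= h1 h2 h3]; lia.
apply: Rle_trans (@rsum_range_sub N.+1 4 Y.+1 (fun v => 4 <= v < Y.+1)%N (fun v => / 8 * / INR v) _ _ _) _ => //.
  by move=> v; apply: Rmult_le_pos => //; lra.
apply: rsum_le => v /andP [v4 vY].
have vR := INR_gt0 (leq_trans (isT : 0 < 4)%N v4).
have hv4 : (v %/ 4 <= v)%N by exact: leq_div.
apply: (Rle_trans _ (\rsum_(1 <= u < (v %/ 4).+1) / (INR v * INR v))).
  rewrite rsum_nat_const // INR_1 S_INR.
  have h8 : INR v <= 8 * INR (v %/ 4).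
    have h1 := ltn_ceil v (isT : 0 < 4)%N; have h2 : (0 < v %/ 4)%N by rewrite divn_gt0.
    by apply: (@INR_le_mul 8); lia.
  have -> : / 8 * / INR v = INR v / 8 * / (INR v * INR v) by field; lra.
  by apply: Rmult_le_compat_r; [exact: hsq|lra].
pose Pu u := [&& 0 < u & 4 * u <= v]%N.
apply: Rle_trans (@rsum_range_sub N.+1 1 (v %/ 4).+1 Pu (fun=> / (INR v * INR v)) _ _ _) _ => //.
- by have := ltn_ord v; lia.
- by move=> u /andP [u1 u2]; rewrite /Pu u1 /=; have := leq_trunc_div v 4; lia.
right; apply: eq_bigl => u; rewrite /Pu /any_pair /=.
by have -> : (v <= N %/ 2)%N by []; rewrite andbT.
Qed.

(** A coprime pair (u, v) admits at least N/(8v) values of x and as many of y, so the solutions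
    number at least a constant times N^2 log N, each of weight about N^(-8s). The 1024 is 64 from
    these choices times 16 from the sum over coprime pairs. *)
Lemma lower_fourth_log s : exists c, 0 < c /\ forall N, (2 <= N)%N ->
  c * pw (INR N) (2 - 8 * s) * (ln (INR N) - 3) <= RInt (fun x => pw (Cmod (T s N x)) 4) 0 1.
Proof.
pose c1 := pw (1/16) (Rabs (2 * s)).
have c10 : 0 < c1 by apply: pw_gt0; lra.
pose c4 := c1 * c1 * (c1 * c1).
have c40 : 0 < c4 by repeat apply: Rmult_lt_0_compat.
exists (c4 / 1024); split; first lra.
move=> N hN; have N0 : 0 < INR N by apply: INR_gt0; lia.
pose w0 := pw (INR N) (- (2 * s)).
have w00 : 0 < w0 by exact: pw_gt0.
have hw n : (N <= 16 * n)%N -> (n <= N)%N -> c1 * w0 <= pw (INR n) (- (2 * s)).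
  move=> h1 h2.
  have n0 : 0 < INR n by apply: INR_gt0; lia.
  have h3 : INR n <= INR N by apply: le_INR; lia.
  have h4 : INR N <= 16 * INR n by apply: (@INR_le_mul 16); lia.
  case: (Rle_dec 0 (2 * s)) => hs.
    apply: (Rle_trans _ w0); last exact: pw_neg_anti.
    have : c1 <= 1 by apply: pw_le1; [exact: Rabs_pos|lra].
    by nra.
  have -> : c1 = pw (1/16) (- (2 * s)) by rewrite /c1 Rabs_left //; lra.
  by rewrite -pwM; [apply: pw_le; lra|lra|lra].
rewrite -fourth_moment_sum; pose F := @fourth_weight s N.
have hF z : 0 <= F z.
  rewrite /F /fourth_weight; apply: Rmult_le_pos; last by case: ifP => _; lra.
  by repeat apply: Rmult_le_pos; exact: pw_ge0.
pose kap4 := (c1 * w0) * (c1 * w0) * ((c1 * w0) * (c1 * w0)).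
have cw : 0 < c1 * w0 by exact: Rmult_lt_0_compat.
have kap0 : 0 < kap4 by repeat apply: Rmult_lt_0_compat.
apply: Rle_trans (@rsum_inj _ _ (@fourth_param N) xpredT (@fourth_sol N) F hF (@fourth_sol_inj N) _) => //.
apply: (Rle_trans _ (\big[Rplus/0]_(z | @fourth_param N z) kap4)); last first.
  apply: rsum_le => z hz; have := fourth_solP hz.
  case: z hz => [[u v] [x y]] hz; rewrite /F /fourth_weight; case: (fourth_sol _) => [[a b] [c d]] /= [[e1 e2 e3 e4] [k1 k2 k3 k4]].
  have -> : (a * a + b * b = c * c + d * d)%N.
    have e : ((u * x) * (v * y) = (u * y) * (v * x))%N by rewrite mulnACA [RHS]mulnACA [(x * y)%N]mulnC.
    by rewrite e1 e4; nia.
  rewrite eqxx Rmult_1_r.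
  have ha := hw a k1 ltac:(by have := ltn_ord a; lia); have hb := hw b k2 ltac:(by have := ltn_ord b; lia).
  have hc := hw c k3 ltac:(by have := ltn_ord c; lia); have hd := hw d k4 ltac:(by have := ltn_ord d; lia).
  apply: Rmult_le_compat; try by apply: Rmult_le_pos; lra.
    by apply: Rmult_le_compat; lra.
  by apply: Rmult_le_compat; lra.
pose qx (v x : 'I_N.+1) := ((N %/ (2 * v) < 2 * x) && (x <= N %/ (2 * v)))%N.
have -> : \big[Rplus/0]_(z | @fourth_param N z) kap4 =
  \big[Rplus/0]_(z | @coprime_pair N z) (kap4 * ((\rsum_(x < N.+1 | qx z.2 x) 1) * (\rsum_(y < N.+1 | qx z.2 y) 1))).
  rewrite [RHS](eq_bigr (fun z : 'I_N.+1 * 'I_N.+1 => \big[Rplus/0]_(t : 'I_N.+1 * 'I_N.+1 | qx z.2 t.1 && qx z.2 t.2) kap4)).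
    rewrite pair_big_dep; apply: eq_bigl => [[[u v] [x y]]].
    by rewrite /fourth_param /coprime_pair /qx /= -!andbA.
  move=> z _; rewrite -(pair_big (qx z.2) (qx z.2) (fun _ _ => kap4)) /=.
  rewrite big_distrl /= -rsumMl; apply: eq_bigr => x _.
  by rewrite -!rsumMl; apply: eq_bigr => y _; ring.
have hq (v : 'I_N.+1) : (0 < v)%N -> (v <= N %/ 2)%N -> INR N / (8 * INR v) <= \rsum_(x < N.+1 | qx v x) 1.
  move=> v0 hv; pose X := (N %/ (2 * v))%N; pose h := (X %/ 2)%N.
  have v0R := INR_gt0 v0.
  have h2v : (2 * v <= N)%N by have := leq_trunc_div N 2; lia.
  have X1 : (0 < X)%N by rewrite divn_gt0; lia.
  have e2 : (N < X.+1 * (2 * v))%N by apply: ltn_ceil; lia.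
  have e3 : (N <= 4 * (v * X))%N by nia.
  have XN : (X <= N)%N by exact: leq_div.
  have hh : (2 * h <= X)%N by have := leq_trunc_div X 2; rewrite -/h; lia.
  have hh2 : (X < 2 * h.+1)%N by have := ltn_ceil X (isT : 0 < 2)%N; rewrite -/h; lia.
  have e3R : INR N <= 4 * (INR v * INR X) by rewrite -mult_INR; apply: (@INR_le_mul 4); lia.
  have hhR : 2 * INR h <= INR X by apply: (@INR_mul_le 2); lia.
  apply: (Rle_trans _ (INR X - INR h)).
    apply: (Rmult_le_reg_r (8 * INR v)); first lra.
    have -> : INR N / (8 * INR v) * (8 * INR v) = INR N by field; lra.
    by nra.
  have -> : INR X - INR h = \rsum_(h.+1 <= x < X.+1) 1.
    by rewrite rsum_nat_const ?S_INR; [ring|lia].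
  apply: (@rsum_range_sub N.+1 h.+1 X.+1 (fun x => (N %/ (2 * v) < 2 * x) && (x <= N %/ (2 * v)))%N (fun=> 1)) => //.
    by move=> x /andP [x1 x2]; rewrite -/X; lia.
  by move=> _; lra.
apply: (Rle_trans _ (\big[Rplus/0]_(z | @coprime_pair N z) (kap4 * (INR N * INR N / 64) * / (INR z.2 * INR z.2)))); last first.
  apply: rsum_le => [[u v]] /and4P [/= h1 h2 h3 h4].
  have v0 : (0 < v)%N by lia.
  have v0R := INR_gt0 v0.
  have hqv := hq v v0 h3.
  have q0 : 0 <= INR N / (8 * INR v) by apply: Rdiv_le_0_compat; lra.
  have -> : kap4 * (INR N * INR N / 64) * / (INR v * INR v) = kap4 * (INR N / (8 * INR v) * (INR N / (8 * INR v))) by field; lra.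
  apply: Rmult_le_compat_l; first lra.
  exact: Rmult_le_compat.
rewrite rsumMl.
have hcop := coprime_sum_ge N; have hany := any_pair_sum_ge hN.
have hcop2 : (ln (INR N) - 3) / 16 <= \big[Rplus/0]_(z | @coprime_pair N z) / (INR z.2 * INR z.2).
  by move: hcop hany; set S1 := bigop.body _ _ _; set S2 := bigop.body _ _ _; lra.
have e : pw (INR N) (2 - 8 * s) = w0 * w0 * (w0 * w0) * (INR N * INR N).
  rewrite -(pw_2 (Rlt_le _ _ N0)) /w0 -!pwD; congr pw; ring.
have -> : c4 / 1024 * pw (INR N) (2 - 8 * s) * (ln (INR N) - 3) =
  kap4 * (INR N * INR N / 64) * ((ln (INR N) - 3) / 16) by rewrite e /kap4 /c4; field.
apply: Rmult_le_compat_l => //.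
by apply: Rmult_le_pos; [lra|nra].
Qed.

(** * Assembling the cases *)

Definition lower p s (G : nat -> R) := exists c, 0 < c /\ forall N, (2 <= N)%N ->
  0 <= G N /\ pw (c * G N) p <= RInt (fun x => pw (Cmod (T s N x)) p) 0 1.

Lemma lesssim_of_upper p s G H : 0 < p -> (forall N, (2 <= N)%N -> G N = H N) ->
  upper p s G -> lesssim (normT s p) H.
Proof.
move=> hp e [C1 [C10 h]]; exists C1; split => // N /leP hN.
by rewrite -e //; apply: normT_le => //; exact: h.
Qed.

Lemma lesssim_of_lower p s G H : 0 < p -> (forall N, (2 <= N)%N -> G N = H N) ->
  lower p s G -> lesssim H (normT s p).
Proof.
move=> hp e [c [c0 h]]; exists (/ c); split; first exact: Rinv_0_lt_compat.
move=> N /leP hN; rewrite -e //; have [g0 hi] := h N hN.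
apply: (Rmult_le_reg_l c) => //; rewrite -Rmult_assoc Rinv_r ?Rmult_1_l; last lra.
by apply: normT_ge => //; apply: Rmult_le_pos; lra.
Qed.

Lemma simeq_of_lesssim F H : lesssim F H -> lesssim H F -> simeq F H.
Proof.
move=> [C1 [C10 h1]] [C2 [C20 h2]]; exists (/ C2), C1.
split; first exact: Rinv_0_lt_compat.
split => // N hN; split; last exact: h1.
apply: (Rmult_le_reg_l C2) => //; rewrite -Rmult_assoc Rinv_r ?Rmult_1_l; last lra.
exact: h2.
Qed.

Lemma simeq_intro p s G1 G2 H : 0 < p -> (forall N, (2 <= N)%N -> G1 N = H N) ->
  (forall N, (2 <= N)%N -> G2 N = H N) -> upper p s G1 -> lower p s G2 -> simeq (normT s p) H.
Proof.
move=> hp e1 e2 hu hl; apply: simeq_of_lesssim; first exact: lesssim_of_upper hu.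
exact: lesssim_of_lower hl.
Qed.

(** When the second moment is at least of size X^2 and the L^3 norm at most of size X,
    [lower_from_L2] transfers the size X to every exponent. *)
Lemma lower_of_square_sum p s X : 0 < p -> (forall N, (2 <= N)%N -> 0 < X N) ->
  (exists c, 0 < c /\ forall N, (2 <= N)%N ->
     c * (X N * X N) <= \rsum_(1 <= n < N.+1) pw (INR n) (- (4 * s))) ->
  upper 3 s X -> lower p s X.
Proof.
move=> hp X0 [c [c0 hc]] [C1 [C10 hC]].
have [c' [c'0 h]] := lower_from_L2 hp c0 C10.
exists c'; split => // N hN; split; first by left; exact: X0.
apply: h; [exact: X0|exact: contC_T| |by move=> _; exact: hC].
by apply: Rle_trans (hc N hN) _; exact: T_L2_ge.
Qed.

Lemma INR_pow_gt0 N e : (2 <= N)%N -> 0 < pw (INR N) e.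
Proof. by move=> h; apply: pw_gt0; apply: INR_gt0; lia. Qed.

Lemma upper_ext p s G H : (forall N, G N = H N) -> upper p s G -> upper p s H.
Proof. by move=> e [C1 [C10 h]]; exists C1; split => // N hN; rewrite -e; exact: h. Qed.

(** The tent estimates need an exponent above 2, so the comparison goes through max(p, 3), still
    below 4. *)
Lemma upper_sub4 p s : 0 < p < 4 -> s < 1/4 -> upper p s (fun N => pw (INR N) (1/2 - 2 * s)).
Proof.
move=> hp hs.
have [hr1 hr2] : 2 < Rmax p 3 < 4 /\ p <= Rmax p 3.
  by rewrite /Rmax; case: (Rle_dec p 3) => h; lra.
apply: (@upper_exponent p (Rmax p 3)); [lra|lra|by move=> N; exact: INR_pow_gt0|].
by apply: (upper_ext _ (upper_lt4 hr1 hs)) => N; rewrite Rmult_1_l.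
Qed.

Lemma upper_quarter_sub4 p : 0 < p < 4 -> upper p (1/4) (fun N => pw (ln (INR N)) (1/2)).
Proof.
move=> hp.
have [hr1 hr2] : 2 < Rmax p 3 < 4 /\ p <= Rmax p 3.
  by rewrite /Rmax; case: (Rle_dec p 3) => h; lra.
apply: (@upper_exponent p (Rmax p 3)); [lra|lra| |].
  by move=> N hN; apply: pw_gt0; have := ln_ge_half hN; lra.
apply: upper_critical_log; first lra.
have -> : 2 * (1/4) = 1/2 by field.
exact: sharp_rate_lt4.
Qed.

(** Some r >= p with 4 < r has decaying block norms, and norms are then compared. For s < 1/2 it is
    the midpoint of max(p, 4) and the critical exponent q, which exceeds 4; for s >= 1/2 it is
    max(p, 5). *)
Lemma upper_one p s : 0 < p -> 1/4 < s -> (s < 1/2 -> p < 2 / (1 - 2 * s)) -> upper p s (fun=> 1).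
Proof.
move=> hp hs hcrit; have one0 : forall N, (2 <= N)%N -> 0 < 1 by move=> *; lra.
have main r : p <= r -> 4 < r -> 1 - 2 * s < 2 / r -> upper p s (fun=> 1).
  move=> h1 h2 h3; apply: (@upper_exponent p r) => //.
  by apply: upper_bounded => //; lra.
case: (Rle_dec (1/2) s) => h2.
  apply: (main (Rmax p 5)); rewrite /Rmax; case: (Rle_dec p 5) => h; try lra.
  by have : 0 < 2 / p by [apply: Rdiv_lt_0_compat; lra]; lra.
have hlt : 0 < 1 - 2 * s by lra.
have hc := hcrit ltac:(lra); set q := 2 / (1 - 2 * s) in hc.
have hq : q * (1 - 2 * s) = 2 by rewrite /q; field; lra.
have hq4 : 4 < q by nra.
have [r [r1 [r2 r3]]] : exists r, p <= r /\ 4 < r /\ r < q.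
  exists ((Rmax p 4 + q) / 2).
  by rewrite /Rmax; case: (Rle_dec p 4) => h; lra.
apply: (main r) => //; apply: (Rmult_lt_reg_r r); first lra.
have -> : 2 / r * r = 2 by field; lra.
by have := Rmult_lt_compat_l _ _ _ hlt r3; lra.
Qed.

Lemma lower_sub_quarter p s : 0 < p -> s < 1/4 -> lower p s (fun N => pw (INR N) (1/2 - 2 * s)).
Proof.
move=> hp hs; apply: lower_of_square_sum => //; last by apply: upper_sub4; lra.
  by move=> N; exact: INR_pow_gt0.
have [c [c0 hc]] := psum_ge (4 * s); exists c; split => // N hN.
rewrite -pwD (_ : 1/2 - 2 * s + (1/2 - 2 * s) = 1 - 4 * s); last by field.
by apply: hc; lia.
Qed.

Lemma lower_quarter p : 0 < p -> lower p (1/4) (fun N => pw (ln (INR N)) (1/2)).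
Proof.
move=> hp; apply: lower_of_square_sum => //; last by apply: upper_quarter_sub4; lra.
  by move=> N hN; apply: pw_gt0; have := ln_ge_half hN; lra.
exists 1; split => [|N hN]; first lra.
have hl := ln_ge_half hN.
rewrite pw_half ?Rmult_1_l; last lra.
have n0 : 0 < INR N by apply: INR_gt0; lia.
have h1 : ln (INR N) <= ln (INR N.+1) by apply: ln_le => //; apply: le_INR; lia.
apply: Rle_trans h1 _; apply: Rle_trans (harmonic_ge N) _; right.
apply: eq_big_nat => n /andP [n1 _]; have n10 := INR_gt0 n1.
by rewrite (_ : 4 * (1/4) = 1) ?pwN ?pw_1 //; [lra|field].
Qed.

Lemma lower_one p s : 0 < p -> 1/4 < s -> lower p s (fun=> 1).
Proof.
move=> hp hs; apply: lower_of_square_sum => //.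
- by move=> *; lra.
- exists 1; split => [|N hN]; first lra.
  rewrite big_ltn ?INR_1 ?pw1; last by lia.
  rewrite !Rmult_1_r -[X in X <= _]Rplus_0_r; apply: Rplus_le_compat_l.
  by apply: rsum_ge0 => n _; exact: pw_ge0.
apply: upper_one => //; first lra.
move=> h2; apply: (Rmult_lt_reg_r (1 - 2 * s)); first lra.
by have -> : 2 / (1 - 2 * s) * (1 - 2 * s) = 2; [field; lra|lra].
Qed.

Lemma lower_super p s : 0 < p -> lower p s (fun N => pw (INR N) (1 - 2 / p - 2 * s)).
Proof.
move=> hp; have [c [c0 h]] := lower_origin s hp; exists c; split => // N hN.
by split; [exact: pw_ge0|exact: h].
Qed.

Lemma lower_critical_norm p s : 2 < p -> 2 * s + 2 / p = 1 ->
  lower p s (fun N => pw (ln (INR N)) (/ p)).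
Proof.
move=> hp hs; have [c [c0 h]] := lower_critical hp hs.
exists (pw c (/ p)); split; first exact: pw_gt0.
move=> N hN; have hl := ln_ge_half hN; split; first exact: pw_ge0.
rewrite -pwM ?pwA ?Rinv_l ?pw_1; try lra; first exact: h.
by apply: Rmult_le_pos; lra.
Qed.

(** The count gives ln N - 3, which is at least half of ln N once ln N >= 6; for smaller N the
    logarithm is bounded and [lower_sub_quarter] suffices. *)
Lemma lower_fourth s : s < 1/4 ->
  lower 4 s (fun N => pw (INR N) (1/2 - 2 * s) * pw (ln (INR N)) (1/4)).
Proof.
move=> hs; have [c1 [c10 h1]] := lower_fourth_log s.
have [c2 [c20 h2]] := @lower_sub_quarter 4 s ltac:(lra) hs.
pose c3 := pw c2 4; have c30 : 0 < c3 by exact: pw_gt0.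
pose c := c1 * c3 / (6 * (c1 + c3)).
have c0 : 0 < c by apply: Rdiv_lt_0_compat; nra.
exists (pw c (1/4)); split; first exact: pw_gt0.
move=> N hN; have hl := ln_ge_half hN; have n0 : 0 < INR N by apply: INR_gt0; lia.
split; first by apply: Rmult_le_pos; exact: pw_ge0.
have q1 := pw_ge0 c (1/4); have q2 := pw_ge0 (INR N) (1/2 - 2 * s); have q3 := pw_ge0 (ln (INR N)) (1/4).
rewrite pwM //; last by apply: Rmult_le_pos.
rewrite pwM // !pwA (_ : 1/4 * 4 = 1); last by field.
rewrite (_ : (1/2 - 2 * s) * 4 = 2 - 8 * s); last by field.
rewrite !pw_1; try lra.
have {}h1 := h1 N hN; have [_ {}h2] := h2 N hN.
rewrite pwM // in h2; last lra.
rewrite pwA (_ : (1/2 - 2 * s) * 4 = 2 - 8 * s) -/c3 in h2; last by field.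
set a := pw (INR N) (2 - 8 * s) in h1 h2 *.
have a0 : 0 < a by exact: pw_gt0.
set I := RInt _ 0 1 in h1 h2 *.
have hcc1 : 6 * c <= c1.
  have -> : c1 = 6 * c + c1 * c1 / (c1 + c3) by rewrite /c; field; lra.
  by have : 0 < c1 * c1 / (c1 + c3) by [apply: Rdiv_lt_0_compat; nra]; lra.
have hcc3 : 6 * c <= c3.
  have -> : c3 = 6 * c + c3 * c3 / (c1 + c3) by rewrite /c; field; lra.
  by have : 0 < c3 * c3 / (c1 + c3) by [apply: Rdiv_lt_0_compat; nra]; lra.
case: (Rle_dec (ln (INR N)) 6) => h6.
  apply: Rle_trans h2.
  have -> : c * (a * ln (INR N)) = c * ln (INR N) * a by ring.
  by apply: Rmult_le_compat_r; nra.
apply: Rle_trans h1.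
have -> : c * (a * ln (INR N)) = c * ln (INR N) * a by ring.
have -> : c1 * a * (ln (INR N) - 3) = c1 * (ln (INR N) - 3) * a by ring.
by apply: Rmult_le_compat_r; nra.
Qed.

Theorem theorem4p4 (s p : R) (hp : 0 < p) :
  (s < 1/4 ->
     (p < 4 -> simeq (normT s p) (fun N => Rpower (INR N) (1/2 - 2 * s))) /\
     (p = 4 -> simeq (normT s p)
                 (fun N => Rpower (INR N) (1/2 - 2 * s) * Rpower (ln (INR N)) (1/4))) /\
     (4 < p -> simeq (normT s p) (fun N => Rpower (INR N) (1 - 2 / p - 2 * s)))) /\
  (s = 1/4 ->
     (p < 4 -> simeq (normT s p) (fun N => Rpower (ln (INR N)) (1/2))) /\
     (4 < p -> simeq (normT s p) (fun N => Rpower (INR N) (1/2 - 2 / p))) /\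
     (p = 4 -> lesssim (fun N => Rpower (ln (INR N)) (1/2)) (normT s p) /\
               lesssim (normT s p) (fun N => Rpower (ln (INR N)) (3/4)))) /\
  (1/4 < s < 1/2 ->
     (p < 2 / (1 - 2 * s) -> simeq (normT s p) (fun _ => 1)) /\
     (2 / (1 - 2 * s) < p -> simeq (normT s p) (fun N => Rpower (INR N) (1 - 2 / p - 2 * s))) /\
     (p = 2 / (1 - 2 * s) ->
        lesssim (fun N => Rpower (ln (INR N)) (1 / p)) (normT s p) /\
        lesssim (normT s p) (fun N => Rpower (ln (INR N)) (1/2)))) /\
  (1/2 <= s -> simeq (normT s p) (fun _ => 1)).
Proof.
have eN e N : (2 <= N)%N -> pw (INR N) e = Rpower (INR N) e.
  by move=> hN; rewrite pwE //; apply: INR_gt0; lia.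
have eL e N : (2 <= N)%N -> pw (ln (INR N)) e = Rpower (ln (INR N)) e.
  by move=> hN; rewrite pwE //; have := ln_ge_half hN; lra.
split.
  move=> hs; split => [h4|]; last split => [->|h4].
  - apply: (simeq_intro hp _ _ (upper_sub4 (conj hp h4) hs) (lower_sub_quarter hp hs)) => N hN; exact: eN.
  - apply: (simeq_intro _ _ _ (upper_4 hs) (lower_fourth hs)) => [|N hN|N hN]; first lra.
      by rewrite eN // eL // Rmult_comm.
    by rewrite eN // eL.
  - have h2p : 2 / p < 1/2 by apply: (Rmult_lt_reg_r p) => //; have -> : 2 / p * p = 2; [field|]; lra.
    have he : 0 < 1 - 2 / p - 2 * s by lra.
    apply: (simeq_intro hp _ _ (upper_gt4 h4 he) (lower_super s hp)) => N hN; last exact: eN.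
    by rewrite Rmult_1_l eN.
split.
  move=> ->; split => [h4|]; last split => [h4|->].
  - apply: (simeq_intro hp _ _ (upper_quarter_sub4 (conj hp h4)) (lower_quarter hp)) => N hN; exact: eL.
  - have h2p : 2 / p < 1/2 by apply: (Rmult_lt_reg_r p) => //; have -> : 2 / p * p = 2; [field|]; lra.
    have he : 0 < 1 - 2 / p - 2 * (1/4) by lra.
    have e0 : 1/2 - 2 / p = 1 - 2 / p - 2 * (1/4) by field; lra.
    rewrite e0.
    apply: (simeq_intro hp _ _ (upper_gt4 h4 he) (lower_super (1/4) hp)) => N hN; last exact: eN.
    by rewrite Rmult_1_l eN.
  - have h4 : 0 < 4 by lra.
    split; first by apply: (lesssim_of_lower h4 _ (lower_quarter h4)) => N hN; exact: eL.
    apply: (lesssim_of_upper h4 _ upper_quarter_4) => N hN.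
    by rewrite pwA (_ : 3/2 * (1/2) = 3/4); [exact: eL|field].
split.
  move=> [hs1 hs2]; have hlt : 0 < 1 - 2 * s by lra.
  have hq : 2 / (1 - 2 * s) * (1 - 2 * s) = 2 by field; lra.
  (* This is where s > 1/4 enters; at and above the critical exponent only the rate for p > 4 is
     then needed. *)
  have hq4 : 4 < 2 / (1 - 2 * s).
    by apply: (Rmult_lt_reg_r (1 - 2 * s)) => //; rewrite hq; lra.
  split => [hlow|]; last split => [hhigh|hcrit].
  - by apply: (simeq_intro hp _ _ (upper_one hp hs1 (fun=> hlow)) (lower_one hp hs1)).
  - have h4 : 4 < p by lra.
    have he : 0 < 1 - 2 / p - 2 * s.
      suff : 2 / p < 1 - 2 * s by lra.
      apply: (Rmult_lt_reg_r p) => //; have -> : 2 / p * p = 2 by field; lra.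
      by have := Rmult_lt_compat_l _ _ _ hlt hhigh; lra.
    apply: (simeq_intro hp _ _ (upper_gt4 h4 he) (lower_super s hp)) => N hN; last exact: eN.
    by rewrite Rmult_1_l eN.
  - have h4 : 4 < p by lra.
    have e2 : 2 / p = 1 - 2 * s by rewrite hcrit; field; lra.
    have h2 : 2 < p by lra.
    have hs' : 2 * s + 2 / p = 1 by lra.
    (* At the critical exponent 2s = 1 - 2/p, so the weights cancel the growth of the blocks
       exactly. *)
    have hS : sharp_rate p (pw 2 (2 * s)) (fun=> 1).
      have -> : 2 * s = 1 - 2 / p by lra.
      exact: sharp_rate_gt4.
    split.
      apply: (lesssim_of_lower hp _ (lower_critical_norm h2 hs')) => N hN.
      by rewrite eL // /Rdiv Rmult_1_l.
    by apply: (lesssim_of_upper hp _ (upper_critical_log h2 hS)) => N hN; exact: eL.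
move=> hs; have hs1 : 1/4 < s by lra.
(* For s >= 1/2 the condition on p is vacuous. *)
have hno : s < 1/2 -> p < 2 / (1 - 2 * s) by move=> h; lra.
by apply: (simeq_intro hp _ _ (upper_one hp hs1 hno) (lower_one hp hs1)).
Qed.
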